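(* With the notation of the context: (1) $\displaystyle \mathcal O_U=\bigoplus_{\lambda\in\mathcal P_{r,n}}\ \bigoplus_{T\in NST(\lambda)}\mathcal D_V F_T$ (as $\mathcal D_V$-modules); (2) $\displaystyle \mathcal O_U\cong\bigoplus_{\lambda\in\mathcal P_{r,n}} f^{\lambda}\,\mathcal D_V F_\lambda$ as $\mathcal D_V$-modules, i.e. $\mathcal O_U$ is isomorphic to the direct sum over $\lambda$ of $f^\lambda$ copies of $\mathcal D_VF_\lambda$, where $f^\lambda=\dim_{\mathbb C}V^{S_0}(\lambda)$.
   Context: Setting. Let $n_1,\dots,n_r$ be positive integers, $n=\sum_i n_i$, $m_i=n_1+\cdots+n_{i-1}$ (so $m_1=0$), and $B_i=\{m_i+1,\dots,m_i+n_i\}$. The group $S_{n_1}\times\cdots\times S_{n_r}\subset S_n$ (the $i$-th factor permuting $B_i$) acts on $\mathcal O_X=\mathbb C[x_1,\dots,x_n]$ by $(\sigma f)(x_1,\dots,x_n)=f(x_{\sigma(1)},\dots,x_{\sigma(n)})$. Write $\mathcal O_Y=\mathcal O_X^{S_{n_1}\times\cdots\times S_{n_r}}=\mathbb C[y_1,\dots,y_n]$, where the $y_j$ with $j\in B_i$ are algebraically independent generators (e.g. the elementary symmetric polynomials) of $\mathbb C[x_j: j\in B_i]^{S_{n_i}}$. Put $\Delta_i=\prod_{k<l,\ k,l\in B_i}(x_k-x_l)$, $\Delta=\prod_i\Delta_i$, $\mathcal O_U=\mathbb C[x_1,\dots,x_n,\Delta^{-1}]$, $\mathcal O_V=\mathbb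 C[y_1,\dots,y_n,\Delta^{-2}]$, and $\mathcal D_V=\mathbb C\langle y_1,\dots,y_n,\partial/\partial y_1,\dots,\partial/\partial y_n,\Delta^{-2}\rangle$ (the localized Weyl algebra). $\mathcal O_U$ is a left $\mathcal D_V$-module: $\mathcal O_V$ acts by multiplication and $\partial/\partial y_j$ acts by the unique extension of this derivation of $\mathcal O_V$ to $\mathcal O_U$ (which is finite étale over $\mathcal O_V$). Tableaux. $\mathcal P_{r,n}$ is the set of $r$-diagrams of type $(n_1,\dots,n_r)$, i.e. $r$-tuples $\lambda=(\lambda^1,\dots,\lambda^r)$ of partitions with $\lambda^i\vdash n_i$. $NST(\lambda)$ is the set of natural standard $r$-tableaux $T=(T^1,\dots,T^r)$ of shape $\lambda$: $T^i$ is a filling of $\lambda^i$ with the numbers of $B_i$, each used once, with strictly increasing rows and columns. Young symmetrizers. $e_{T^i}=\frac{f^{\lambda^i}}{n_i!}\sum_{\sigma\in R(T^i),\ \tau\in C(T^i)}\operatorname{sgn}(\tau)\,\tau\sigma$, where $R(T^i)$, $C(T^i)$ are the row and column stabilizers and $f^{\lambda^i}$ is the number of standard tableaux of shape $\lambda^i$; $e_T=e_{T^1}\cdots e_{T^r}$. Higher Specht polynomials. For a standard tableau $S^i$ of shape $\lambda^i$ with entries $B_i$, the word $w(S^i)$ is obtained by reading each column from bottom to top, starting from the left. The smallest entry has index $0$; if $k$ has index $p$, then $k+1$ has index $p$ if it lies to the right of $k$ in $w(S^i)$ and $p+1$ if it lies to the left. Replacing entries by indices gives $i(S^i)$. Put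 $x_{T^i}^{i(S^i)}=\prod_b x_{T^i(b)}^{i(S^i)(b)}$ (product over the boxes $b$ of $\lambda^i$) and $F_{T^i}^{S^i}=e_{T^i}(x_{T^i}^{i(S^i)})$. Let $S_0=(S_0^1,\dots,S_0^r)\in NST(\lambda)$, where $S_0^i$ is the canonical standard tableau of shape $\lambda^i$, whose cells are numbered (with the elements of $B_i$ in increasing order) from left to right in successive rows starting from the top. For $T\in NST(\lambda)$ put $F_T:=F_T^{S_0}:=F_{T^1}^{S_0^1}\cdots F_{T^r}^{S_0^r}$, $F_\lambda:=F_{S_0}^{S_0}$, and let $V^{S_0}(\lambda)$ be the $\mathbb C$-span of $\{F_T^{S_0}: T\in NST(\lambda)\}$. *)

(* Defs.v *)
From HB Require Import structures.
From mathcomp Require Import all_boot all_order all_algebra all_fingroup.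
From mathcomp Require Import fraction.
From mathcomp Require Import mpoly.
From mathcomp Require Import boolp classical_sets.

Set Implicit Arguments.
Unset Strict Implicit.
Unset Printing Implicit Defensive.

Import GRing.Theory.
Local Open Scope ring_scope.

Local Notation "x %:F" := (@FracField.tofrac _ x).

Section Modules.

Variables (A : pzRingType) (M : lmodType A).

Definition cyclic_submod (v u : M) : Prop := exists a : A, u = a *: v.

Definition is_direct_sum (I : finType) (W : I -> M -> Prop) : Prop :=
  forall u : M, exists! g : {ffun I -> M},
    (forall k, W k (g k)) /\ u = \sum_k g k.

(* The external direct sum of a finite family of submodules W k of M is the   *)
(* submodule of M^I made of the families g such that g k lies in W k.         *)
Definition iso_direct_sum (I : finType) (W : I -> M -> Prop) : Prop :=
  exists phi : {linear M -> {ffun I -> M}},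
    injective phi /\
    (forall g, (exists u, phi u = g) <-> (forall k, W k (g k))).

End Modules.

Arguments is_direct_sum {A} M {I} W.
Arguments iso_direct_sum {A} M {I} W.

Section Dimension.

Variables (F : fieldType) (V : lmodType F).

Definition is_basis (W : V -> Prop) (d : nat) (b : 'I_d -> V) : Prop :=
  (forall w, W w <-> exists c : 'I_d -> F, w = \sum_k c k *: b k) /\
  (forall c : 'I_d -> F, \sum_k c k *: b k = 0 -> forall k, c k = 0).

(* The size of a basis of W; the default value 0 is never reached when W is   *)
(* a finite-dimensional subspace.                                             *)
Definition dimension (W : V -> Prop) : nat :=
  xget 0%N [set d | exists b : 'I_d -> V, is_basis W b]%classic.

Definition span_of (I : finType) (v : I -> V) (w : V) : Prop :=
  exists c : I -> F, w = \sum_k c k *: v k.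

Lemma is_basis_le W d d' (b : 'I_d -> V) (b' : 'I_d' -> V) :
  is_basis W b -> is_basis W b' -> (d <= d')%N.
Proof.
move=> [Wb fb] [Wb' fb'].
have get e (v : 'I_e -> V) (k : 'I_e) : v k = \sum_l (l == k)%:R *: v l.
  rewrite (bigD1 k) //= eqxx scale1r big1 ?addr0 // => l /negPf ->.
  by rewrite scale0r.
have inW k : W (b k) by apply/Wb; exists (fun l => (l == k)%:R); apply: get.
have inW' k : W (b' k) by apply/Wb'; exists (fun l => (l == k)%:R); apply: get.
have [P PE] : {P : 'I_d -> 'I_d' -> F & forall k, b k = \sum_l P k l *: b' l}.
  by apply: (@choice _ _ (fun k c => b k = \sum_l c l *: b' l)) => k; apply/Wb'.
have [Q QE] : {Q : 'I_d' -> 'I_d -> F & forall k, b' k = \sum_l Q k l *: b l}.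
  by apply: (@choice _ _ (fun k c => b' k = \sum_l c l *: b l)) => k; apply/Wb.
apply: (@mulmx1_min F _ _ (\matrix_(i, j) P i j) (\matrix_(i, j) Q i j)).
apply/matrixP => i j; rewrite !mxE; apply/eqP; rewrite -subr_eq0; apply/eqP.
move: j; apply: (fb (fun j => _)).
under eq_bigr => j _ do rewrite scalerBl.
rewrite sumrB; apply/eqP; rewrite subr_eq0; apply/eqP.
have -> : \sum_(k < d) (i == k)%:R *: b k = b i.
  by rewrite [RHS]get; apply: eq_bigr => k _; rewrite eq_sym.
under eq_bigr => j _ do rewrite scaler_suml.
rewrite exchange_big PE; apply: eq_bigr => k _.
rewrite QE scaler_sumr; apply: eq_bigr => l _.
by rewrite !mxE scalerA.
Qed.

Lemma dimensionE W d (b : 'I_d -> V) : is_basis W b -> dimension W = d.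
Proof.
move=> bW; rewrite /dimension; case: xgetP => [e _ [b' b'W]|/(_ d)]; last first.
  by case; exists b.
by apply/eqP; rewrite eqn_leq (is_basis_le b'W bW) (is_basis_le bW b'W).
Qed.

Lemma dimension_span (I : finType) (v : I -> V) :
  exists b : 'I_(dimension (span_of v)) -> V, is_basis (span_of v) b.
Proof.
suff [d [b bP]] : exists d, exists b : 'I_d -> V, is_basis (span_of v) b.
  by rewrite (dimensionE bP); exists b.
pose gen (A : {set I}) := `[< forall k, exists2 c : I -> F,
  (forall l, l \notin A -> c l = 0) & v k = \sum_l c l *: v l >].
have genT : gen [set: I].
  apply/asboolP => k; exists (fun l => (l == k)%:R) => [l|]; first by rewrite inE.
  rewrite (bigD1 k) //= eqxx scale1r big1 ?addr0 // => l /negPf ->.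
  by rewrite scale0r.
case: (arg_minnP (fun A : {set I} => #|A|) genT) => A /asboolP gA minA.
exists #|A|, (fun k => v (enum_val k)); split => [w|c c0 k].
  split=> [[c ->]|[c ->]]; last first.
    exists (fun l => if [pick k | enum_val k == l] is Some k then c k else 0).
    rewrite [RHS](bigID (mem A)) /= [X in _ = _ + X]big1 ?addr0 => [|l lA].
      rewrite [RHS]big_enum_val /=; apply: eq_bigr => k _.
      case: pickP => [k' /eqP/enum_val_inj -> //|/(_ k)]; by rewrite eqxx.
    case: pickP => [k /eqP kl|_]; last by rewrite scale0r.
    by rewrite -kl enum_valP in lA.
  have [P PE] : {P : I -> I -> F & forall k,
      (forall l, l \notin A -> P k l = 0) /\ v k = \sum_l P k l *: v l}.
    apply: (@choice _ _ (fun k c => (forall l, l \notin A -> c l = 0) /\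
      v k = \sum_l c l *: v l)) => k.
    by have [e] := gA k; exists e.
  exists (fun l => \sum_k c k * P k (enum_val l)).
  transitivity (\sum_(l in A) (\sum_k c k * P k l) *: v l); last first.
    by rewrite [LHS]big_enum_val.
  under [RHS]eq_bigr => l _ do rewrite scaler_suml.
  rewrite exchange_big /=; apply: eq_bigr => k _.
  have [P0 {1}->] := PE k.
  rewrite (bigID (mem A)) /= [X in _ + X]big1 ?addr0 => [|l lA].
    by rewrite scaler_sumr; apply: eq_bigr => l _; rewrite scalerA.
  by rewrite P0 // scale0r.
apply/eqP/negPn/negP => ck.
have {}c0 : v (enum_val k) =
    \sum_(l | l != k) (- (c k)^-1 * c l) *: v (enum_val l).
  rewrite (bigD1 k) //= in c0; move/eqP: c0; rewrite addr_eq0 => /eqP c0.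
  apply: (scalerI ck); rewrite c0 scaler_sumr -sumrN; apply: eq_bigr => l _.
  by rewrite scalerA mulrA mulrN mulfV // mulN1r scaleNr.
have : gen (A :\ enum_val k).
  apply/asboolP => j; have [e e0 ->] := gA j.
  pose g l := if l == enum_val k then 0 else
     if [pick h | enum_val h == l] is Some h
     then e l + e (enum_val k) * (- (c k)^-1 * c h) else 0.
  have gE h : h != k -> g (enum_val h) =
      e (enum_val h) + e (enum_val k) * (- (c k)^-1 * c h).
    move=> hk; rewrite /g (inj_eq enum_val_inj) (negPf hk).
    case: pickP => [h' /eqP/enum_val_inj -> //|/(_ h)]; by rewrite eqxx.
  have gk0 : g (enum_val k) = 0 by rewrite /g eqxx.
  have g0 l : l \notin A -> g l = 0.
    move=> lA; rewrite /g; case: eqP => // _; case: pickP => // h /eqP hl.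
    by rewrite -hl enum_valP in lA.
  exists g => [l|].
    rewrite !inE negb_and negbK; case: eqP => [-> _|_ /=]; last exact: g0.
    exact: gk0.
  have red (f : I -> F) : (forall l, l \notin A -> f l = 0) ->
      \sum_l f l *: v l = \sum_(h < #|A|) f (enum_val h) *: v (enum_val h).
    move=> f0; rewrite (bigID (mem A)) /= [X in _ + X]big1 ?addr0 => [|l lA].
      by rewrite [LHS]big_enum_val.
    by rewrite f0 // scale0r.
  rewrite !red // [LHS](bigD1 k) // [RHS](bigD1 k) //=.
  rewrite gk0 scale0r add0r {1}c0 scaler_sumr -big_split /=.
  by apply: eq_bigr => h hk; rewrite gE // scalerDl addrC scalerA.
move=> /minA; rewrite (cardsD1 (enum_val k) A) enum_valP /= add1n.
by rewrite ltnn.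
Qed.

End Dimension.

(* Partitions of m, padded with zeros to exactly m parts.                     *)
Definition is_part (m : nat) (p : {ffun 'I_m -> 'I_m.+1}) : bool :=
  [forall a : 'I_m, forall b : 'I_m, (a <= b)%N ==> (p b <= p a)%N] &&
  (\sum_a p a == m)%N.

Definition part (m : nat) : finType :=
  {p : {ffun 'I_m -> 'I_m.+1} | is_part p}.

(* Boxes are pairs (row, column), numbered from 0.                            *)
Definition box (m : nat) (p : part m) : finType :=
  {b : 'I_m * 'I_m | (b.2 < sval p b.1)%N}.

Definition brow m (p : part m) (b : box p) : nat := (sval b).1.
Definition bcol m (p : part m) (b : box p) : nat := (sval b).2.

(* Index of the entry s + j in the word w, where s is the smallest entry.     *)
Fixpoint entry_index (w : seq nat) (s j : nat) : nat :=
  if j is j'.+1 then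
    (entry_index w s j' + (index (s + j) w < index (s + j') w))%N
  else 0%N.

Section Specht.

Variables (F : fieldType) (r : nat) (n : 'I_r -> nat).

Definition nvars : nat := (\sum_(i < r) n i)%N.

Local Notation N := nvars.
Local Notation OX := {mpoly F[N]}.

Definition offset (i : 'I_r) : nat := (\sum_(k < r | (k < i)%N) n k)%N.

(* Variables are numbered from 0, so the i-th block is the set of the         *)
(* j with offset i <= j < offset i + n i.                                     *)
Definition block (i : 'I_r) : {set 'I_N} :=
  [set j : 'I_N | (offset i <= j < offset i + n i)%N].

Definition block_Delta (i : 'I_r) : OX :=
  \prod_(k in block i) \prod_(l in block i | (k < l)%N) ('X_k - 'X_l).

Definition Delta : OX := \prod_i block_Delta i.

Definition diagram : finType := {dffun forall i : 'I_r, part (n i)}.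

Definition filling (i : 'I_r) (p : part (n i)) : finType :=
  {ffun box p -> 'I_N}.

Definition is_standard i (p : part (n i)) (T : filling p) : bool :=
  [&& injectiveb T, [set T b | b : box p] == block i,
      [forall b, forall c, (brow b == brow c) && (bcol b < bcol c)%N
                             ==> (T b < T c)%N] &
      [forall b, forall c, (bcol b == bcol c) && (brow b < brow c)%N
                             ==> (T b < T c)%N]].

Definition NST (lam : diagram) : finType :=
  {T : {dffun forall i : 'I_r, filling (lam i)} |
    [forall i, is_standard (T i)]}.

Definition num_std i (p : part (n i)) : nat :=
  #|[set T : filling p | is_standard T]|.

Definition row_stab i (p : part (n i)) (T : filling p) : {set 'S_N} :=
  [set s | perm_on (block i) s &&
    [forall b, exists c, (brow c == brow b) && (s (T b) == T c)]].

Definition col_stab i (p : part (n i)) (T : filling p) : {set 'S_N} :=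
  [set s | perm_on (block i) s &&
    [forall b, exists c, (bcol c == bcol b) && (s (T b) == T c)]].

(* The action of the Young symmetrizer e_T. Since msym s 'X_k = 'X_(s k),     *)
(* the product (tau sigma) of the group algebra acts as                       *)
(* msym tau \o msym sigma, and not as msym (tau * sigma)%g, because the       *)
(* product of perm is composition from left to right.                         *)
Definition young i (p : part (n i)) (T : filling p) (f : OX) : OX :=
  ((num_std p)%:R / ((n i)`!)%:R) *:
    \sum_(s in row_stab T) \sum_(t in col_stab T)
      (-1) ^+ (odd_perm t) *: msym t (msym s f).

Definition reading_word i (p : part (n i)) (S : filling p) : seq nat :=
  pmap (fun b => omap (fun b' : box p => (S b' : nat)) (insub b))
    [seq (a, c) | c <- enum 'I_(n i), a <- rev (enum 'I_(n i))].

Definition index_tab i (p : part (n i)) (S : filling p) (b : box p) : nat :=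
  entry_index (reading_word S) (offset i) (S b - offset i).

Definition block_specht i (p : part (n i)) (S T : filling p) : OX :=
  young T (\prod_(b : box p) 'X_(T b) ^+ index_tab S b).

Definition canon_val i (p : part (n i)) (b : box p) : nat :=
  (offset i +
    (\sum_(a < n i | (a < brow b)%N) sval p a + bcol b))%N.

Lemma offset_leq i : (offset i + n i <= N)%N.
Proof.
rewrite /offset /nvars [leqRHS](bigID (fun k : 'I_r => (k < i)%N)) /=.
by rewrite leq_add2l (bigD1 i) ?ltnn //= leq_addr.
Qed.

Lemma canon_val_lt i (p : part (n i)) (b : box p) : (canon_val b < N)%N.
Proof.
apply: leq_trans (offset_leq i); rewrite ltn_add2l.
case: p b => p p_part b; case/andP: (p_part) => _ /eqP pE.
rewrite /canon_val -[ltnRHS]pE.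
rewrite [ltnRHS](bigID (fun a : 'I_(n i) => (a < brow b)%N)) /= ltn_add2l.
rewrite (bigD1 (sval b).1) /= ?ltnn //.
by apply: leq_trans (leq_addr _ _); apply: (svalP b).
Qed.

Definition canon_filling i (p : part (n i)) : filling p :=
  [ffun b => Ordinal (canon_val_lt b)].

Definition specht (lam : diagram)
    (T : {dffun forall i : 'I_r, filling (lam i)}) : OX :=
  \prod_i block_specht (canon_filling (lam i)) (T i).

Definition specht_std (lam : diagram) (T : NST lam) : OX := specht (sval T).

Definition canon_tab (lam : diagram) :
    {dffun forall i : 'I_r, filling (lam i)} :=
  [ffun i => canon_filling (lam i)].

Definition specht_canon (lam : diagram) : OX := specht (canon_tab lam).

Definition specht_dim (lam : diagram) : nat :=
  dimension (span_of (@specht_std lam)).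

Definition in_block (i : 'I_r) (f : OX) : Prop :=
  forall m, m \in msupp f -> forall j, j \notin block i -> m j = 0%N.

Definition block_sym (i : 'I_r) (f : OX) : Prop :=
  forall s : 'S_N, perm_on (block i) s -> msym s f = f.

(* For each i, the y_j with j in the i-th block are algebraically             *)
(* independent generators of the symmetric polynomials in that block.         *)
Definition block_generators (y : N.-tuple OX) : Prop :=
  forall i, [/\
    forall j, j \in block i -> in_block i (tnth y j) /\ block_sym i (tnth y j),
    forall f, in_block i f -> block_sym i f ->
      exists2 p, in_block i p & f = p \mPo y &
    forall p, in_block i p -> p \mPo y = 0 -> p = 0].

Lemma Delta_neq0 : Delta != 0.
Proof.
apply/prodf_neq0 => i _; apply/prodf_neq0 => k _; apply/prodf_neq0 => l.
case/andP=> _ kl; rewrite subr_eq0; apply/eqP => /(congr1 (mcoeff U_(k))).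
rewrite !mcoeffX eqxx; case: eqP => [/eqP|_ /eqP]; last by rewrite oner_eq0.
by rewrite eq_mnm1 => /eqP lk; rewrite lk ltnn in kl.
Qed.

Lemma DeltaF_neq0 : Delta%:F != 0.
Proof. by rewrite tofrac_eq0 Delta_neq0. Qed.

Definition in_OU : {pred {fraction OX}} :=
  fun u => `[< exists (f : OX) (k : nat), u = f%:F / Delta%:F ^+ k >].

Fact in_OU_subring : subring_closed in_OU.
Proof.
split.
- by apply/asboolP; exists 1, 0%N; rewrite expr0 divr1 tofrac1.
- move=> _ _ /asboolP[f [k ->]] /asboolP[g [l ->]].
  apply/asboolP; exists (f * Delta ^+ l - g * Delta ^+ k), (k + l)%N.
  rewrite tofracB !tofracM !tofracXn exprD.
  rewrite -mulNr addf_div ?expf_neq0 ?DeltaF_neq0 //.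
  by rewrite mulNr.
- move=> _ _ /asboolP[f [k ->]] /asboolP[g [l ->]].
  apply/asboolP; exists (f * g), (k + l)%N.
  by rewrite tofracM exprD mulf_div.
Qed.

HB.instance Definition _ :=
  GRing.isSubringClosed.Build {fraction OX} in_OU in_OU_subring.

Record OU := MkOU { OU_val : {fraction OX}; _ : OU_val \in in_OU }.

HB.instance Definition _ := [isSub for OU_val].
HB.instance Definition _ := [Choice of OU by <:].
HB.instance Definition _ := [SubChoice_isSubComNzRing of OU by <:].

Fact poly_in_OU (f : OX) : f%:F \in in_OU.
Proof. by apply/asboolP; exists f, 0%N; rewrite expr0 divr1. Qed.

Definition polyU (f : OX) : OU := MkOU (poly_in_OU f).

Fact invDelta_in_OU : (Delta%:F)^-1 \in in_OU.
Proof. by apply/asboolP; exists 1, 1%N; rewrite expr1 tofrac1 div1r. Qed.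

Definition invDelta : OU := MkOU invDelta_in_OU.

Definition is_derivation (d : OU -> OU) : Prop :=
  (forall c : F, d (polyU c%:MP) = 0) /\
  (forall u v, d (u * v) = d u * v + u * d v).

(* Copy of OU carrying the left DV y dy-module structure defined below.       *)
Definition OU_mod (y : N.-tuple OX) (dy : 'I_N -> {additive OU -> OU}) : Type :=
  OU.

HB.instance Definition _ y dy := GRing.Zmodule.on (@OU_mod y dy).

Section DV.

Variables (y : N.-tuple OX) (dy : 'I_N -> {additive OU -> OU}).

(* The localized Weyl algebra F<y, d/dy, Delta^-2>, as an algebra of          *)
(* operators on OU; its action on OU is faithful since the localized Weyl     *)
(* algebra is simple in characteristic 0.                                     *)
Inductive DV_op : (OU -> OU) -> Prop :=
| DV_const (c : F) : DV_op (fun u => polyU c%:MP * u)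
| DV_y j : DV_op (fun u => polyU (tnth y j) * u)
| DV_invDelta2 : DV_op (fun u => invDelta ^+ 2 * u)
| DV_dy j : DV_op (dy j)
| DV_add P Q : DV_op P -> DV_op Q -> DV_op (fun u => P u + Q u)
| DV_comp P Q : DV_op P -> DV_op Q -> DV_op (P \o Q).

Record DV := MkDV { DV_val : OU -> OU; _ : `[< DV_op DV_val >] }.

HB.instance Definition _ := [isSub for DV_val].
HB.instance Definition _ := [Choice of DV by <:].

Lemma DV_valP (P : DV) : DV_op (DV_val P).
Proof. by case: P => P h; apply/asboolP. Qed.

Lemma polyU0 : polyU 0%:MP = 0.
Proof. by apply: val_inj; rewrite /= mpolyC0 tofrac0. Qed.
Lemma polyU1 : polyU 1%:MP = 1.
Proof. by apply: val_inj; rewrite /= mpolyC1 tofrac1. Qed.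
Lemma polyUN1 : polyU (-1)%:MP = -1.
Proof. by apply: val_inj; rewrite /= mpolyCN mpolyC1 tofracN tofrac1. Qed.

Fact DV_op0 : `[< DV_op (fun=> 0) >].
Proof.
apply/asboolP; have := DV_const 0; congr DV_op; apply/funext => u.
by rewrite polyU0 mul0r.
Qed.
Fact DV_op1 : `[< DV_op id >].
Proof.
apply/asboolP; have := DV_const 1; congr DV_op; apply/funext => u.
by rewrite polyU1 mul1r.
Qed.
Fact DV_opN (P : DV) : `[< DV_op (fun u => - DV_val P u) >].
Proof.
apply/asboolP; have := DV_comp (DV_const (-1)) (DV_valP P).
by congr DV_op; apply/funext => u; rewrite /= polyUN1 mulN1r.
Qed.
Fact DV_opD (P Q : DV) : `[< DV_op (fun u => DV_val P u + DV_val Q u) >].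
Proof. by apply/asboolP; apply: DV_add; apply: DV_valP. Qed.
Fact DV_opM (P Q : DV) : `[< DV_op (DV_val P \o DV_val Q) >].
Proof. by apply/asboolP; apply: DV_comp; apply: DV_valP. Qed.

Lemma DV_valD (P : DV) : {morph DV_val P : u v / u + v}.
Proof.
elim: (DV_valP P) => [c|j||j|P1 P2 _ IH1 _ IH2|P1 P2 _ IH1 _ IH2] u v /=.
- by rewrite mulrDr.
- by rewrite mulrDr.
- by rewrite mulrDr.
- by rewrite raddfD.
- by rewrite IH1 IH2 addrACA.
- by rewrite IH2 IH1.
Qed.

Definition DV_zero := MkDV DV_op0.
Definition DV_one := MkDV DV_op1.
Definition DV_opp P := MkDV (DV_opN P).
Definition DV_plus P Q := MkDV (DV_opD P Q).
Definition DV_mul P Q := MkDV (DV_opM P Q).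

Fact DV_plusA : associative DV_plus.
Proof. by move=> P Q S; apply/val_inj/funext => u /=; rewrite addrA. Qed.
Fact DV_plusC : commutative DV_plus.
Proof. by move=> P Q; apply/val_inj/funext => u /=; rewrite addrC. Qed.
Fact DV_plus0 : left_id DV_zero DV_plus.
Proof. by move=> P; apply/val_inj/funext => u /=; rewrite add0r. Qed.
Fact DV_plusN : left_inverse DV_zero DV_opp DV_plus.
Proof. by move=> P; apply/val_inj/funext => u /=; rewrite addNr. Qed.

HB.instance Definition _ :=
  GRing.isZmodule.Build DV DV_plusA DV_plusC DV_plus0 DV_plusN.

Fact DV_mulA : associative DV_mul.
Proof. by move=> P Q S; apply/val_inj/funext. Qed.
Fact DV_mul1l : left_id DV_one DV_mul.
Proof. by move=> P; apply/val_inj/funext. Qed.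
Fact DV_mul1r : right_id DV_one DV_mul.
Proof. by move=> P; apply/val_inj/funext. Qed.
Fact DV_mulDl : left_distributive DV_mul +%R.
Proof. by move=> P Q S; apply/val_inj/funext. Qed.
Fact DV_mulDr : right_distributive DV_mul +%R.
Proof. by move=> P Q S; apply/val_inj/funext => u; apply: DV_valD. Qed.
Fact DV_one_neq0 : DV_one != 0 :> DV.
Proof.
apply/eqP => /(congr1 (fun P => DV_val P 1)) /= /eqP.
by rewrite oner_eq0.
Qed.

HB.instance Definition _ := GRing.Zmodule_isNzRing.Build DV
  DV_mulA DV_mul1l DV_mul1r DV_mulDl DV_mulDr DV_one_neq0.

Definition DV_scale (P : DV) (u : OU_mod y dy) : OU_mod y dy := DV_val P u.

Fact DV_scaleA P Q u : DV_scale P (DV_scale Q u) = DV_scale (P * Q) u.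
Proof. by []. Qed.
Fact DV_scale1 : left_id 1 DV_scale.
Proof. by []. Qed.
Fact DV_scaleDr : right_distributive DV_scale +%R.
Proof. by move=> P u v; apply: DV_valD. Qed.
Fact DV_scaleDl u : {morph DV_scale^~ u : P Q / P + Q}.
Proof. by []. Qed.

HB.instance Definition _ := GRing.Zmodule_isLmodule.Build DV (OU_mod y dy)
  DV_scaleA DV_scale1 DV_scaleDr DV_scaleDl.

End DV.

End Specht.

Arguments OU_mod {F r n} y dy.

(* Main.v *)
Require Import Defs.
From HB Require Import structures.
From mathcomp Require Import all_boot all_order all_algebra all_fingroup.
From mathcomp Require Import fraction.
From mathcomp Require Import mpoly.
From mathcomp Require Import boolp classical_sets reals complex.
From mathcomp Require Import fintype finset.
From mathcomp Require Import zify.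

(* Let G be the product of the symmetric groups of the blocks.  The index     *)
(* tableau of the canonical tableau has the row numbers as entries, so F_T is *)
(* up to a non-zero constant the Specht polynomial of T: the column           *)
(* antisymmetrization of x^rho, where rho_j is the row of j in T.  The column *)
(* antisymmetrization of a monomial vanishes unless its exponents are         *)
(* distinct within each column; this forces its degree to be at least that of *)
(* x^rho, with equality only for the column permutations of x^rho.  Hence the *)
(* matrix of the e_S F_T is triangular with non-zero diagonal, the products   *)
(* e_S s_ST (s_ST moving T to S) are independent in the group algebra, and    *)
(* they form a basis because the squares of the numbers of standard tableaux  *)
(* add up to at least |G|.  In particular 1 is a combination of the e_S s_ST. *)
(*   The coefficient of g in e_S is, up to scaling, the coefficient of x^rho  *)
(* in g^-1 F_S.  So for w in O_U the average over G of the operator           *)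
(* w d^rho / rho!, which lies in D_V because d/dx_i is a combination of the   *)
(* d/dy_j, maps F_S to a multiple of e_S w.  Writing u as a combination of    *)
(* the e_S (s_ST u) shows that O_U is the sum of the D_V F_S; applying the    *)
(* e_S to a relation shows that the sum is direct.  Permutations commute with *)
(* D_V, so D_V F_T only depends on the shape of T up to isomorphism.          *)

(** Three facts carry the argument. Triangularity: for a suitable order on the standard
    multitableaux, [esum_spoly0] says that the symmetrizer of S kills the Specht polynomial of T
    when S strictly precedes T, while [esum_spolyE] says that the symmetrizer of T multiplies its
    own Specht polynomial by a non-zero scalar. That the scalar is non-zero is a positivity
    argument, [esum_spoly_neq0]. Counting: [one_theta] turns triangularity into an expression of 1
    in the group algebra. Independence of the elements e_S s_ST is not enough; there must be at
    least |G| pairs of tableaux of a common shape. The bound m! <= sum of (f^lambda)^2,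
    [factorial_num_std], comes from the commutation relation of the up and down operators on the
    Young lattice ([sum_up_paths]), with standard tableaux coded by Yamanouchi words. Operators: D_V
    commutes with the group algebra ([DV_opU]), and every e_T w is the image of the Specht
    polynomial of T under some element of D_V ([ecoef_DV]). Applying the expression of 1 to u gives
    [component_sum]; applying the symmetrizer of the first tableau that occurs in a relation gives
    [component_sum_eq0]. For the second statement, [tocanon] moves each summand to the one of the
    canonical tableau, and [specht_dimE] identifies the multiplicity with the number of standard
    tableaux. *)

Set Implicit Arguments.
Unset Strict Implicit.
Unset Printing Implicit Defensive.

Import Order.TTheory GRing.Theory Num.Theory.

(** * Yamanouchi words *)

Section Yamanouchi.
Variable M : nat.
Implicit Types (p q : nat -> nat) (w : seq nat).

Definition incr p a c := p c + (c == a).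
Definition decr p a c := p c - (c == a).
(** Such a [p] gives the row lengths of a Young diagram. The comparison at [a = M.-1] also
    constrains row [M], just outside the sums over [a < M]. *)
Definition wdec p := all (fun a => p a.+1 <= p a) (iota 0 M).
Definition removable p b := (0 < p b) && wdec (decr p b).

Lemma wdecP p : reflect (forall a, a < M -> p a.+1 <= p a) (wdec p).
Proof.
apply: (iffP allP) => [h a aM|h a]; first by apply: h; rewrite mem_iota.
by rewrite mem_iota => /andP[_ aM]; apply: h.
Qed.

(** For a diagram [p] with [k] boxes this counts the ways of removing corners one by one down to the
    empty diagram, that is f^p. *)
Fixpoint paths k p : nat :=
  if k is k'.+1 then \sum_(b < M) removable p b * paths k' (decr p b) else 1.

Arguments paths : simpl never.

Lemma pathsS k p :
  paths k.+1 p = \sum_(b < M) removable p b * paths k (decr p b).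
Proof. by []. Qed.

Lemma incrK p a : decr (incr p a) a = p.
Proof. by apply/funext => c; rewrite /decr /incr addnK. Qed.

Lemma removable_incr p a : removable (incr p a) a = wdec p.
Proof. by rewrite /removable incrK /incr eqxx addn1. Qed.

Lemma decrK p a : 0 < p a -> incr (decr p a) a = p.
Proof.
by move=> pa; apply/funext => c; rewrite /decr /incr; case: eqP => [->|]; lia.
Qed.

Lemma incr_decr p a b : a != b -> decr (incr p a) b = incr (decr p b) a.
Proof.
move=> ab; apply/funext => c; rewrite /decr /incr.
by case: (eqVneq c a) => [->|]; rewrite ?(negPf ab); lia.
Qed.

Lemma wdec_incr0 p : wdec p -> wdec (incr p 0).
Proof.
by move=> /wdecP h; apply/wdecP => a aM; have := h _ aM; rewrite /incr /=; lia.
Qed.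

(** Both sides say that row [a] is strictly longer than row [a.+1]. *)
Lemma wdec_incrS p a : wdec p -> a.+1 < M -> wdec (incr p a.+1) = removable p a.
Proof.
move=> /wdecP h aM; have ha := h a (ltnW aM).
apply/idP/idP => [/wdecP/(_ a (ltnW aM))|/andP[pa /wdecP/(_ a (ltnW aM))]].
  rewrite /incr /decr eqxx => ha'; apply/andP; split; first by lia.
  apply/wdecP => c cM; have := h c cM; have := h c.+1; rewrite /decr.
  by case: (eqVneq c a) => [->|]; case: (eqVneq c.+1 a) => [|]; lia.
rewrite /decr eqxx => ha'; apply/wdecP => c cM; have := h c cM; rewrite /incr.
by case: (eqVneq c a) => [->|]; rewrite ?eqSS => *; lia.
Qed.

Lemma pos_last p : wdec p -> 0 < p M.-1 -> M <= \sum_(a < M) p a.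
Proof.
move=> /wdecP h pM.
have pos d : d < M -> 0 < p (M.-1 - d).
  elim: d => [|d IH] dM; first by rewrite subn0.
  have := h (M.-1 - d.+1); have -> : (M.-1 - d.+1).+1 = M.-1 - d by lia.
  by have := IH (ltnW dM); lia.
rewrite -[leqLHS]card_ord -sum1_card leq_sum // => a _.
have -> : (a : nat) = M.-1 - (M.-1 - a) by case: a => a /= aM; lia.
by apply: pos; case: a => a /= aM; lia.
Qed.

(** A box can be added in row 0 or just below a removable corner. With fewer than [M] boxes the last
    row is empty, so no removable corner is lost at the end of the range. *)
Lemma up_down p : wdec p -> \sum_(a < M) p a < M ->
  \sum_(a < M) wdec (incr p a) = (\sum_(b < M) removable p b).+1.
Proof.
move=> dp kM; have M0 : 0 < M by apply: leq_ltn_trans kM.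
have := pos_last dp; have := @wdec_incrS p; move: kM.
case: M M0 dp (wdec_incr0 dp) => // m _ dp dp0 kM S L.
rewrite big_ord_recl dp0 [in RHS]big_ord_recr /= [X in _ = (_ + X).+1](_ : _ = 0).
  rewrite addn0 add1n; congr _.+1; apply: eq_bigr => a _.
  by rewrite /bump /= add1n S // ltnS ltn_ord.
apply/eqP; rewrite eqb0 /removable negb_and -leqNgt.
by case: (posnP (p m)) => [->|/L]; [rewrite leqnn|rewrite leqNgt kM].
Qed.

Lemma size_incr p a : a < M -> \sum_(c < M) incr p a c = (\sum_(c < M) p c).+1.
Proof.
move=> aM; rewrite big_split /= -[RHS]addn1; congr (_ + _).
rewrite (bigD1 (Ordinal aM)) //= eqxx big1 // => c.
by rewrite -val_eqE /= => /negPf->.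
Qed.

Lemma size_decr p b k : b < M -> 0 < p b -> \sum_(c < M) p c = k.+1 ->
  \sum_(c < M) decr p b c = k.
Proof.
by move=> bM pb; rewrite -{1}(decrK pb) size_incr // => -[].
Qed.

(* The commutation relation D U - U D = 1 of the Young lattice.              *)
Lemma sum_up_paths k p : wdec p -> \sum_(a < M) p a = k -> k < M ->
  \sum_(a < M) wdec (incr p a) * paths k.+1 (incr p a) = k.+1 * paths k p.
Proof.
elim: k p => [|k IH] p dp pk kM.
  have p0 c : c < M -> p c = 0.
    move=> cM; move/eqP: pk; rewrite sum_nat_eq0 => /forallP/(_ (Ordinal cM)).
    by move=> /eqP.
  have M0 : 0 < M by [].
  have e a (aM : a < M) : paths 1 (incr p a) = 1.
    rewrite pathsS (bigD1 (Ordinal aM)) //= muln1 big1 ?addn0 => [|b ba].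
      by rewrite removable_incr dp.
    rewrite /removable /incr p0 ?ltn_ord // (_ : (b == a :> nat) = false) //.
    by apply/negP => /eqP ba'; rewrite -val_eqE /= ba' eqxx in ba.
  under eq_bigr => a _ do rewrite e ?ltn_ord // muln1.
  rewrite up_down ?pk // big1 // => b _.
  by rewrite /removable p0.
have step a : wdec (incr p a) * paths k.+2 (incr p a) =
    \sum_(b < M) (wdec (incr p a) && removable (incr p a) b) *
      paths k.+1 (decr (incr p a) b).
  by rewrite pathsS big_distrr /=; apply: eq_bigr => b _; rewrite mulnA mulnb.
under eq_bigr => a _ do rewrite step.
(* Adding and then removing in the same row gives back [p], once for each addable row. *)
have diag (a : 'I_M) : (wdec (incr p a) && removable (incr p a) a) *
   paths k.+1 (decr (incr p a) a) = wdec (incr p a) * paths k.+1 p.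
  by rewrite removable_incr incrK dp andbT.
(* In two different rows the two operations commute, and so do the conditions that allow them. *)
have offd (a b : 'I_M) : a != b ->
   (wdec (incr p a) && removable (incr p a) b) * paths k.+1 (decr (incr p a) b)
   = (removable p b && wdec (incr (decr p b) a)) * paths k.+1 (incr (decr p b) a).
  move=> ab; have ab' : (a : nat) != b by [].
  rewrite incr_decr //; congr (nat_of_bool _ * _).
  rewrite /removable incr_decr //; apply/idP/idP.
    case/and3P=> /wdecP h1 h2 /wdecP h3.
    have pb : 0 < p b.
      by move: h2; rewrite /incr eq_sym (negPf ab') addn0.
    rewrite pb /= andbC; apply/andP; split; first by apply/wdecP.
    apply/wdecP => c cM; have := h3 c cM; have := wdecP _ dp c cM.
    rewrite /incr /decr.
    by case: (eqVneq c a) => [->|]; case: (eqVneq c b) => [|];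
       case: (eqVneq c.+1 b) => [|]; case: (eqVneq c.+1 a) => [|]; lia.
  case/andP=> /andP[pb /wdecP h1] /wdecP h3.
  have ->: 0 < incr p a b by rewrite /incr; lia.
  rewrite andbC /=; apply/andP; split; first by apply/wdecP.
  apply/wdecP => c cM; have := h3 c cM; have := wdecP _ dp c cM.
  rewrite /incr /decr.
  by case: (eqVneq c a) => [->|]; case: (eqVneq c b) => [|];
     case: (eqVneq c.+1 b) => [|]; case: (eqVneq c.+1 a) => [|]; lia.
have E1 : \sum_(a < M) \sum_(b < M) (wdec (incr p a) && removable (incr p a) b) *
      paths k.+1 (decr (incr p a) b) =
    (\sum_(a < M) wdec (incr p a)) * paths k.+1 p + \sum_(b < M) \sum_(a < M | a != b)
   (removable p b && wdec (incr (decr p b) a)) * paths k.+1 (incr (decr p b) a).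
  rewrite big_distrl /= [X in _ = _ + X](exchange_big_dep xpredT) //= -big_split /=.
  apply: eq_bigr => a _; rewrite (bigD1 a) //= diag; congr (_ + _).
  under eq_bigl => b do rewrite eq_sym.
  by apply: eq_bigr => b ab; rewrite offd.
have E2 : k.+1 * paths k.+1 p = (\sum_(b < M) removable p b) * paths k.+1 p +
  \sum_(b < M) \sum_(a < M | a != b)
   (removable p b && wdec (incr (decr p b) a)) * paths k.+1 (incr (decr p b) a).
  rewrite [in LHS]pathsS big_distrr /= big_distrl /= -big_split /=.
  apply: eq_bigr => b _; case rb : (removable p b); last first.
    by rewrite /= !mul0n muln0 add0n big1.
  case/andP: (rb) => pb db; rewrite !mul1n -IH //; last exact: ltnW.
    by rewrite (bigD1 b) //= decrK // dp !mul1n.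
  exact: size_decr pk.
by rewrite E1 up_down ?pk // mulSn -addnA -E2 -mulSn.
Qed.

Definition cont w : nat -> nat := fun a => count_mem a w.

Lemma cont_rcons w a : cont (rcons w a) = incr (cont w) a.
Proof.
apply/funext => c; rewrite /cont /incr -cats1 count_cat /= addn0.
by rewrite eq_sym.
Qed.

(** Yamanouchi words: every prefix has a decreasing content. Letter number [j] is the row of entry
    [j] of a standard tableau whose shape is the content. *)
Fixpoint yam k : seq (seq nat) :=
  if k is k'.+1 then
    [seq rcons w a | w <- yam k', a <- [seq a <- iota 0 M | wdec (incr (cont w) a)]]
  else [:: [::]].

Arguments yam : simpl never.

Lemma yamS k : yam k.+1 = [seq rcons w a | w <- yam k,
  a <- [seq a <- iota 0 M | wdec (incr (cont w) a)]].
Proof. by []. Qed.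

Lemma yamP k w : w \in yam k -> [/\ size w = k, wdec (cont w),
  all (fun a => a < M) w & forall j, wdec (cont (take j w))].
Proof.
elim: k w => [|k IH] w; rewrite ?yamS.
  by rewrite inE => /eqP ->; split=> // [|j]; apply/wdecP.
move=> /allpairsPdep[v [a [/IH[vk dv av tv]]]].
rewrite mem_filter mem_iota /= add0n => /andP[da aM] ->.
split; rewrite ?size_rcons ?vk ?cont_rcons ?all_rcons ?aM // => j.
rewrite -cats1 take_cat; case: ltnP => [_|_]; first exact: tv.
case: (j - size v) => [|i] /=; first by rewrite cats0.
by rewrite cats1 cont_rcons.
Qed.

Lemma yam_uniq k : uniq (yam k).
Proof.
elim: k => // k IH; rewrite yamS; apply: allpairs_uniq_dep => //.
  by move=> w _; rewrite filter_uniq ?iota_uniq.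
by move=> [w a] [v b] _ _ /= /rcons_inj[-> ->].
Qed.

Lemma size_cont w : all (fun a => a < M) w -> \sum_(a < M) cont w a = size w.
Proof.
elim/last_ind: w => [|w a IH]; first by rewrite big1.
by rewrite all_rcons => /andP[aM /IH wE]; rewrite cont_rcons size_incr // size_rcons wE.
Qed.

Lemma sum_yam k (g : (nat -> nat) -> nat) :
  \sum_(w <- yam k.+1) g (cont w) =
  \sum_(w <- yam k) \sum_(a < M) wdec (incr (cont w) a) * g (incr (cont w) a).
Proof.
rewrite yamS big_allpairs_dep /=; apply: eq_bigr => w _.
rewrite big_filter big_mkcond /= -{1}[M]subn0 big_mkord.
by apply: eq_bigr => a _; rewrite cont_rcons; case: ifP; rewrite ?mul1n.
Qed.

(** By [sum_up_paths], passing from length [k] to [k.+1] multiplies the sum by [k.+1]. *)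
Lemma sum_paths_yam k : k <= M -> \sum_(w <- yam k) paths k (cont w) = k`!.
Proof.
elim: k => [|k IH] kM; first by rewrite big_seq1.
rewrite sum_yam factS -IH 1?ltnW // big_distrr /= [LHS]big_seq [RHS]big_seq.
by apply: eq_bigr => w /yamP[wk dw aw _]; rewrite sum_up_paths // size_cont.
Qed.

(** A chain of corner removals read backwards is a Yamanouchi word; the induction splits on its last
    letter. *)
Lemma paths_yam k p : wdec p -> \sum_(a < M) p a = k -> (forall a, M <= a -> p a = 0) ->
  paths k p = count (fun w => `[< cont w = p >]) (yam k).
Proof.
elim: k p => [|k IH] p dp pk pM.
  rewrite /= addn0 asboolT //; apply/funext => a.
  case: (leqP M a) => [/pM ->|aM] //; move/eqP: pk; rewrite sum_nat_eq0.
  by move=> /forallP/(_ (Ordinal aM)) /eqP /= ->.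
rewrite pathsS -sum1_count [in RHS]big_mkcond /=.
have -> := sum_yam k (fun q => if `[< q = p >] then 1 else 0).
rewrite exchange_big /=; apply: eq_bigr => b _.
case rb : (removable p b); last first.
  rewrite big_seq big1 // => w /yamP[_ dw _ _]; case: asboolP => [pE|]; last by rewrite muln0.
  by move/negP: rb; case; rewrite -pE removable_incr.
case/andP: (rb) => pb db.
rewrite mul1n IH //; last 2 first.
- exact: size_decr pk.
- by move=> a /pM; rewrite /decr => ->.
rewrite -sum1_count [in LHS]big_mkcond /=; apply: eq_bigr => w _.
case: asboolP => [->|ne]; first by rewrite decrK // dp asboolT.
by case: asboolP => [e|]; [case: ne; rewrite -e incrK|rewrite muln0].
Qed.

(** This is M! = sum of (f^lambda)^2, each square being counted as pairs of words of equal
    content. *)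
Lemma factorial_yam :
  M`! = \sum_(w <- yam M) count (fun v => `[< cont v = cont w >]) (yam M).
Proof.
rewrite -(sum_paths_yam (leqnn M)) [LHS]big_seq [RHS]big_seq.
apply: eq_bigr => w /yamP[wM dw aw _]; rewrite paths_yam ?size_cont // => a Ma.
apply/count_memPn/negP => /(allP aw); by rewrite /= ltnNge Ma.
Qed.

End Yamanouchi.

(** * Blocks, and standard fillings from words *)

Section Blocks.
Variables (r : nat) (n : 'I_r -> nat).
Local Notation N := (nvars n).
Local Notation offset := (offset n).
Local Notation block := (block n).

Lemma offset_ltn (i k : 'I_r) : i < k -> offset i + n i <= offset k.
Proof.
move=> ik; rewrite /Defs.offset [leqRHS](bigID (fun l : 'I_r => l < i)) /=.
apply: leq_add; last by rewrite (bigD1 i) ?leq_addr //= ltnn andbT.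
apply/eq_leq/eq_bigl => l; case li: (l < i); rewrite ?andbF ?andbT //.
by rewrite (ltn_trans li ik).
Qed.

Lemma in_blockE i (j : 'I_N) : (j \in block i) = (offset i <= j < offset i + n i).
Proof. by rewrite inE. Qed.

Lemma block_inj i k (j : 'I_N) : j \in block i -> j \in block k -> i = k.
Proof.
rewrite !in_blockE => ji jk; apply/val_inj/eqP => /=; rewrite eqn_leq leqNgt [X in _ && X]leqNgt.
by apply/andP; split; apply/negP => /offset_ltn; lia.
Qed.

Lemma card_block i : #|block i| = n i.
Proof.
have h (k : 'I_(n i)) : offset i + k < N.
  by apply: leq_trans (offset_leq n i); rewrite ltn_add2l.
have inj : injective (fun k => Ordinal (h k)).
  by move=> k l [] /eqP; rewrite eqn_add2l => /eqP/val_inj.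
rewrite -[RHS]card_ord -(card_imset _ inj); apply: eq_card => j.
rewrite in_blockE; apply/andP/imsetP => [[oj jo]|[k _ ->]] /=.
  have jk : j - offset i < n i by lia.
  by exists (Ordinal jk) => //; apply: val_inj => /=; lia.
by rewrite leq_addr ltn_add2l.
Qed.

Lemma block_exists (j : 'I_N) : exists i, j \in block i.
Proof.
suff /eqP e : \bigcup_i block i == [set: 'I_N].
  have : j \in \bigcup_i block i by rewrite e inE.
  by case/bigcupP=> i _ ij; exists i.
rewrite eqEcard subsetT cardsT card_ord -sum1_card partition_disjoint_bigcup.
  by rewrite leq_eqVlt; apply/orP; left; apply/eqP/eq_bigr => i _; rewrite sum1_card card_block.
move=> i k ik; rewrite disjoint_subset; apply/subsetP => l li.
by rewrite inE /=; apply: contra_neqN ik; apply: block_inj.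
Qed.

Lemma blockofP (j : 'I_N) : {i | j \in block i}.
Proof. by apply: cid; apply: block_exists. Qed.

Definition blockof j := projT1 (blockofP j).

Lemma blockof_in j : j \in block (blockof j).
Proof. exact: (projT2 (blockofP j)). Qed.

Lemma in_block_blockof i j : (j \in block i) = (blockof j == i).
Proof.
apply/idP/eqP => [ji|<-]; last exact: blockof_in.
exact: block_inj (blockof_in j) ji.
Qed.

End Blocks.

Section WordFilling.
Variables (r : nat) (n : 'I_r -> nat) (i : 'I_r).
Local Notation m := (n i).
Local Notation N := (nvars n).

Implicit Types (p q : part m).

(** Extending a partition by zero makes it comparable with the content of a word. *)
Definition pcont p : nat -> nat :=
  fun a => if insub a is Some a' then sval p a' : nat else 0.

Lemma pcontE p (a : 'I_m) : pcont p a = sval p a.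
Proof. by rewrite /pcont valK. Qed.

Lemma pcont_out p a : m <= a -> pcont p a = 0.
Proof. by move=> ma; rewrite /pcont insubF // ltnNge ma. Qed.

Lemma pcont_sum p : \sum_(a < m) pcont p a = m.
Proof.
under eq_bigr => a _ do rewrite pcontE.
by case: p => p /= /andP[_ /eqP].
Qed.

Lemma pcont_inj : injective pcont.
Proof.
move=> p q pq; apply/val_inj/ffunP => a; apply: val_inj => /=.
by rewrite -!pcontE pq.
Qed.

Lemma pcont_le p a b : a <= b -> pcont p b <= pcont p a.
Proof.
move=> ab; case: (ltnP b m) => [bm|/(@pcont_out p) -> //].
have am := leq_ltn_trans ab bm.
rewrite (pcontE p (Ordinal bm)) (pcontE p (Ordinal am)).
by case: p => p /= /andP[/forallP/(_ (Ordinal am))/forallP/(_ (Ordinal bm))/implyP/(_ ab)].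
Qed.

Lemma pcont_surj (q : nat -> nat) : wdec m q -> \sum_(a < m) q a = m ->
  (forall a, m <= a -> q a = 0) -> exists p, pcont p = q.
Proof.
move=> /wdecP dq sq qm.
have qle a : q a < m.+1.
  case: (ltnP a m) => [am|/qm -> //].
  by rewrite ltnS -[leqRHS]sq (bigD1 (Ordinal am)) //= leq_addr.
have qd a b : a <= b -> q b <= q a.
  move=> /subnK <-; elim: (b - a) => // d IH; apply: leq_trans IH.
  by rewrite addSn; case: (ltnP (d + a) m) => [/dq //|h]; rewrite qm //; lia.
have pP : is_part [ffun a : 'I_m => Ordinal (qle a)].
  apply/andP; split.
    by apply/forallP => a; apply/forallP => b; apply/implyP => /qd; rewrite !ffunE.
  by under eq_bigr => a _ do rewrite ffunE; rewrite sq.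
exists (exist (fun p : {ffun 'I_m -> 'I_m.+1} => is_part p) _ pP : part m).
apply/funext => a; rewrite /pcont.
case: insubP => [a' _ <-|]; first by rewrite /= ffunE.
by rewrite -leqNgt => /qm ->.
Qed.

Lemma card_box p : #|box p| = m.
Proof.
rewrite -[RHS](pcont_sum p) card_sig -sum1_card.
rewrite -(pair_big_dep xpredT (fun a c : 'I_m => c < sval p a) (fun _ _ => 1)) /=.
apply: eq_bigr => a _; rewrite pcontE.
have pm : sval p a <= m by rewrite -ltnS.
have inj : injective (widen_ord pm) by move=> c d /(congr1 val) /= /val_inj.
rewrite sum1dep_card -[RHS]card_ord -(card_imset _ inj).
apply: eq_card => c; rewrite inE; apply/idP/imsetP => [cp|[d _ ->] //=].
by exists (Ordinal cp) => //; apply: val_inj.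
Qed.

Lemma box_lt p (b : box p) : bcol b < pcont p (brow b).
Proof. by rewrite /brow pcontE; apply: (svalP b). Qed.

Lemma mkbox p a c : c < pcont p a -> exists b : box p, brow b = a /\ bcol b = c.
Proof.
move=> cp; have am : a < m by case: (ltnP a m) => // /pcont_out p0; rewrite p0 in cp.
have pa := pcontE p (Ordinal am); rewrite /= in pa.
have cm : c < m by rewrite (leq_trans cp) // pa -ltnS.
have bP : (Ordinal cm < sval p (Ordinal am))%N by rewrite -pa.
by exists (exist (fun b : 'I_m * 'I_m => (b.2 < sval p b.1)%N) (Ordinal am, Ordinal cm) bP : box p).
Qed.

Lemma box_eq p (b c : box p) : brow b = brow c -> bcol b = bcol c -> b = c.
Proof.
case: b c => [[a d] h] [[a' d'] h']; rewrite /brow /bcol /= => e1 e2.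
by apply: val_inj => /=; congr (_, _); apply: val_inj.
Qed.

Section OneWord.
Variable w : seq nat.
Hypothesis wY : w \in yam m m.

Let wm : size w = m. Proof. by case: (yamP wY). Qed.

(** The position of occurrence number [c], counted from 0, of the letter [a]: up to the offset of
    the block, the entry of box [(a, c)] in the tableau coded by [w]. *)
Definition wpos a c := find (fun j => (nth m w j == a) && (count_mem a (take j w) == c)) (iota 0 m).

Lemma wpos_exists a c : c < count_mem a w ->
  exists2 j, j < size w & (nth m w j == a) && (count_mem a (take j w) == c).
Proof.
elim/last_ind: w => // v x IH; rewrite -cats1 count_cat /= addn0 => cx.
case: (ltnP c (count_mem a v)) => [/IH[j jv jP]|vc].
  exists j; first by rewrite size_cat ltn_addr.
  by rewrite nth_cat jv take_cat jv.
exists (size v); first by rewrite size_cat addn1.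
rewrite nth_cat ltnn subnn /= take_size_cat // .
case: (eqVneq x a) cx => /= _; rewrite ?addn1 ?addn0 => cx; first by rewrite eqn_leq vc -ltnS.
by rewrite ltnNge vc in cx.
Qed.

Lemma wposP a c : c < count_mem a w ->
  [/\ wpos a c < m, nth m w (wpos a c) = a & count_mem a (take (wpos a c) w) = c].
Proof.
move=> /wpos_exists[j jw jP].
have h : has (fun j => (nth m w j == a) && (count_mem a (take j w) == c)) (iota 0 m).
  by apply/hasP; exists j => //; rewrite mem_iota -wm.
have := nth_find 0 h; rewrite -/(wpos a c).
have lt : wpos a c < m by rewrite -[ltnRHS](size_iota 0) -has_find.
by rewrite nth_iota // add0n => /andP[/eqP ? /eqP].
Qed.

Lemma wpos_uniq j a c : j < m -> nth m w j = a -> count_mem a (take j w) = c -> wpos a c = j.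
Proof.
move=> jm ja jc.
have lt : c < count_mem a w.
  rewrite -(cat_take_drop j w) count_cat jc -addn1 leq_add2l (drop_nth m) ?wm //.
  by rewrite /= ja eqxx.
have [km ka kc] := wposP lt.
have key x y : x < y -> y < m -> nth m w x = a -> count_mem a (take x w) < count_mem a (take y w).
  move=> xy ym xa.
  have -> : take y w = take x w ++ a :: take (y - x.+1) (drop x.+1 w).
    by rewrite -{1}(subnKC xy) takeD (take_nth m) ?wm ?(ltn_trans xy) // xa cat_rcons.
  by rewrite count_cat /= eqxx; lia.
case: (ltngtP (wpos a c) j) => // h.
  by have := key _ _ h jm ka; rewrite kc jc ltnn.
by have := key _ _ h km ja; rewrite kc jc ltnn.
Qed.

Lemma count_take_mono a x y : x <= y -> count_mem a (take x w) <= count_mem a (take y w).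
Proof. by move=> xy; rewrite -(subnKC xy) takeD count_cat leq_addr. Qed.

Variable p : part m.
Hypothesis wp : cont w = pcont p.

Lemma wfill_lt (b : box p) : Defs.offset n i + wpos (brow b) (bcol b) < N.
Proof.
apply: leq_trans (offset_leq n i); rewrite ltn_add2l.
by case: (@wposP (brow b) (bcol b)) => //; rewrite -/(cont w _) wp box_lt.
Qed.

Definition wfill : filling p := [ffun b => Ordinal (wfill_lt b)].

(** Rows increase because successive occurrences of a letter are ordered; columns increase because
    in every prefix a letter occurs at least as often as any larger one. *)
Lemma wfill_std : is_standard wfill.
Proof.
have P (b : box p) : [/\ wpos (brow b) (bcol b) < m, nth m w (wpos (brow b) (bcol b)) = brow b &
   count_mem (brow b) (take (wpos (brow b) (bcol b)) w) = bcol b].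
  by apply: wposP; rewrite -/(cont w _) wp box_lt.
have inj : injective wfill.
  move=> b c /(congr1 val); rewrite !ffunE /= => /eqP; rewrite eqn_add2l => /eqP e.
  have [_ b1 b2] := P b; have [_ c1 c2] := P c.
  have rr : brow b = brow c by rewrite -b1 -c1 e.
  by apply: box_eq => //; rewrite -b2 -c2 e rr.
apply/and4P; split.
- exact/injectiveP.
- rewrite eqEcard card_block card_imset // card_box leqnn andbT.
  apply/subsetP => _ /imsetP[b _ ->]; rewrite in_blockE ffunE /= leq_addr ltn_add2l.
  by have [] := P b.
- apply/forallP => b; apply/forallP => c; apply/implyP => /andP[/eqP rr cc].
  rewrite !ffunE /= ltn_add2l ltnNge; apply/negP => /(count_take_mono (brow b)).
  have [_ _ b2] := P b; have [_ _ c2] := P c; rewrite b2 rr c2.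
  by rewrite leqNgt cc.
- apply/forallP => b; apply/forallP => c; apply/implyP => /andP[/eqP cc rr].
  rewrite !ffunE /= ltn_add2l ltnNge; apply/negP => le.
  have [bm b1 b2] := P b; have [cm c1 c2] := P c.
  (* In the prefix ending at the entry of [c] the letter [brow c] occurs [(bcol c).+1] times, so
     [brow b] occurs at least as often; but only [bcol b = bcol c] occurrences precede the entry of
     [b], which is assumed not to come earlier. *)
  have [_ _ _ /(_ (wpos (brow c) (bcol c)).+1)] := yamP wY.
  have mono (q : nat -> nat) x y : wdec m q -> x <= y -> y <= m -> q y <= q x.
    move=> /wdecP dq; elim: y => [|y IH]; first by rewrite leqn0 => /eqP ->.
    rewrite leq_eqVlt => /orP[/eqP -> //|xy] ym.
    by apply: leq_trans (IH _ _); [apply: dq| |apply: ltnW].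
  move=> /mono/(_ (ltnW rr)); rewrite /cont (take_nth m) ?wm // c1 -cats1 !count_cat /= c2.
  have rne : (brow c == brow b) = false by rewrite eqn_leq [_ <= _]leqNgt rr.
  rewrite eqxx rne !addn0 addn1 => h.
  have crm : brow c <= m by rewrite /brow ltnW.
  have := leq_trans (h crm) (count_take_mono (brow b) le).
  by rewrite b2 cc ltnn.
Qed.

(** The word can be read back from the filling, which gives the injectivity in [num_std_ge]. *)
Lemma wfillE j : j < m ->
  exists b : box p, [/\ brow b = nth m w j & wfill b = Defs.offset n i + j :> nat].
Proof.
move=> jm; set a := nth m w j; set c := count_mem a (take j w).
have lt : c < pcont p a.
  rewrite -wp /cont -(cat_take_drop j w) count_cat -/c -addn1 leq_add2l (drop_nth m) ?wm //.
  by rewrite /= eqxx.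
have [b [b1 b2]] := mkbox lt; exists b; split=> //.
by rewrite ffunE /= b1 b2 (@wpos_uniq j).
Qed.

End OneWord.

Lemma num_std_ge p :
  count (fun v => `[< cont v = pcont p >]) (yam m m) <= num_std p.
Proof.
rewrite -size_filter; set s := [seq _ <- _ | _].
have sP (v : seq_sub s) : val v \in yam m m /\ cont (val v) = pcont p.
  by have := valP v; rewrite mem_filter => /andP[/asboolP].
pose f (v : seq_sub s) := wfill (sP v).1 (sP v).2.
have finj : injective f.
  move=> u v uv; apply: val_inj; apply: (@eq_from_nth _ m).
    by have [[] /yamP[-> _ _ _] _ [] /yamP[-> _ _ _] _] := (sP u, sP v).
  move=> j; have [/yamP[-> _ _ _] _] := sP u => jm.
  have [b [b1 b2]] := wfillE (sP u).1 (sP u).2 jm.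
  have [c [c1 c2]] := wfillE (sP v).1 (sP v).2 jm.
  rewrite -b1 -c1; congr brow.
  have := wfill_std (sP u).1 (sP u).2 => /and4P[/injectiveP inj _ _ _].
  by apply: inj; apply: val_inj; rewrite /= b2 -/(f u) uv c2.
rewrite -(card_seq_sub (filter_uniq _ (yam_uniq m m))) -(card_imset _ finj).
by apply: subset_leq_card; apply/subsetP => _ /imsetP[v _ ->]; rewrite inE wfill_std.
Qed.

Lemma factorial_num_std : m`! <= \sum_(p : part m) num_std p ^ 2.
Proof.
rewrite factorial_yam.
apply: leq_trans (_ : \sum_(p : part m)
  (count (fun v => `[< cont v = pcont p >]) (yam m m)) ^ 2 <= _); last first.
  by apply: leq_sum => p _; rewrite leq_exp2r // num_std_ge.
under [leqRHS]eq_bigr => p _ do rewrite -mulnn -{1}sum1_count big_distrl /=.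
rewrite (exchange_big_dep xpredT) //= big_seq [leqRHS]big_seq leq_sum // => w wY.
have [wm dw aw _] := yamP wY.
have [p pE] : exists p, pcont p = cont w.
  apply: pcont_surj => //; first by rewrite size_cont.
  by move=> a ma; apply/count_memPn/negP => /(allP aw); rewrite /= ltnNge ma.
by rewrite (bigD1 p) ?asboolT //= mul1n pE leq_addr.
Qed.

End WordFilling.

(** * The index tableau of the canonical tableau *)

Section Canon.
Variables (r : nat) (n : 'I_r -> nat) (i : 'I_r) (p : part (n i)).
Local Notation m := (n i).
Implicit Types b c : box p.

Definition fill_bij (T : filling p) := injective T /\ forall b, T b \in block n i.

Lemma fill_surj T : fill_bij T -> forall j, j \in block n i -> exists b, T b = j.
Proof.
move=> [inj Tb] j ji.
suff /eqP e : [set T b | b : box p] == block n i.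
  by move: ji; rewrite -e => /imsetP[b _ ->]; exists b.
rewrite eqEcard card_block card_imset // card_box leqnn andbT.
by apply/subsetP => _ /imsetP[b _ ->].
Qed.

Lemma std_bij T : is_standard T -> fill_bij T.
Proof.
case/and4P => /injectiveP inj /eqP e _ _; split=> // b.
by rewrite -e imset_f.
Qed.

Lemma canon_filling_val b : canon_filling p b = canon_val b :> nat.
Proof. by rewrite ffunE. Qed.

Lemma canon_val_lex b c : (brow b < brow c) || (brow b == brow c) && (bcol b < bcol c) ->
  canon_val b < canon_val c.
Proof.
rewrite /canon_val ltn_add2l; case/orP=> [rr|/andP[/eqP -> cc]]; last by rewrite ltn_add2l.
apply: leq_trans (leq_addr _ _).
rewrite [ltnRHS](bigID (fun a : 'I_m => a < brow b)) /=.
rewrite -addnS leq_add //.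
  apply/eq_leq/eq_bigl => a; case lt: (a < brow b); rewrite ?andbF ?andbT //.
  by rewrite (ltn_trans lt rr).
rewrite (bigD1 (sval b).1) /=; last by rewrite ltnn andbT.
by apply: leq_trans (leq_addr _ _); apply: (svalP b).
Qed.

Lemma lex_canon_val b c : canon_val b < canon_val c ->
  (brow b < brow c) || (brow b == brow c) && (bcol b < bcol c).
Proof.
move=> lt; case: (ltngtP (brow b) (brow c)) => //= [h|h].
  by have := @canon_val_lex c b; rewrite h => /(_ isT); lia.
case: (ltngtP (bcol b) (bcol c)) => //= [h'|h'].
  by have := @canon_val_lex c b; rewrite h eqxx h' orbT => /(_ isT); lia.
by rewrite (box_eq h h') ltnn in lt.
Qed.

Lemma canon_val_inj b c : canon_val b = canon_val c -> b = c.
Proof.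
move=> e; case: (ltngtP (brow b) (brow c)) => h.
- by have := @canon_val_lex b c; rewrite h e ltnn => /(_ isT).
- by have := @canon_val_lex c b; rewrite h e ltnn => /(_ isT).
case: (ltngtP (bcol b) (bcol c)) => h'.
- by have := @canon_val_lex b c; rewrite h eqxx h' orbT e ltnn => /(_ isT).
- by have := @canon_val_lex c b; rewrite h eqxx h' orbT e ltnn => /(_ isT).
exact: box_eq.
Qed.

Lemma canon_bij : fill_bij (canon_filling p).
Proof.
split=> [b c e|b].
  by apply: canon_val_inj; rewrite -!canon_filling_val e.
rewrite in_blockE canon_filling_val /canon_val leq_addr ltn_add2l.
rewrite -[ltnRHS](pcont_sum p) [ltnRHS](bigID (fun a : 'I_m => a < brow b)) /=.
rewrite -addnS leq_add //; first by apply/eq_leq/eq_bigr => a _; rewrite pcontE.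
rewrite (bigD1 (sval b).1) /= ?ltnn //.
by apply: leq_trans (leq_addr _ _); apply: box_lt.
Qed.

Definition reads_before b c :=
  (bcol b < bcol c) || (bcol b == bcol c) && (brow c < brow b).

Let boxes : seq (box p) :=
  pmap insub [seq (a, k) | k <- enum 'I_m, a <- rev (enum 'I_m)].

Lemma reading_wordE T : reading_word T = [seq (T b : nat) | b <- boxes].
Proof.
rewrite /reading_word /boxes.
elim: [seq (a, k) | k <- enum 'I_m, a <- rev (enum 'I_m)] => //= x s ->.
by case: insub.
Qed.

Lemma boxes_sorted : sorted reads_before boxes.
Proof.
pose e (x y : 'I_m * 'I_m) := (x.2 < y.2) || (x.2 == y.2) && (y.1 < x.1).
have -> : reads_before = relpre val e by [].
rewrite -sorted_map pmap_filter; last exact: insubK.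
have et : transitive e.
  move=> [a1 a2] [b1 b2] [c1 c2]; rewrite /e /= -!val_eqE /=; lia.
apply: sorted_filter => //.
rewrite sorted_pairwise //.
have lt_enum : pairwise (relpre (@nat_of_ord m) ltn) (enum 'I_m).
  rewrite -pairwise_map val_enum_ord -sorted_pairwise; first exact: iota_ltn_sorted.
  exact: ltn_trans.
have ltt := lt_enum; move: lt_enum; elim: {1 3}(enum 'I_m) => //= k t IH /andP[kt /IH{}IH].
rewrite pairwise_cat IH andbT; apply/andP; split.
  apply/allrelP => _ [_ _] /mapP[a _ ->] /allpairsP[[d b] /= [ds _ [-> ->]]].
  by rewrite /e /=; have /allP/(_ _ ds) /= -> := kt.
rewrite pairwise_map -sorted_pairwise; last first.
  by move=> a b d; rewrite /e /= ltnn eqxx /=; lia.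
rewrite rev_sorted sorted_pairwise; last by move=> a b d; rewrite /e /= ltnn eqxx /=; lia.
apply: sub_pairwise ltt => a b /= ab.
by rewrite /e /= ltnn eqxx ab.
Qed.

Lemma mem_boxes b : b \in boxes.
Proof.
rewrite /boxes mem_pmap; apply/mapP; exists (val b); last by rewrite valK.
apply/allpairsP; exists ((val b).2, (val b).1); rewrite /= mem_rev !mem_enum.
by split=> //; case: (val b).
Qed.

Lemma index_boxes b c : (index b boxes < index c boxes) = reads_before b c.
Proof.
have trans : transitive reads_before.
  by move=> x y z; rewrite /reads_before; lia.
apply/idP/idP => [|bc].
  exact: (sorted_ltn_index trans boxes_sorted _ _ (mem_boxes b) (mem_boxes c)).
case: ltngtP => // [lt|e].
  have := sorted_ltn_index trans boxes_sorted _ _ (mem_boxes c) (mem_boxes b) lt.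
  by move: bc; rewrite /reads_before; lia.
move: bc; have -> : b = c by rewrite -(nth_index b (mem_boxes b)) e nth_index ?mem_boxes.
by rewrite /reads_before; lia.
Qed.

(** The next entry of the canonical tableau is either to the right in the same row, hence later in
    the reading word, or at the start of the next row, hence earlier. So the index grows by one
    exactly when the row does. *)
Lemma entry_index_canon j b : canon_val b = offset n i + j ->
  entry_index (reading_word (canon_filling p)) (offset n i) j = brow b.
Proof.
have idx c : index (canon_val c) (reading_word (canon_filling p)) = index c boxes.
  rewrite reading_wordE -canon_filling_val.
  have inj : injective (fun x => canon_filling p x : nat).
    by move=> x y /val_inj; apply: (proj1 canon_bij).
  exact: (index_map inj).
have mkb a k (lt : k < pcont p a) : exists2 x : box p, brow x = a & bcol x = k.
  by have [x []] := mkbox lt; exists x.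
elim: j b => [|j IH] b bj /=.
  case: (posnP (brow b)) => [-> //|bpos].
  have [x x1 x2] : exists2 x : box p, brow x = 0 & bcol x = 0.
    apply: mkb; apply: leq_ltn_trans (leq0n (bcol b)) _.
    by apply: leq_trans (box_lt b) _; apply: pcont_le.
  have := @canon_val_lex x b; rewrite x1 bpos => /(_ isT).
  by rewrite bj addn0 /canon_val; lia.
have [c cj] : exists c, canon_val c = offset n i + j.
  have jN : offset n i + j < nvars n.
    by have := canon_val_lt b; rewrite bj; lia.
  have jb : Ordinal jN \in block n i.
    have := proj2 canon_bij b; rewrite !in_blockE canon_filling_val bj /=; lia.
  by have [c cE] := fill_surj canon_bij jb; exists c; rewrite -canon_filling_val cE.
rewrite (IH _ cj) -bj -cj !idx index_boxes.
have lt : canon_val c < canon_val b by rewrite bj cj; lia.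
case/orP: (lex_canon_val lt) => [rr|/andP[/eqP rr cc]]; last first.
  by rewrite /reads_before rr; lia.
(* If the next entry lies in a lower row, its box is the first one of the row following that of
   [c]. *)
have [x x1 x2] : exists2 x : box p, brow x = (brow c).+1 & bcol x = 0.
  apply: mkb; apply: leq_ltn_trans (leq0n (bcol b)) _.
  by apply: leq_trans (box_lt b) _; apply: pcont_le.
have cx : canon_val c < canon_val x by apply: canon_val_lex; rewrite x1; lia.
have xb : x = b.
  apply: canon_val_inj; apply/eqP; rewrite eqn_leq andbC.
  apply/andP; split; first by rewrite bj addnS -cj.
  rewrite leqNgt; apply/negP => /lex_canon_val; rewrite x1 x2; lia.
by move: x1 x2; rewrite xb /reads_before; lia.
Qed.

Lemma index_tab_canon b : index_tab (canon_filling p) b = brow b.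
Proof.
rewrite /index_tab; apply: entry_index_canon.
by rewrite canon_filling_val subnKC // leq_addr.
Qed.

End Canon.

(** * Young symmetrizers and Specht polynomials *)

Local Open Scope ring_scope.

Section Stab.
Variables (N : nat) (K : eqType) (c : 'I_N -> K).

Definition fstab : {set 'S_N} := [set s : 'S_N | [forall j, c (s j) == c j]].

Lemma fstabP (s : 'S_N) : reflect (forall j, c (s j) = c j) (s \in fstab).
Proof. by rewrite inE; apply: (iffP forallP) => h j; apply/eqP. Qed.

Fact fstab_group_set : group_set fstab.
Proof.
apply/group_setP; split=> [|s t /fstabP hs /fstabP ht]; apply/fstabP => j.
  by rewrite perm1.
by rewrite permM ht hs.
Qed.
Canonical fstab_group := Group fstab_group_set.

Lemma fstab_tperm j k : c j = c k -> tperm j k \in fstab.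
Proof. by move=> jk; apply/fstabP => l; case: tpermP => // ->. Qed.

End Stab.

(** A multitableau is recorded by the row and column of each entry, which avoids types depending on
    the shape; the block of an entry is given separately by [blk]. *)
Record tableau N := Tableau { trow : 'I_N -> nat; tcol : 'I_N -> nat }.
Arguments trow : simpl never.
Arguments tcol : simpl never.

Section Tableaux.
Variables (F : numFieldType) (N : nat) (B : eqType) (blk : 'I_N -> B).
Local Notation OX := {mpoly F[N]}.
Local Notation "m # s" := [multinom m ((s : 'S_N) i) | i < N]
  (at level 40, left associativity).
Implicit Types (T S : tableau N) (lam mu : B -> nat -> nat).

Definition tab_of lam T :=
  [/\ forall i a b, (a <= b)%N -> (lam i b <= lam i a)%N,
      forall j k, blk j = blk k -> trow T j = trow T k -> tcol T j = tcol T k -> j = k,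
      forall j, (tcol T j < lam (blk j) (trow T j))%N &
      forall i a c, (c < lam i a)%N ->
        exists j, [/\ blk j = i, trow T j = a & tcol T j = c]].

Definition rowg T := fstab_group (fun j => (blk j, trow T j)).
Definition colg T := fstab_group (fun j => (blk j, tcol T j)).
Definition blkg := fstab_group blk.

Definition rsum T (f : OX) : OX := \sum_(s in rowg T) msym s f.
Definition csum T (f : OX) : OX :=
  \sum_(t in colg T) (-1) ^+ odd_perm t *: msym t f.

Lemma msym_sum s (J : Type) (l : seq J) (P : pred J) (f : J -> OX) :
  msym s (\sum_(i <- l | P i) f i) = \sum_(i <- l | P i) msym s (f i).
Proof. exact: raddf_sum. Qed.

Fact rsum_is_linear T : linear (rsum T).
Proof.
move=> c f g; rewrite /rsum scaler_sumr -big_split /=.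
by apply: eq_bigr => s _; rewrite linearP.
Qed.
HB.instance Definition _ T := GRing.isLinear.Build F OX OX *:%R (rsum T) (rsum_is_linear T).

Fact csum_is_linear T : linear (csum T).
Proof.
move=> c f g; rewrite /csum scaler_sumr -big_split /=.
by apply: eq_bigr => s _; rewrite linearP scalerDr !scalerA mulrC.
Qed.
HB.instance Definition _ T := GRing.isLinear.Build F OX OX *:%R (csum T) (csum_is_linear T).

Definition mono T : 'X_{1..N} := [multinom trow T j | j < N].
(** The Specht polynomial: the exponents in a column are 0, 1, 2, ..., so each column contributes a
    Vandermonde determinant. *)
Definition spoly T : OX := csum T 'X_[mono T].
Definition esum T f := csum T (rsum T f).

Lemma rowgP T (s : 'S_N) :
  reflect (forall j, blk (s j) = blk j /\ trow T (s j) = trow T j) (s \in rowg T).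
Proof. by apply: (iffP (fstabP _ _)) => h j; case: (h j) => -> ->. Qed.

Lemma colgP T (s : 'S_N) :
  reflect (forall j, blk (s j) = blk j /\ tcol T (s j) = tcol T j) (s \in colg T).
Proof. by apply: (iffP (fstabP _ _)) => h j; case: (h j) => -> ->. Qed.

Lemma rowg_blk T s : s \in rowg T -> s \in blkg.
Proof. by move=> /rowgP h; apply/fstabP => j; case: (h j). Qed.

Lemma colg_blk T s : s \in colg T -> s \in blkg.
Proof. by move=> /colgP h; apply/fstabP => j; case: (h j). Qed.

Lemma row_col1 lam T s : tab_of lam T -> s \in rowg T -> s \in colg T -> s = 1%g.
Proof.
move=> [_ inj _ _] /rowgP r /colgP c; apply/permP => j; rewrite perm1.
by apply: inj; [case: (r j)|case: (r j)|case: (c j)].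
Qed.

Lemma msym_mono T (s : 'S_N) : s \in blkg -> (mono T # s == mono T) = (s \in rowg T).
Proof.
move=> /fstabP sb; apply/eqP/rowgP => [/mnmP e j|h].
  by split; [|have := e j; rewrite !mnmE].
by apply/mnmP => j; rewrite !mnmE; case: (h j).
Qed.

Lemma mcoeff_msymX m m' (s : 'S_N) : (msym s 'X_[F, m])@_m' = (m' # s == m)%:R.
Proof. by rewrite mcoeff_sym mcoeffX eq_sym. Qed.

Lemma rsum_msym T s f : s \in rowg T -> rsum T (msym s f) = rsum T f.
Proof.
move=> sR; rewrite /rsum [RHS](reindex_inj (mulgI s)) /=.
by apply: eq_big => [t|t _]; rewrite ?groupMl // msymMm.
Qed.

Lemma csum_msym T t f : t \in colg T ->
  csum T (msym t f) = (-1) ^+ odd_perm t *: csum T f.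
Proof.
move=> tC; rewrite /csum [X in _ *: X](reindex_inj (mulgI t)) scaler_sumr /=.
apply: eq_big => [s|s _]; first by rewrite groupMl.
by rewrite msymMm scalerA odd_permM signr_addb mulrA -signr_addb addbb mul1r.
Qed.

Lemma msym_csum T t f : t \in colg T ->
  msym t (csum T f) = (-1) ^+ odd_perm t *: csum T f.
Proof.
move=> tC; rewrite /csum raddf_sum [X in _ *: X](reindex_inj (mulIg t)) scaler_sumr /=.
apply: eq_big => [s|s _]; first by rewrite groupMr.
rewrite linearZ /= msymMm scalerA odd_permM signr_addb mulrCA.
by rewrite -signr_addb addbb mulr1.
Qed.

Lemma eq_opp_eq0 (V : lmodType F) (v : V) : v = - v -> v = 0.
Proof.
move=> /eqP; rewrite -subr_eq0 opprK -mulr2n -scaler_nat scaler_eq0.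
by rewrite pnatr_eq0 => /eqP.
Qed.

(** The transposition of [j] and [k] is absorbed by the row sum of [S] and negates the column sum of
    [T]. *)
Lemma rsum_csum0 S T j k f : j != k -> blk j = blk k ->
  trow S j = trow S k -> tcol T j = tcol T k -> rsum S (csum T f) = 0.
Proof.
move=> jk b rjk cjk; apply: eq_opp_eq0.
have tR : tperm j k \in rowg S by apply: fstab_tperm; rewrite b rjk.
have tC : tperm j k \in colg T by apply: fstab_tperm; rewrite b cjk.
by rewrite -{1}(rsum_msym _ tR) msym_csum // odd_tperm jk scaleN1r linearN.
Qed.

(** Transposing two entries of a column with equal exponents fixes the monomial but changes the sign
    of its antisymmetrization. *)
Lemma csumX_inj T m j k : csum T 'X_[m] != 0 -> blk j = blk k ->
  tcol T j = tcol T k -> m j = m k -> j = k.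
Proof.
move=> /eqP nz b cjk mjk; apply/eqP/negP => /negP jk; apply: nz; apply: eq_opp_eq0.
have tC : tperm j k \in colg T by apply: fstab_tperm; rewrite b cjk.
have := csum_msym 'X_[m] tC; rewrite odd_tperm jk scaleN1r => <-.
rewrite msymX; congr (csum T 'X_[_]); apply/mnmP => l; rewrite mnmE tpermV.
by case: tpermP => [->|->|].
Qed.

(** Ranks within columns are the least exponents that are distinct in each column; on the row
    numbers of [T] they change nothing. *)
Definition colrank T (f : 'I_N -> nat) j :=
  #|[set k | [&& blk k == blk j, tcol T k == tcol T j & (f k < f j)%N]]|.

Lemma card_below (A : {set 'I_N}) (f : 'I_N -> nat) d :
  {in A &, injective f} -> (forall k, k \in A -> (f k < d)%N) -> (#|A| <= d)%N.
Proof.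
move=> inj lt; case: d lt => [|d] lt.
  by rewrite leqn0 cards_eq0; apply/eqP/setP => k; rewrite inE; apply/negP => /lt.
have inj' : {in A &, injective (fun k => inord (f k) : 'I_d.+1)}.
  move=> k l kA lA /(congr1 val); rewrite /= !inordK ?lt // => e; exact: inj.
by rewrite -(card_in_imset inj') -[leqRHS]card_ord max_card.
Qed.

Lemma card_above (A : {set 'I_N}) (f : 'I_N -> nat) d :
  (forall a, (a < d)%N -> exists2 k, k \in A & f k = a) -> (d <= #|A|)%N.
Proof.
case: d => // d sur.
have h : [set: 'I_d.+1] \subset [set inord (f k) | k in A].
  apply/subsetP => a _; have [k kA ka] := sur _ (ltn_ord a).
  by apply/imsetP; exists k => //; apply: val_inj; rewrite /= inordK ka.
have := leq_trans (subset_leq_card h) (leq_imset_card _ _).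
by rewrite cardsT card_ord.
Qed.

Lemma colrank_row lam T j : tab_of lam T -> colrank T (trow T) j = trow T j.
Proof.
move=> [dec inj lt sur]; apply/eqP; rewrite eqn_leq; apply/andP; split.
  apply: (@card_below _ (trow T)) => [k l|k]; rewrite !inE.
    move=> /and3P[/eqP b1 /eqP c1 _] /and3P[/eqP b2 /eqP c2 _] rr.
    by apply: inj; rewrite ?b1 ?c1.
  by case/and3P.
apply: (@card_above _ (trow T)) => a aj.
have := leq_trans (lt j) (dec (blk j) _ _ (ltnW aj)).
case/sur => k [b r c]; exists k => //.
by rewrite !inE b c r aj !eqxx.
Qed.

Lemma colrank_le T (f : 'I_N -> nat) j :
  (forall k l, blk k = blk l -> tcol T k = tcol T l -> f k = f l -> k = l) ->
  (colrank T f j <= f j)%N.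
Proof.
move=> inj; apply: (@card_below _ f) => [k l|k]; rewrite !inE.
  move=> /and3P[/eqP b1 /eqP c1 _] /and3P[/eqP b2 /eqP c2 _] rr.
  by apply: inj; rewrite ?b1 ?c1.
by case/and3P.
Qed.

(* Twice the sum of the ranks counts the ordered pairs of distinct entries    *)
(* lying in a common column.                                                  *)
Lemma sum_colrank T (f : 'I_N -> nat) :
  (forall k l, blk k = blk l -> tcol T k = tcol T l -> f k = f l -> k = l) ->
  ((\sum_j colrank T f j).*2 =
   \sum_j \sum_k [&& blk k == blk j, tcol T k == tcol T j & k != j])%N.
Proof.
move=> inj.
have E : (\sum_j colrank T f j =
    \sum_j \sum_k [&& blk k == blk j, tcol T k == tcol T j & (f k < f j)%N])%N.
  by apply: eq_bigr => j _; rewrite /colrank -sum1dep_card big_mkcond.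
rewrite -addnn {2}E exchange_big E -big_split /=; apply: eq_bigr => j _.
rewrite -big_split /=; apply: eq_bigr => k _.
rewrite [blk j == _]eq_sym [tcol T j == _]eq_sym.
case: eqP => //= b; case: eqP => //= c; case: (eqVneq k j) => [->|ne /=].
  by rewrite ltnn.
case: (ltngtP (f k) (f j)) => //= e; case/eqP: ne; exact: inj.
Qed.

(** The exponents are distinct in each column, so each is at least its rank, and the ranks have the
    same sum for [m] as for the rows of [T]. In equal degree every exponent is its rank, so [m]
    permutes the row numbers within columns. *)
Lemma csumX_deg lam T m : tab_of lam T -> csum T 'X_[m] != 0 ->
  (mdeg (mono T) <= mdeg m)%N /\
  (mdeg m = mdeg (mono T) ->
   exists2 t, t \in colg T & forall j, m j = trow T (t j)).
Proof.
move=> tT nz; have minj := csumX_inj nz.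
have rinj : forall k l, blk k = blk l -> tcol T k = tcol T l ->
    trow T k = trow T l -> k = l.
  by case: tT => _ inj _ _ k l b c r; apply: inj.
have sumE : (mdeg (mono T) = \sum_j colrank T m j)%N.
  apply: double_inj; rewrite sum_colrank // -(sum_colrank rinj) mdegE.
  by congr _.*2; apply: eq_bigr => j _; rewrite mnmE (colrank_row _ tT).
have le j : (colrank T m j <= m j)%N by apply: colrank_le.
rewrite sumE mdegE; split; first exact: leq_sum.
move=> e.
have {}le j : m j = colrank T m j.
  apply/eqP; rewrite eqn_leq le andbT leqNgt; apply/negP => lt.
  have : (\sum_j colrank T m j < \sum_j m j)%N.
    rewrite (bigD1 j) //= [ltnRHS](bigD1 j) //= -addSn leq_add //.
    exact: leq_sum.
  by rewrite e ltnn.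
have [dec inj lt sur] := tT.
(* The rank [m j] is smaller than the height of the column of [j], so this column has a box in row
   [m j]. *)
have ex j : exists k, [&& blk k == blk j, tcol T k == tcol T j & trow T k == m j].
  suff /sur[k [b r c]] : (tcol T j < lam (blk j) (m j))%N.
    by exists k; rewrite b r c !eqxx.
  rewrite ltnNge; apply/negP => h; have := ltnn (m j); rewrite {1}le => /negP; apply.
  apply: leq_trans (_ : #|[set k | (blk k == blk j) && (tcol T k == tcol T j)]| <= _)%N.
    apply: proper_card; apply/properP; split.
      by apply/subsetP => k; rewrite !inE => /and3P[-> ->].
    by exists j; rewrite inE ?eqxx ?ltnn.
  apply: (@card_below _ (trow T)) => [k l|k]; rewrite !inE.
    by move=> /andP[/eqP b1 /eqP c1] /andP[/eqP b2 /eqP c2] rr; apply: inj; rewrite ?b1 ?c1.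
  move=> /andP[/eqP b1 /eqP c1]; rewrite ltnNge; apply/negP => h'.
  by have := lt k; rewrite b1 c1 ltnNge (leq_trans (dec _ _ _ h')).
pose t j := xchoose (ex j).
have tP j : [&& blk (t j) == blk j, tcol T (t j) == tcol T j & trow T (t j) == m j].
  exact: xchooseP (ex j).
have tinj : injective t.
  move=> j k jk; have /and3P[/eqP b1 /eqP c1 /eqP r1] := tP j.
  have /and3P[/eqP b2 /eqP c2 /eqP r2] := tP k.
  by apply: minj; [rewrite -b1 jk|rewrite -c1 jk|rewrite -r1 jk].
exists (perm tinj); last by move=> j; rewrite permE; case/and3P: (tP j) => _ _ /eqP.
by apply/colgP => j; rewrite permE; case/and3P: (tP j) => /eqP -> /eqP ->.
Qed.

Lemma csumX_spoly lam T m : tab_of lam T -> mdeg m = mdeg (mono T) ->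
  exists c, csum T 'X_[m] = c *: spoly T.
Proof.
move=> tT dm; case: (eqVneq (csum T 'X_[m]) 0) => [->|nz].
  by exists 0; rewrite scale0r.
have [_ /(_ dm)[t tC mt]] := csumX_deg tT nz.
exists ((-1) ^+ odd_perm t); rewrite /spoly.
have -> : mono T = m # (t^-1)%g.
  by apply/mnmP => j; rewrite !mnmE mt permKV.
by rewrite -msymX csum_msym // scalerA -signr_addb addbb scale1r.
Qed.

Lemma rsum_supp T f m : m \in msupp (rsum T f) ->
  exists2 s : 'S_N, s \in rowg T & m # s \in msupp f.
Proof.
rewrite mcoeff_msupp /rsum raddf_sum /= => nz.
have [s sR sf] : exists2 s : 'S_N, s \in rowg T & (msym s f)@_m != 0.
  apply/exists_inP; apply: contra_neqT nz; rewrite negb_exists_in => /forall_inP h.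
  by rewrite big1 // => s /h; rewrite negbK => /eqP.
by exists s => //; rewrite mcoeff_msupp -mcoeff_sym.
Qed.

Lemma csum_supp T f m : m \in msupp (csum T f) ->
  exists2 s : 'S_N, s \in colg T & m # s \in msupp f.
Proof.
rewrite mcoeff_msupp /csum raddf_sum /= => nz.
have [s sR sf] : exists2 s : 'S_N, s \in colg T & (msym s f)@_m != 0.
  apply/exists_inP; apply: contra_neqT nz; rewrite negb_exists_in => /forall_inP h.
  by rewrite big1 // => s /h; rewrite negbK mcoeffZ => /eqP ->; rewrite mulr0.
by exists s => //; rewrite mcoeff_msupp -mcoeff_sym.
Qed.

Lemma mdeg_perm (m : 'X_{1..N}) (s : 'S_N) : mdeg (m # s) = mdeg m.
Proof.
rewrite !mdegE [RHS](reindex_inj (@perm_inj _ s)) /=.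
by apply: eq_bigr => j _; rewrite mnmE.
Qed.

(** Row sums preserve the degree, so [csumX_spoly] applies to each monomial of the row sum. *)
Lemma esum_spoly lam T : tab_of lam T -> exists c, esum T (spoly T) = c *: spoly T.
Proof.
move=> tT; rewrite /esum {1}[rsum T _]mpolyE raddf_sum /=.
have [c cP] : exists c : 'X_{1..N} -> F, forall m, m \in msupp (rsum T (spoly T)) ->
    csum T 'X_[m] = c m *: spoly T.
  have key m : exists c, m \in msupp (rsum T (spoly T)) -> csum T 'X_[m] == c *: spoly T.
    case mS: (m \in _); last by exists 0.
    case/rsum_supp: mS => s _ /csum_supp[t _]; rewrite msuppX inE => /eqP e.
    have [|c cE] := @csumX_spoly lam T m tT; first by rewrite -e !mdeg_perm.
    by exists c; rewrite cE.
  (* Comparing coefficients at one monomial of [spoly T] makes the scalar an explicit function of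
     [m]. *)
  have [nz|/negPn/eqP z] := boolP (spoly T != 0).
    have [m0 m0S] : exists m0, (spoly T)@_m0 != 0.
      exists (mlead (spoly T)); by rewrite mleadc_eq0.
    exists (fun m => (csum T 'X_[m])@_m0 / (spoly T)@_m0) => m mS.
    have [c /(_ mS) /eqP cE] := key m; rewrite cE mcoeffZ.
    by rewrite mulfK.
  by exists (fun=> 0) => m mS; rewrite z linear0 msupp0 in mS.
exists (\sum_(m <- msupp (rsum T (spoly T))) (rsum T (spoly T))@_m * c m).
rewrite scaler_suml [LHS]big_seq [RHS]big_seq; apply: eq_bigr => m mS.
by rewrite linearZ /= cP // scalerA.
Qed.

(** A column permutation fixing [mono T] preserves the rows as well, hence is the identity. *)
Lemma spoly_mono lam T : tab_of lam T -> (spoly T)@_(mono T) = 1.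
Proof.
move=> tT; rewrite /spoly /csum raddf_sum (bigD1 1%g) //= odd_perm1 scale1r.
rewrite msym1m mcoeffX eqxx big1 ?addr0 // => t /andP[tC t1].
rewrite mcoeffZ mcoeff_msymX msym_mono ?(colg_blk tC) //.
case tR : (t \in _); last by rewrite mulr0.
by rewrite (row_col1 tT tR tC) eqxx in t1.
Qed.

Lemma spoly_neq0 lam T : tab_of lam T -> spoly T != 0.
Proof.
move=> /spoly_mono e; apply/eqP => z; move/eqP: e; rewrite z mcoeff0.
by rewrite eq_sym oner_eq0.
Qed.

(* [esum T (spoly T)] at [mono T], times [#|rowg T|], is the squared norm of  *)
(* [rsum T (spoly T)] for the form making the monomials orthonormal.          *)
Lemma esum_spoly_neq0 lam T : tab_of lam T -> esum T (spoly T) != 0.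
Proof.
move=> tT; set v := rsum T (spoly T).
have vE m : v@_m = \sum_(s in rowg T) \sum_(t in colg T)
    (-1) ^+ odd_perm t * (m == mono T # (s * t)%g)%:R.
  rewrite /v /rsum raddf_sum (reindex_inj invg_inj) /=.
  apply: eq_big => [s|s _]; first by rewrite groupV.
  rewrite /spoly /csum (raddf_sum (msym _)) (raddf_sum (mcoeff m)) (reindex_inj invg_inj) /=.
  apply: eq_big => [t|t _]; first by rewrite groupV.
  rewrite linearZ /= -msymMm mcoeffZ mcoeff_msymX odd_permV -invMg; congr (_ * _%:R).
  congr nat_of_bool; apply/eqP/eqP => [<-|->]; apply/mnmP => j; rewrite !mnmE ?permK //.
  by rewrite permKV.
have vreal m : v@_m \is Num.real.
  rewrite vE; apply: rpred_sum => s _; apply: rpred_sum => t _.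
  by rewrite rpredM ?realn // rpredX // realN real1.
(* Only the identity of the column group contributes, once for each row permutation. *)
have v0 : v@_(mono T) != 0.
  rewrite vE (eq_bigr (fun=> 1)) ?sumr_const ?pnatr_eq0 -?lt0n ?cardG_gt0 // => s sR.
  rewrite (bigD1 1%g) //= odd_perm1 mul1r mulg1 eq_sym msym_mono ?(rowg_blk sR) // sR.
  rewrite big1 ?addr0 // => t /andP[tC t1].
  have stb : (s * t)%g \in blkg by rewrite groupM ?(rowg_blk sR) ?(colg_blk tC).
  rewrite eq_sym (msym_mono _ stb) groupMl //.
  case tR : (t \in _); last by rewrite mulr0.
  by rewrite (row_col1 tT tR tC) eqxx in t1.
(* By [vE], taking the coefficient of [esum T f] at [mono T] amounts to pairing [f] with [v]; here
   [f = v]. *)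
have key : (esum T v)@_(mono T) = \sum_(m <- msupp v) v@_m ^+ 2.
  rewrite /esum /csum raddf_sum /=.
  under eq_bigr => t _ do rewrite mcoeffZ mcoeff_sym /rsum raddf_sum mulr_sumr /=.
  rewrite exchange_big /=.
  under eq_bigr => s _.
    under eq_bigr => t _.
      rewrite mcoeff_sym.
      have -> : mono T # t # s = mono T # (s * t)%g.
        by apply/mnmP => j; rewrite !mnmE permM.
      rewrite {1}[v]mpolyE raddf_sum mulr_sumr /=; over.
    rewrite exchange_big /=; over.
  rewrite exchange_big /=; apply: eq_bigr => m _.
  rewrite expr2 [X in _ = _ * X]vE mulr_sumr; apply: eq_bigr => s _.
  rewrite mulr_sumr; apply: eq_bigr => t _.
  by rewrite mcoeffZ mcoeffX mulrCA.
have pos : 0 < (esum T v)@_(mono T).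
  rewrite key (bigD1_seq (mono T)) ?msupp_uniq ?mcoeff_msupp //=.
  apply: ltr_pwDl; first by rewrite lt_def expf_neq0 //= real_exprn_even_ge0.
  by apply: sumr_ge0 => m _; rewrite real_exprn_even_ge0.
(* Since [v] is invariant under row permutations, a second row sum only multiplies it by their
   number. *)
have rr : rsum T v = #|rowg T|%:R *: v.
  rewrite scaler_nat -sumr_const {1}/rsum; apply: eq_bigr => s sR.
  rewrite /v {1}/rsum raddf_sum [RHS](reindex_inj (mulIg s)) /=.
  by apply: eq_big => [t|t _]; rewrite ?groupMr // msymMm.
apply/eqP => z; move: pos; rewrite /esum rr linearZ /= -/(esum T (spoly T)) z.
by rewrite scaler0 mcoeff0 ltxx.
Qed.

(** Some monomial x^rho_S with permuted variables survives the column sum of [T]. By [csumX_deg] its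
    degree is then minimal and its exponents are the rows of [T] permuted, so in every block [S] and
    [T] have equally many entries in each row. *)
Lemma esum0_deg lam mu T S (g : 'S_N) : tab_of lam T -> tab_of mu S -> g \in blkg ->
  (mdeg (mono S) <= mdeg (mono T))%N ->
  esum T (msym g (spoly S)) != 0 -> mu =2 lam.
Proof.
move=> tT tS gb le nz.
have [m [mdm ms cm]] : exists m, [/\ mdeg m = mdeg (mono S),
     exists2 s : 'S_N, s \in blkg & m = mono S # s & csum T 'X_[m] != 0].
  have : exists2 m, m \in msupp (rsum T (msym g (spoly S))) & csum T 'X_[m] != 0.
    apply/hasP; apply: contra_neqT nz => /hasPn h.
    rewrite /esum [rsum T _]mpolyE raddf_sum big_seq big1 //= => m /h.
    by rewrite negbK linearZ /= => /eqP ->; rewrite scaler0.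
  case=> m /rsum_supp[s sR].
  rewrite mcoeff_msupp mcoeff_sym -mcoeff_msupp => /csum_supp[t tC].
  rewrite msuppX inE => /eqP e cm; exists m; split=> //.
    by rewrite -e !mdeg_perm.
  exists ((t * g * s)^-1)%g; first by rewrite groupV !groupM ?(colg_blk tC) ?(rowg_blk sR).
  rewrite -e; apply/mnmP => j; rewrite !mnmE; congr (m _).
  by rewrite -{1}[j](permKV (t * g * s)%g) !permM.
have [le' /(_ _)] := csumX_deg tT cm; rewrite mdm => tc.
have [|t tC mt] := tc; first by apply/eqP; rewrite eqn_leq le -mdm.
have [s sb mE] := ms.
have cnt i a : #|[set j | (blk j == i) && (trow S j == a)]| =
    #|[set j | (blk j == i) && (trow T j == a)]|.
  have inj : injective (fun j => (s^-1 * t)%g j) by apply: perm_inj.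
  rewrite -(card_imset _ inj); apply: eq_card => k; rewrite !inE.
  apply/imsetP/idP => [[j]|].
    rewrite inE => /andP[/eqP bj /eqP rj] ->.
    have -> : trow T ((s^-1 * t)%g j) = trow S j.
      by rewrite permM -mt mE !mnmE permKV.
    rewrite rj eqxx andbT; apply/eqP.
    have /fstabP -> : (s^-1 * t)%g \in blkg by rewrite groupM ?groupV ?(colg_blk tC).
    by [].
  move=> /andP[/eqP bk /eqP rk]; exists ((s^-1 * t)^-1 k)%g; last by rewrite permKV.
  rewrite inE; apply/andP; split.
    have /fstabP -> : (s^-1 * t)^-1%g \in blkg by rewrite groupV groupM ?groupV ?(colg_blk tC).
    by apply/eqP.
  rewrite -rk invMg invgK permM; apply/eqP.
  have := mt (t^-1 k)%g; rewrite permKV => <-.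
  by rewrite mE !mnmE.
have len nu U i a : tab_of nu U -> #|[set j | (blk j == i) && (trow U j == a)]| = nu i a.
  move=> [dec inj lt sur]; apply/eqP; rewrite eqn_leq; apply/andP; split.
    apply: (@card_below _ (tcol U)) => [k l|k]; rewrite !inE.
      by move=> /andP[/eqP b1 /eqP c1] /andP[/eqP b2 /eqP c2] rr; apply: inj; rewrite ?b1 ?c1.
    by move=> /andP[/eqP <- /eqP <-].
  apply: (@card_above _ (tcol U)) => c /sur[k [b r cE]].
  by exists k => //; rewrite inE b r !eqxx.
by move=> i a; rewrite -(len _ _ i a tS) -(len _ _ i a tT) cnt.
Qed.

(** * Standardness, and transport between tableaux of the same shape *)

Definition standard T :=
  (forall j k, blk j = blk k -> trow T j = trow T k -> (tcol T j < tcol T k)%N -> (j < k)%N) /\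
  (forall j k, blk j = blk k -> tcol T j = tcol T k -> (trow T j < trow T k)%N -> (j < k)%N).

(** In the column of [k] in [T], the entry [j] in row [trow S k] lies above [k], so [j < k] and [j]
    has the same row in [S] as in [T]. Hence [j] and [k] share a row of [S] and a column of [T]. *)
Lemma rsum_csum_std0 lam S T (k : 'I_N) f : tab_of lam T -> standard T ->
  (forall j : 'I_N, (j < k)%N -> trow S j = trow T j) -> (trow S k < trow T k)%N ->
  rsum S (csum T f) = 0.
Proof.
move=> [dec inj lt sur] [_ sc] eqr ltr.
have /sur[j [b r c]] := leq_trans (lt k) (dec (blk k) _ _ (ltnW ltr)).
have jk : (j < k)%N by apply: sc; rewrite ?r.
apply: (@rsum_csum0 S T j k) => //; last by rewrite eqr.
by rewrite neq_ltn jk.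
Qed.

Definition tmap S T (s : 'S_N) := forall j,
  [/\ blk (s j) = blk j, trow T (s j) = trow S j & tcol T (s j) = tcol S j].

Lemma tmap_exists lam S T : tab_of lam S -> tab_of lam T -> exists s, tmap S T s.
Proof.
move=> [_ injS ltS _] [_ _ _ surT].
have ex j : exists k, [&& blk k == blk j, trow T k == trow S j & tcol T k == tcol S j].
  have [k [b r c]] := surT _ _ _ (ltS j).
  by exists k; rewrite b r c !eqxx.
pose f j := xchoose (ex j).
have fP j : [/\ blk (f j) = blk j, trow T (f j) = trow S j & tcol T (f j) = tcol S j].
  by have /and3P[/eqP ? /eqP ? /eqP] := xchooseP (ex j).
have finj : injective f.
  move=> j k jk; have [b1 r1 c1] := fP j; have [b2 r2 c2] := fP k.
  by apply: injS; [rewrite -b1 jk|rewrite -r1 jk|rewrite -c1 jk].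
by exists (perm finj) => j; rewrite permE.
Qed.

Lemma tmap_blk S T s : tmap S T s -> s \in blkg.
Proof. by move=> h; apply/fstabP => j; case: (h j). Qed.

(** Conjugation by [s] carries the column group of [S] to that of [T] and preserves signs. *)
Lemma msym_spoly S T s : tmap S T s -> msym s (spoly S) = spoly T.
Proof.
move=> h; rewrite /spoly /csum raddf_sum [RHS](reindex_inj (conjg_inj s)) /=.
apply: eq_big => [t|t _]; last first.
  rewrite linearZ /= odd_permJ -msymMm conjgC msymMm; congr (_ *: msym _ _).
  rewrite msymX; congr 'X_[_]; apply/mnmP => j; rewrite !mnmE.
  by have [_ <- _] := h ((s^-1)%g j); rewrite permKV.
apply/colgP/colgP => tC j.
  have [b c] := tC ((s^-1)%g j).
  rewrite conjgE permM permM.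
  have [b1 _ c1] := h (t ((s^-1)%g j)); have [b2 _ c2] := h ((s^-1)%g j).
  by rewrite b1 c1 b c -b2 -c2 permKV.
have [b1 _ c1] := h (t j); have [b2 _ c2] := h j.
have := tC (s j); rewrite conjgE !permM permK b1 c1 b2 c2.
by [].
Qed.

End Tableaux.

(** * A basis of the group algebra *)

Lemma seqlexi_first_diff (s t : seqlexi nat) : size s = size t -> (s <= t)%O ->
  s != t -> exists2 k, (forall j, (j < k)%N -> nth 0%N s j = nth 0%N t j) &
    (k < size s)%N && (nth 0%N s k < nth 0%N t k)%N.
Proof.
elim: s t => [|x s IH] [|y t] //= [st]; rewrite lexi_cons !leEnat => /andP[].
case: (ltngtP x y) => //= [xy _ _ _|<- _ le]; first by exists 0%N.
rewrite eqseq_cons eqxx /= => /(IH _ st le).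
by case=> k kj kk; exists k.+1 => // -[].
Qed.

Section Extend.
Variables (T : finType) (X : {set T}) (V : zmodType).

Definition extend0 (v : 'I_#|X| -> V) (x : T) : V :=
  if [pick k | enum_val k == x] is Some k then v k else 0.

Lemma extend0_val v k : extend0 v (enum_val k) = v k.
Proof.
rewrite /extend0; case: pickP => [l /eqP/enum_val_inj -> //|/(_ k)].
by rewrite eqxx.
Qed.

Lemma extend0_out v x : x \notin X -> extend0 v x = 0.
Proof.
move=> xX; rewrite /extend0; case: pickP => // k /eqP e.
by rewrite -e enum_valP in xX.
Qed.

End Extend.

Lemma sum_fiber (F : fieldType) (V : lmodType F) (I : finType) (X : {set I * I})
    (a : I * I -> F) (d : F) (w : I -> V) j :
  (forall x, x \notin X -> a x = 0) ->
  \sum_k (a (k, j) * d) *: w k =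
  \sum_(x in X) (if x.2 == j then a x * d else 0) *: w x.1.
Proof.
move=> a0; transitivity (\sum_(y | y.2 == j) (a y * d) *: w y.1).
  transitivity (\sum_k \sum_(l | l == j) (a (k, l) * d) *: w k).
    by apply: eq_bigr => k _; rewrite big_pred1_eq.
  by rewrite pair_big_dep /=; apply: eq_big => -[k l].
rewrite big_mkcond [RHS]big_mkcond; apply: eq_bigr => y _.
case: ifP => yj; case: ifP => yX; rewrite ?scale0r //.
by rewrite a0 ?yX // mul0r scale0r.
Qed.

Section GroupCoef.
Variables (F : numFieldType) (N : nat) (B : eqType) (blk : 'I_N -> B).
Local Notation OX := {mpoly F[N]}.
Implicit Types (T S : tableau N).

(* The coefficient of g in the Young symmetrizer csum * rsum of T.            *)
Definition ecoef T (g : 'S_N) : F := (msym g^-1 (spoly F blk T))@_(mono T).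

(** Expand the Specht polynomial over the column group: the summand of [t] contributes to the
    coefficient of [g * t] exactly when [g] fixes [mono T], that is when [g] lies in the row
    group. *)
Lemma sum_ecoef T f :
  \sum_(g in blkg blk) ecoef T g *: msym g f = esum blk T f.
Proof.
rewrite /esum /csum.
under [RHS]eq_bigr => t _ do rewrite /rsum msym_sum scaler_sumr.
under [LHS]eq_bigr => g _ do rewrite /ecoef /spoly /csum
  msym_sum (raddf_sum (mcoeff (mono T))) scaler_suml.
rewrite exchange_big; apply: eq_bigr => t tC /=.
rewrite [LHS](reindex_inj (mulIg t)) /=.
rewrite [LHS](bigID (mem (rowg blk T))) /= [X in _ + X]big1 ?addr0; last first.
  move=> g /andP[gG gR]; rewrite linearZ /= mcoeffZ -msymMm mcoeff_msymX.
  rewrite groupMr ?(colg_blk tC) // in gG.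
  have -> : (t * (g * t)^-1 = g^-1)%g by rewrite invMg mulKVg.
  by rewrite (@msym_mono _ _ blk) ?groupV // (negPf gR) mulr0 scale0r.
apply: eq_big => [g|g /andP[_ gR]].
  rewrite groupMr ?(colg_blk tC) //; case gR: (g \in rowg _ _); last by rewrite andbF.
  by rewrite (rowg_blk gR).
rewrite linearZ /= mcoeffZ -msymMm mcoeff_msymX.
have -> : (t * (g * t)^-1 = g^-1)%g by rewrite invMg mulKVg.
have gV : g^-1%g \in blkg blk by rewrite groupV (rowg_blk gR).
rewrite (msym_mono T gV) groupV gR mulr1.
by rewrite (msymMm f g t).
Qed.

End GroupCoef.

Section Family.
Variables (F : numFieldType) (N : nat) (B : eqType) (blk : 'I_N -> B).
Local Notation OX := {mpoly F[N]}.
Variables (L : eqType) (rowlen : L -> B -> nat -> nat).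
Hypothesis rowlen_inj : forall l l', rowlen l =2 rowlen l' -> l = l'.
Variables (I : finType) (sh : I -> L) (tab : I -> tableau N).
Hypothesis tabP : forall i, tab_of blk (rowlen (sh i)) (tab i).
Hypothesis tab_std : forall i, standard blk (tab i).
Hypothesis tab_inj : forall i j, sh i = sh j -> trow (tab i) =1 trow (tab j) -> i = j.

Local Notation sp i := (spoly F blk (tab i)).
Local Notation es i := (esum blk (tab i)).

Lemma mdeg_shape i j : sh i = sh j -> mdeg (mono (tab i)) = mdeg (mono (tab j)).
Proof.
move=> e; have := tabP i; rewrite e => ti; have [s sP] := tmap_exists ti (tabP j).
rewrite -(mdeg_perm (mono (tab j)) s); congr mdeg; apply/mnmP => k; rewrite !mnmE.
by case: (sP k).
Qed.

Let maxdeg := (\sum_i mdeg (mono (tab i)))%N.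
Let word i : seqlexi nat := [seq trow (tab i) j | j <- enum 'I_N].
(** Tableaux are ordered by decreasing degree of x^rho, whence the subtraction from [maxdeg], and
    then lexicographically by the rows of the successive entries. *)
Let key i : seqlexi nat := (maxdeg - mdeg (mono (tab i)))%N :: word i.

Let key_deg i j : (key i <= key j)%O ->
  (mdeg (mono (tab j)) <= mdeg (mono (tab i)))%N.
Proof.
rewrite lexi_cons => /andP[le _].
have h k : (mdeg (mono (tab k)) <= maxdeg)%N by rewrite /maxdeg (bigD1 k) //= leq_addr.
by move: (h i) (h j) le; rewrite leEnat; lia.
Qed.

(** For different shapes this is [esum0_deg], since larger degrees come first. For equal shapes the
    first entry on which the rows differ has the smaller row number in tableau [i], and
    [rsum_csum_std0] applies. *)
Lemma esum_spoly0 i j : (key i <= key j)%O -> i != j -> es i (sp j) = 0.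
Proof.
move=> le ij; have [e|ne] := eqVneq (sh i) (sh j); last first.
  apply/eqP/negPn/negP => nz; case/eqP: ne; apply/esym/rowlen_inj.
  apply: (esum0_deg (F := F) (g := 1%g) (tabP i) (tabP j) _ (key_deg le)); first exact: group1.
  by rewrite msym1m.
have {}le : (word i <= word j)%O.
  by move: le; rewrite lexi_cons (mdeg_shape e) lexx /= => ->.
have szE k : size (word k) = N by rewrite size_map size_enum_ord.
have nthE k (l : 'I_N) : nth 0%N (word k) l = trow (tab k) l.
  by rewrite (nth_map l) ?size_enum_ord // nth_ord_enum.
have [||k kj /andP[]] := seqlexi_first_diff _ le.
- by rewrite !szE.
- apply: contraNneq ij => wE; apply/eqP/tab_inj => // l.
  by rewrite -!nthE wE.
rewrite szE => kN; rewrite -[k]/(val (Ordinal kN)) !nthE => lt.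
rewrite /esum /spoly (rsum_csum_std0 _ (tabP j) (tab_std j) _ lt) ?linear0 //.
by move=> l lk; have := kj l lk; rewrite !nthE.
Qed.

Lemma pick_first (A : pred I) i0 : A i0 ->
  exists2 i, A i & forall j, A j -> j != i -> es i (sp j) = 0.
Proof.
move=> Ai0; case: (arg_minP key Ai0) => i Ai le; exists i => // j /le ij ji.
by apply: esum_spoly0; rewrite // eq_sym.
Qed.

Lemma pick_last (A : pred I) i0 : A i0 ->
  exists2 i, A i & forall j, A j -> j != i -> es j (sp i) = 0.
Proof.
move=> Ai0; case: (arg_maxP key Ai0) => i Ai le; exists i => // j /le ij ji.
exact: esum_spoly0.
Qed.

Lemma esum_spolyE i : exists2 c, c != 0 & es i (sp i) = c *: sp i.
Proof.
have [c cE] := esum_spoly F (tabP i); exists c => //.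
by have := esum_spoly_neq0 F (tabP i); rewrite cE scaler_eq0 negb_or => /andP[].
Qed.

(** The symmetrizer of the first tableau with a non-zero coefficient leaves only its own term. *)
Lemma spoly_free (c : I -> F) : \sum_i c i *: sp i = 0 -> forall i, c i = 0.
Proof.
move=> z i0; apply/eqP/negPn/negP => ci0.
have [i ci h] := @pick_first (fun i => c i != 0) i0 ci0.
move/(congr1 (esum blk (tab i))): z.
rewrite /esum !linear0 (raddf_sum (rsum blk (tab i))) (raddf_sum (csum blk (tab i))).
rewrite (bigD1 i) //= big1 ?addr0 => [|j ji]; last first.
  rewrite linearZ /= linearZ /= -/(esum blk (tab i) (sp j)).
  by have [->|/h ->] := eqVneq (c j) 0; rewrite ?scale0r ?scaler0.
rewrite !linearZ /= -/(esum blk (tab i) (sp i)).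
have [d d0 ->] := esum_spolyE i => /eqP.
rewrite !scaler_eq0 (negPf ci) (negPf d0) /=; apply/negP.
exact: spoly_neq0 (tabP i).
Qed.

Lemma tmapP_subproof i j : sh i = sh j -> exists s, tmap blk (tab i) (tab j) s.
Proof. by move=> e; have := tabP i; rewrite e => ti; apply: tmap_exists ti (tabP j). Qed.

Variable smap : I -> I -> 'S_N.
Hypothesis smapP : forall i j, sh i = sh j -> tmap blk (tab i) (tab j) (smap i j).

(** The coefficient of [h] in e_i s, where s moves tableau [j] to tableau [i]. *)
Definition theta i j (h : 'S_N) : F := ecoef F blk (tab i) ((smap j i)^-1 * h)%g.

Lemma sum_theta i j (f : OX) : sh i = sh j ->
  \sum_(h in blkg blk) theta i j h *: msym h f = es i (msym (smap j i) f).
Proof.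
move=> e; have sb := tmap_blk (smapP (esym e)).
rewrite -sum_ecoef (reindex_inj (mulgI (smap j i))) /=.
apply: eq_big => [h|h _]; first by rewrite groupMl.
by rewrite /theta mulKg msymMm.
Qed.

(** Relabelling conjugates Young symmetrizers: e_i s = s e_j. *)
Lemma esum_smap i j (f : OX) : sh i = sh j ->
  es i (msym (smap j i) f) = msym (smap j i) (es j f).
Proof.
move=> e; have h := smapP (esym e); set s := smap j i in h *.
have sb := tmap_blk h.
rewrite -!sum_ecoef raddf_sum (reindex_inj (conjg_inj s)) /=.
apply: eq_big => [g|g _]; first by rewrite memJ_norm // (subsetP (normG _)).
rewrite msymZ; have <- : msym (g ^ s)%g (msym s f) = msym s (msym g f).
  by rewrite -[LHS]msymMm -[RHS]msymMm -conjgC.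
suff -> : ecoef F blk (tab i) (g ^ s)%g = ecoef F blk (tab j) g by [].
rewrite /ecoef.
rewrite -(msym_spoly F h) -msymMm -conjVg -conjgC msymMm mcoeff_sym.
congr ((msym _ _)@_ _); apply/mnmP => k; rewrite !mnmE.
by case: (h k).
Qed.

Hypothesis card_le : (#|blkg blk| <= #|[set x : I * I | sh x.1 == sh x.2]|)%N.

(** The functions [theta i j] on the group are independent and at least as many as its elements, so
    they span all functions, in particular the indicator of 1. *)
Lemma one_theta : exists a : I * I -> F, forall h, h \in blkg blk ->
  (h == 1%g)%:R = \sum_(x | sh x.1 == sh x.2) a x * theta x.1 x.2 h.
Proof.
pose X := [set x : I * I | sh x.1 == sh x.2].
have one_in : 1%g \in blkg blk by apply: group1.
pose A : 'M[F]_(#|X|, #|blkg blk|) :=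
  \matrix_(x, g) theta (enum_val x).1 (enum_val x).2 (enum_val g).
have free : row_free A.
  apply: inj_row_free => v vA.
  have [a aE a0] : exists2 a : I * I -> F, (forall x, a (enum_val x) = v 0 x) &
      forall x, x \notin X -> a x = 0.
    exists (extend0 (v 0)) => x; [exact: extend0_val|exact: extend0_out].
  have zero f : \sum_(x in X) a x *: es x.1 (msym (smap x.2 x.1) f) = 0.
    transitivity (\sum_(x in X) \sum_(h in blkg blk) (a x * theta x.1 x.2 h) *: msym h f).
      apply: eq_bigr => x; rewrite inE => /eqP xX; rewrite -sum_theta // scaler_sumr.
      by apply: eq_bigr => h _; rewrite scalerA.
    rewrite exchange_big big1 //= => h hG; rewrite -scaler_suml.
    have /matrixP/(_ 0 (enum_rank_in hG h)) := vA; rewrite !mxE => e.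
    rewrite [X in X *: _](_ : _ = 0) ?scale0r // -[RHS]e big_enum_val /=.
    by apply: eq_bigr => x _; rewrite aE !mxE enum_rankK_in.
  suff az x : a x = 0 by apply/rowP => x; rewrite -aE az mxE.
  apply/eqP/negPn/negP => ax.
  (* For the last [j] occurring as a second index, all other symmetrizers involved kill [sp j].
     Applied to [sp j], the relation becomes one between the [sp k], with coefficients
     [a (k, j) * d]. *)
  have [|j /existsP[i aij] jmax] := @pick_last (fun j => [exists i, a (i, j) != 0]) x.2.
    by apply/existsP; exists x.1; rewrite -surjective_pairing.
  have inX y : a y != 0 -> sh y.1 = sh y.2.
    by move=> ay; apply/eqP; apply: contraNT ay => ny; rewrite a0 // inE.
  have [d d0 dE] := esum_spolyE j.
  have := zero (sp j); rewrite (eq_bigr (fun y => (if y.2 == j then a y * d else 0) *: sp y.1)).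
    move=> z; suff /(_ i) /eqP : forall k, (a (k, j) * d = 0).
      by rewrite mulf_eq0 (negPf aij) (negPf d0).
    by apply: spoly_free; rewrite -[RHS]z; apply: sum_fiber.
  move=> [k l] /=; rewrite inE /= => /eqP kl.
  have [->|akl] := eqVneq (a (k, l)) 0; first by rewrite mul0r if_same !scale0r.
  have [d' _ d'E] := esum_spolyE l.
  have := esum_smap (sp j) kl; move: (smapP (esym kl)); set s := smap l k => sP ->.
  have [lj|ne] := eqVneq l j.
    rewrite lj in sP *; rewrite dE msymZ scalerA; congr (_ *: _).
    exact: msym_spoly.
  rewrite jmax; first by rewrite msym0 scaler0 scale0r.
    by apply/existsP; exists k.
  exact: ne.
have full : row_full A.
  rewrite /row_full eqn_leq rank_leq_col; move: free; rewrite /row_free => /eqP ->.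
  exact: card_le.
have [C CA] := row_fullP full.
exists (extend0 (C (enum_rank_in one_in 1%g))).
move=> h hG; rewrite (eq_bigl (mem X)) => [|x]; last by rewrite /= inE.
rewrite big_enum_val.
have /matrixP/(_ (enum_rank_in one_in 1%g) (enum_rank_in hG h)) := CA.
rewrite !mxE.
have -> : (enum_rank_in one_in 1%g == enum_rank_in hG h) = (h == 1%g).
  apply/eqP/eqP => [e|h1]; last by apply: enum_val_inj; rewrite !enum_rankK_in // h1.
  by rewrite -(enum_rankK_in hG hG) -e enum_rankK_in.
move=> <-; apply: eq_bigr => x _; rewrite mxE enum_rankK_in //; congr (_ * _).
by rewrite extend0_val.
Qed.

End Family.

(** * Higher Specht polynomials as Specht polynomials *)

Section BlockPerm.
Variables (r : nat) (n : 'I_r -> nat).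
Local Notation N := (nvars n).
Local Notation blk := (@blockof r n).

Lemma prod_block_perm (f : 'I_r -> 'S_N) j : (forall k, perm_on (block n k) (f k)) ->
  (\prod_k f k)%g j = f (blk j) j.
Proof.
move=> fP; have fB k l : blk (f k l) = blk l.
  have [lk|lk] := boolP (l \in block n k).
    have := perm_closed l (fP k); rewrite lk => h.
    by move: h lk; rewrite !in_block_blockof => /eqP -> /eqP ->.
  by rewrite (out_perm (fP k) lk).
have key (s : seq 'I_r) l : uniq s -> (\prod_(k <- s) f k)%g l =
    if blk l \in s then f (blk l) l else l.
  elim: s l => [|k s IH] l /=; first by rewrite big_nil perm1.
  case/andP=> ks us; rewrite big_cons permM IH // fB inE.
  have [->|ne] /= := eqVneq (blk l) k; first by rewrite (negPf ks).
  by rewrite (out_perm (fP k)) // in_block_blockof.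
by rewrite key ?index_enum_uniq // mem_index_enum.
Qed.

(** With the product over blocks as inverse, this identifies [blkg] with the product of the
    symmetric groups of the blocks. *)
Definition restr (t : 'S_N) : {ffun 'I_r -> 'S_N} :=
  [ffun i => restr_perm (block n i) t].

Lemma restr_on t i : perm_on (block n i) (restr t i).
Proof. by rewrite ffunE restr_perm_on. Qed.

Lemma restrE t i j : t \in blkg blk -> j \in block n i -> restr t i j = t j.
Proof.
move=> /fstabP tb ji; rewrite ffunE restr_permE //.
apply/astabsP => k; rewrite /= apermE !in_block_blockof.
by have := tb k => /= ->.
Qed.

Lemma restr_blk t j : t \in blkg blk -> restr t (blk j) j = t j.
Proof. by move=> tb; rewrite restrE // blockof_in. Qed.

Lemma prod_restr t : t \in blkg blk -> (\prod_i restr t i)%g = t.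
Proof.
move=> tb; apply/permP => j; rewrite prod_block_perm; last exact: restr_on.
exact: restr_blk.
Qed.

Lemma prod_blkg (f : 'I_r -> 'S_N) : (forall k, perm_on (block n k) (f k)) ->
  (\prod_k f k)%g \in blkg blk.
Proof.
move=> fP; apply/fstabP => j; rewrite prod_block_perm //.
have := perm_closed j (fP (blk j)); rewrite blockof_in.
by rewrite in_block_blockof => /eqP.
Qed.

Lemma restr_prod (f : {ffun 'I_r -> 'S_N}) : (forall k, perm_on (block n k) (f k)) ->
  restr (\prod_k f k)%g = f.
Proof.
move=> fP; apply/ffunP => i; apply/permP => j.
have [ji|ji] := boolP (j \in block n i).
  rewrite restrE ?prod_blkg // prod_block_perm //.
  by move: ji; rewrite in_block_blockof => /eqP ->.
by rewrite (out_perm (restr_on _ _) ji) (out_perm (fP i) ji).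
Qed.

Lemma odd_prod (F : pzRingType) (f : 'I_r -> 'S_N) :
  (-1) ^+ odd_perm (\prod_k f k)%g = \prod_k (-1) ^+ odd_perm (f k) :> F.
Proof.
apply: (big_morph (fun s : 'S_N => (-1) ^+ odd_perm s)) => [s t|].
  by rewrite odd_permM signr_addb.
by rewrite odd_perm1.
Qed.

End BlockPerm.

Section TableauOf.
Variables (r : nat) (n : 'I_r -> nat).
Local Notation N := (nvars n).
Local Notation blk := (@blockof r n).
Implicit Types (lam : diagram n).

Definition rowlen lam (i : 'I_r) (a : nat) : nat := pcont (lam i) a.

Lemma rowlen_inj lam mu : rowlen lam =2 rowlen mu -> lam = mu.
Proof.
move=> e; apply/ffunP => i; apply: pcont_inj; apply/funext => a; exact: e.
Qed.

Section OneTableau.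
Variables (lam : diagram n) (T : {dffun forall i : 'I_r, filling (lam i)}).

Definition boxat (j : 'I_N) : option {i : 'I_r & box (lam i)} :=
  [pick x : {i : 'I_r & box (lam i)} | T (tag x) (tagged x) == j].

Definition tabof : tableau N := Tableau
  (fun j => if boxat j is Some x then brow (tagged x) else 0%N)
  (fun j => if boxat j is Some x then bcol (tagged x) else 0%N).

Hypothesis Tb : forall i, fill_bij (T i).

Lemma blk_fill i (b : box (lam i)) : blk (T i b) = i.
Proof. by apply/eqP; rewrite -in_block_blockof; case: (Tb i). Qed.

Lemma boxatE i (b : box (lam i)) : boxat (T i b) = Some (Tagged (fun i => box (lam i)) b).
Proof.
rewrite /boxat; case: pickP => [[k c] /= /eqP e|/(_ (Tagged (fun i => box (lam i)) b))].
  have ki : k = i by rewrite -(blk_fill b) -(blk_fill c) e.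
  by subst k; have -> : c = b by apply: (proj1 (Tb i)).
by rewrite /= eqxx.
Qed.

Lemma trow_fill i (b : box (lam i)) : trow tabof (T i b) = brow b.
Proof. by rewrite /trow /tcol /= boxatE. Qed.

Lemma tcol_fill i (b : box (lam i)) : tcol tabof (T i b) = bcol b.
Proof. by rewrite /trow /tcol /= boxatE. Qed.

Lemma fillP j : exists b : box (lam (blk j)), T _ b = j.
Proof. by apply: fill_surj (Tb _) _ _; apply: blockof_in. Qed.

Lemma fillP_blk i j : j \in block n i -> exists b : box (lam i), T _ b = j.
Proof. by apply: fill_surj (Tb _) _. Qed.

Lemma tabof_tab : tab_of blk (rowlen lam) tabof.
Proof.
split=> [i a b|j k|j|i a c].
- exact: pcont_le.
- have [b <-] := fillP j; have [c <-] := fillP k.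
  rewrite !trow_fill !tcol_fill !blk_fill; move: (blk j) (blk k) b c => i i' b c e.
  by subst i' => r' c'; rewrite (box_eq r' c').
- by have [b <-] := fillP j; rewrite trow_fill tcol_fill blk_fill /rowlen box_lt.
- by case/mkbox=> b [b1 b2]; exists (T i b); rewrite blk_fill trow_fill tcol_fill.
Qed.

Lemma std_tabof : (forall i, is_standard (T i)) -> standard blk tabof.
Proof.
move=> Ts; split=> j k; have [b <-] := fillP j; have [c <-] := fillP k;
  rewrite !trow_fill !tcol_fill !blk_fill; move: (blk j) (blk k) b c => i i' b c e;
  subst i' => e lt;
  have /and4P[_ _ /forallP/(_ b)/forallP/(_ c) h1
    /forallP/(_ b)/forallP/(_ c) h2] := Ts i.
  by move: h1; rewrite e eqxx lt.
by move: h2; rewrite e eqxx lt.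
Qed.

Lemma col_stabE i (s : 'S_N) : (s \in col_stab (T i)) = perm_on (block n i) s &&
  [forall j in block n i, tcol tabof (s j) == tcol tabof j].
Proof.
rewrite inE; case sP: (perm_on _ _) => //=; apply/forallP/forall_inP => h.
  move=> j /fillP_blk[b <-]; have /existsP[c /andP[/eqP e /eqP ->]] := h b.
  by rewrite !tcol_fill e.
move=> b; have bi : T i b \in block n i by case: (Tb i).
have /fillP_blk[c cE] : s (T i b) \in block n i by rewrite perm_closed.
apply/existsP; exists c; rewrite cE eqxx andbT.
by have /eqP := h _ bi; rewrite -cE !tcol_fill => ->.
Qed.

Lemma row_stabE i (s : 'S_N) : (s \in row_stab (T i)) = perm_on (block n i) s &&
  [forall j in block n i, trow tabof (s j) == trow tabof j].
Proof.
rewrite inE; case sP: (perm_on _ _) => //=; apply/forallP/forall_inP => h.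
  move=> j /fillP_blk[b <-]; have /existsP[c /andP[/eqP e /eqP ->]] := h b.
  by rewrite !trow_fill e.
move=> b; have bi : T i b \in block n i by case: (Tb i).
have /fillP_blk[c cE] : s (T i b) \in block n i by rewrite perm_closed.
apply/existsP; exists c; rewrite cE eqxx andbT.
by have /eqP := h _ bi; rewrite -cE !trow_fill => ->.
Qed.

Lemma colg_restr (t : 'S_N) : (t \in colg blk tabof) =
  (restr t \in family (fun i => mem (col_stab (T i)))) && ((\prod_i restr t i)%g == t).
Proof.
apply/idP/andP => [tC|[/familyP tf /eqP tE]].
  have tb := colg_blk tC; split; last by rewrite prod_restr.
  apply/familyP => i; rewrite /= col_stabE restr_on /=; apply/forall_inP => j ji.
  rewrite restrE //; apply/eqP; by have /colgP/(_ j)[_ ->] := tC.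
have tb : t \in blkg blk by rewrite -tE prod_blkg //; apply: restr_on.
apply/colgP => j; split; first by have /fstabP -> := tb.
have := tf (blk j); rewrite /= col_stabE => /andP[_ /forall_inP/(_ j (blockof_in j)) /eqP].
by rewrite restr_blk.
Qed.

Section Poly.
Variable F : numFieldType.
Local Notation OX := {mpoly F[N]}.

Lemma msymXi (s : 'S_N) j : msym s 'X_j = 'X_(s j) :> OX.
Proof.
rewrite msymX; congr 'X_[_]; apply/mnmP => k; rewrite mnmE !mnmE.
by congr nat_of_bool; apply/eqP/eqP => [->|<-]; rewrite ?permKV ?permK.
Qed.

Lemma msym_prod (s : 'S_N) (J : Type) (l : seq J) (P : pred J) (f : J -> OX) :
  msym s (\prod_(i <- l | P i) f i) = \prod_(i <- l | P i) msym s (f i).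
Proof. exact: rmorph_prod. Qed.

Definition bmono i : OX := \prod_(j in block n i) 'X_j ^+ trow tabof j.

Lemma msym_bmono (s : 'S_N) i :
  msym s (bmono i) = \prod_(j in block n i) 'X_(s j) ^+ trow tabof j.
Proof.
by rewrite /bmono msym_prod; apply: eq_bigr => j _; rewrite rmorphXn /= msymXi.
Qed.

Lemma specht_monoE i :
  \prod_(b : box (lam i)) 'X_(T i b) ^+ index_tab (canon_filling (lam i)) b = bmono i.
Proof.
have [inj Ti] := Tb i.
have e : block n i = [set T i b | b : box (lam i)].
  apply/setP => j; apply/idP/imsetP => [/fillP_blk[b <-]|[b _ ->]]; last exact: Ti.
  by exists b.
rewrite /bmono e big_imset /=; last by move=> b c _ _; apply: inj.
by apply: eq_big => // b _; rewrite trow_fill index_tab_canon.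
Qed.

(** Row permutations fix a monomial whose exponents are row numbers, so the row sum is
    multiplication by the order of the row stabilizer. *)
Lemma block_spechtE i : block_specht F (canon_filling (lam i)) (T i) =
  ((num_std (lam i))%:R / (n i)`!%:R * #|row_stab (T i)|%:R : F) *:
  \sum_(t in col_stab (T i)) (-1) ^+ odd_perm t *: msym t (bmono i).
Proof.
rewrite /block_specht specht_monoE /young -[RHS]scalerA; congr (_ *: _).
rewrite scaler_nat -sumr_const; apply: eq_bigr => s; rewrite row_stabE.
case/andP=> sB /forall_inP sR; apply: eq_bigr => t _; congr (_ *: msym t _).
rewrite msym_bmono /bmono [RHS](reindex_inj (@perm_inj _ s)) /=.
by apply: eq_big => [j|j /sR /eqP ->]; rewrite ?perm_closed.
Qed.

Lemma mono_bmono : 'X_[mono tabof] = \prod_i bmono i :> OX.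
Proof.
rewrite mpolyXE_id (partition_big (fun j => blk j) xpredT) //=; apply: eq_bigr => i _.
apply: eq_big => [j|j _]; first by rewrite in_block_blockof.
by rewrite mnmE.
Qed.

Definition spconst : F :=
  \prod_i ((num_std (lam i))%:R / (n i)`!%:R * #|row_stab (T i)|%:R).

(** The product over blocks of the column sums expands into a sum over families of column
    permutations, which [restr] identifies with [colg]. *)
Lemma spechtE : specht F T = spconst *: spoly F blk tabof.
Proof.
rewrite /specht; under eq_bigr => i _ do rewrite block_spechtE.
rewrite scaler_prod; congr (_ *: _).
rewrite (bigA_distr_big_dep (fun i => mem (col_stab (T i)))) /spoly /csum /=.
rewrite (reindex_onto (@restr r n) (fun f => \prod_i f i)%g) /=; last first.
  move=> f /familyP fP; apply: restr_prod => k.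
  by have := fP k; rewrite /= col_stabE => /andP[].
apply: eq_big => [t|t]; first by rewrite colg_restr.
rewrite -colg_restr => tC; have tb := colg_blk tC.
rewrite scaler_prod -odd_prod prod_restr // mono_bmono msym_prod; congr (_ *: _).
apply: eq_bigr => i _; rewrite !msym_bmono; apply: eq_bigr => j ji.
by rewrite restrE.
Qed.

Lemma spconst_neq0 : (forall i, 0 < num_std (lam i))%N -> spconst != 0.
Proof.
move=> h; apply/prodf_neq0 => i _; rewrite !mulf_neq0 ?invr_eq0 ?pnatr_eq0 -?lt0n //.
  by rewrite fact_gt0.
apply/card_gt0P; exists 1%g; rewrite row_stabE perm_on1 /=.
by apply/forall_inP => j _; rewrite perm1.
Qed.

End Poly.
End OneTableau.
End TableauOf.

(** * The family of standard multitableaux *)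

Local Open Scope nat_scope.

(** Rows increase, so the column of [j] counts the smaller entries of its row. A standard tableau is
    thus determined by its row function. *)
Lemma std_tcol N (B : eqType) (blk : 'I_N -> B) lam T (j : 'I_N) :
  tab_of blk lam T -> standard blk T ->
  tcol T j = #|[set k : 'I_N | [&& blk k == blk j, trow T k == trow T j & k < j]]|.
Proof.
move=> [dec inj lt sur] [sr _].
have lts k : blk k = blk j -> trow T k = trow T j -> k < j -> tcol T k < tcol T j.
  move=> b r kj; case: (ltngtP (tcol T k) (tcol T j)) => // [h|h].
    by have := sr j k (esym b) (esym r) h; rewrite ltnNge ltnW.
  by rewrite (inj k j b r h) ltnn in kj.
apply/eqP; rewrite eqn_leq; apply/andP; split.
  apply: (@card_above _ _ (tcol T)) => c cj.
  have [k [b r cE]] := sur _ _ _ (ltn_trans cj (lt j)).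
  by exists k => //; rewrite inE b r !eqxx /= sr // cE.
apply: (@card_below _ _ (tcol T)) => [k l|k]; rewrite !inE.
  move=> /and3P[/eqP b1 /eqP r1 _] /and3P[/eqP b2 /eqP r2 _] c.
  by apply: inj; rewrite ?b1 ?r1.
by move=> /and3P[/eqP b1 /eqP r1 kj]; apply: lts.
Qed.

Section StdFamily.
Variables (r : nat) (n : 'I_r -> nat).
Local Notation N := (nvars n).
Local Notation blk := (@blockof r n).

Definition stdtab : finType := {lam : diagram n & NST lam}.
Implicit Types x : stdtab.

Definition tabshape x : diagram n := tag x.
Definition tableau_of x : tableau N := tabof (sval (tagged x)).

Lemma NST_std (lam : diagram n) (T : NST lam) i : is_standard (sval T i).
Proof. by case: T => T /= /forallP. Qed.

Lemma NST_bij (lam : diagram n) (T : NST lam) i : fill_bij (sval T i).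
Proof. exact: std_bij (NST_std T i). Qed.

Lemma tableau_ofP x : tab_of blk (rowlen (tabshape x)) (tableau_of x).
Proof. by apply: tabof_tab; apply: NST_bij. Qed.

Lemma tableau_of_std x : standard blk (tableau_of x).
Proof. by apply: std_tabof => i; [apply: NST_bij|apply: NST_std]. Qed.

Lemma tableau_of_inj x x' : tabshape x = tabshape x' ->
  trow (tableau_of x) =1 trow (tableau_of x') -> x = x'.
Proof.
case: x => lam T; case: x' => mu T' e; rewrite /tabshape /= in e; subst mu => rr.
congr (Tagged _ _); apply/val_inj/ffunP => i; apply/ffunP => b.
set j := sval T i b; have bj : blk j = i by apply: (blk_fill (NST_bij T)).
have [b' b'E] : exists b' : box (lam i), sval T' i b' = j.
  by apply: (fillP_blk (NST_bij T')); rewrite -bj blockof_in.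
suff -> : b = b' by [].
apply: box_eq.
  by rewrite -(trow_fill (NST_bij T)) -(trow_fill (NST_bij T')) b'E; apply: (rr j).
rewrite -(tcol_fill (NST_bij T)) -(tcol_fill (NST_bij T')) b'E -/j.
have h1 := std_tcol j (tableau_ofP (existT _ lam T : stdtab))
  (tableau_of_std (existT _ lam T : stdtab)).
have h2 := std_tcol j (tableau_ofP (existT _ lam T' : stdtab))
  (tableau_of_std (existT _ lam T' : stdtab)).
move: h1 h2; rewrite /tableau_of /= => -> ->.
by apply: eq_card => k; rewrite !inE; have := rr k; have := rr j; rewrite /tableau_of /= => -> ->.
Qed.

Definition stdpair i : finType :=
  {p : part (n i) & {T : filling p | is_standard T} * {T : filling p | is_standard T} : finType}.

Lemma card_stdpair i : (n i)`! <= #|stdpair i|.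
Proof.
apply: leq_trans (factorial_num_std n i) _.
rewrite card_tagged sumnE big_map big_enum /=; apply: leq_sum => p _.
by rewrite card_prod card_sig -mulnn /num_std cardsE.
Qed.

Lemma card_blkg : #|blkg blk| <= \prod_i (n i)`!.
Proof.
have inj : {in blkg blk &, injective (@restr r n)}.
  by move=> s t sB tB e; rewrite -(prod_restr sB) -(prod_restr tB) e.
rewrite -(card_in_imset inj).
apply: leq_trans (_ : #|family (fun i : 'I_r => [set s : 'S_N | perm_on (block n i) s])| <= _).
  apply: subset_leq_card; apply/subsetP => _ /imsetP[t _ ->].
  by apply/familyP => i; rewrite inE restr_on.
rewrite card_family foldrE big_map big_enum /=; apply: leq_prod => i _.
rewrite (_ : #|_| = #|perm_on (block n i)|); last by apply: eq_card => s; rewrite inE.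
by rewrite card_perm card_block.
Qed.

Lemma std_cast i (p q : part (n i)) (e : p = q) (T : {T : filling p | is_standard T}) :
  is_standard (ecast q (filling q) e (sval T)).
Proof. by case: q / e; case: T. Qed.

(** Two standard fillings of a common shape chosen in each block assemble into two standard
    multitableaux of a common shape. *)
Lemma card_fprod_le :
  #|fprod stdpair| <= #|[set y : stdtab * stdtab | tabshape y.1 == tabshape y.2]|.
Proof.
(* Codes keep the fillings and forget the proofs of standardness, so that tableaux transported along
   an equality of shapes can be compared. *)
pose fill2 i (p : part (n i)) : Type := (filling p * filling p)%type.
pose code i (u : stdpair i) : {p : part (n i) & fill2 i p} :=
  Tagged (fill2 i) (sval (tagged u).1, sval (tagged u).2).
have code_inj i : injective (code i).
  move=> [p [S T]] [q [S' T']] e; have pq : p = q := congr1 tag e.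
  subst q; have /= [e1 e2] := eq_from_Tagged e.
  by rewrite (val_inj e1 : S = S') (val_inj e2 : T = T').
pose A := {lam : diagram n & (NST lam * NST lam)%type : finType}.
pose rd i (z : A) : {p : part (n i) & fill2 i p} :=
  Tagged (fill2 i) (sval (tagged z).1 i, sval (tagged z).2 i).
have ex (t : fprod stdpair) : exists z : A, forall i, rd i z = code i (t i).
  pose lam : diagram n := [ffun i => tag (t i)].
  have lamE i : tag (t i) = lam i by rewrite ffunE.
  pose S : {dffun forall i : 'I_r, filling (lam i)} :=
    [ffun i => ecast q (filling q) (lamE i) (sval (tagged (t i)).1)].
  pose T : {dffun forall i : 'I_r, filling (lam i)} :=
    [ffun i => ecast q (filling q) (lamE i) (sval (tagged (t i)).2)].
  have SE i : S i = ecast q (filling q) (lamE i) (sval (tagged (t i)).1).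
    exact: ffunE.
  have TE i : T i = ecast q (filling q) (lamE i) (sval (tagged (t i)).2).
    exact: ffunE.
  have SP : [forall i, is_standard (S i)].
    by apply/forallP => i; rewrite SE std_cast.
  have TP : [forall i, is_standard (T i)].
    by apply/forallP => i; rewrite TE std_cast.
  exists (existT _ lam (exist _ S SP : NST lam, exist _ T TP : NST lam) : A) => i.
  rewrite /rd /code /= SE TE.
  by case: (lam i) / (lamE i).
have [f fP] := @choice _ _ _ ex.
have finj : injective f.
  move=> t t' e; apply/fprodP => i; apply: code_inj.
  by rewrite -!fP e.
rewrite -(card_imset _ finj).
pose g (z : A) : stdtab * stdtab := (existT _ (tag z) (tagged z).1, existT _ (tag z) (tagged z).2).
have ginj : injective g.
  move=> [l [S T]] [l' [S' T']] e; have ll : l = l' := congr1 (fun y => tag y.1) e.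
  subst l'.
  have e1 : Tagged (fun l => NST l : Type) S = Tagged (fun l => NST l : Type) S' := congr1 fst e.
  have e2 : Tagged (fun l => NST l : Type) T = Tagged (fun l => NST l : Type) T' := congr1 snd e.
  by rewrite (eq_from_Tagged e1) (eq_from_Tagged e2).
rewrite -(card_imset _ ginj); apply: subset_leq_card; apply/subsetP.
by move=> _ /imsetP[z _ ->]; rewrite inE.
Qed.

Lemma card_blkg_stdtab :
  #|blkg blk| <= #|[set y : stdtab * stdtab | tabshape y.1 == tabshape y.2]|.
Proof.
apply: leq_trans card_blkg (leq_trans _ card_fprod_le).
by rewrite card_fprod; apply: leq_prod => i _; apply: card_stdpair.
Qed.

End StdFamily.

(** * The group action on the localization *)

Local Open Scope ring_scope.

Section OUring.
Variables (F : numFieldType) (r : nat) (n : 'I_r -> nat).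
Local Notation N := (nvars n).
Local Notation OX := {mpoly F[N]}.
Local Notation OU := (OU F n).
Local Notation Delta := (Delta F n).
Local Notation blk := (@blockof r n).
Local Notation G := (blkg blk).

Fact polyU_additive : additive (@polyU F r n).
Proof. by move=> f g; apply: val_inj; rewrite /= tofracB. Qed.
HB.instance Definition _ := GRing.isAdditive.Build OX OU (@polyU F r n) polyU_additive.

Fact polyU_multiplicative : multiplicative (@polyU F r n).
Proof.
split=> [f g|]; apply: val_inj; first by rewrite /= tofracM.
by rewrite /= tofrac1.
Qed.
HB.instance Definition _ := GRing.isMultiplicative.Build OX OU (@polyU F r n) polyU_multiplicative.

Lemma polyU_inj : injective (@polyU F r n).
Proof.
move=> f g /(congr1 val) /= e; apply/eqP; rewrite -subr_eq0 -tofrac_eq0 tofracB.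
by rewrite e subrr.
Qed.

Lemma OU_mul_eq0 (u v : OU) : u * v = 0 -> u != 0 -> v = 0.
Proof.
move=> /(congr1 val) /= /eqP; rewrite mulf_eq0 => /orP[/eqP e /eqP ne|/eqP e _].
  by case: ne; apply: val_inj.
exact: val_inj.
Qed.

Lemma polyU_Delta : polyU Delta * invDelta F n = 1.
Proof. by apply: val_inj; rewrite /= mulfV ?DeltaF_neq0. Qed.

Definition invD2 : OU := invDelta F n ^+ 2.

Lemma polyU_D2 k : polyU (Delta ^+ 2) ^+ k * invD2 ^+ k = 1.
Proof. by rewrite -exprMn rmorphXn -exprMn polyU_Delta !expr1n. Qed.

Lemma OU_repr (u : OU) : exists f k, u = polyU f * invD2 ^+ k.
Proof.
case: u => u uP; have [f [k uE]] := asboolW uP.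
exists (f * Delta ^+ k), k.
rewrite rmorphM /= rmorphXn /invD2 -exprM mul2n -addnn exprD mulrA.
rewrite -(mulrA (polyU f)) -exprMn polyU_Delta expr1n mulr1; apply: val_inj => /=.
rewrite uE; congr (_ * _); elim: k {uE} => [|k IH]; first by rewrite !expr0 invr1.
by rewrite !exprS invfM IH.
Qed.

(** Up to sign, [Delta ^+ 2] is the product of the differences over all ordered pairs of distinct
    indices in a common block, and G permutes these pairs. *)
Lemma Delta_sqr_sym (s : 'S_N) : s \in G -> msym s (Delta ^+ 2) = Delta ^+ 2.
Proof.
move=> sG; have sB k : blk (s k) = blk k by apply/fstabP.
pose D : OX := \prod_k \prod_(l | (blk l == blk k) && (l != k)) ('X_k - 'X_l).
have Ds : msym s D = D.
  rewrite /D msym_prod [RHS](reindex_inj (@perm_inj _ s)) /=; apply: eq_bigr => k _.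
  rewrite msym_prod [RHS](reindex_inj (@perm_inj _ s)) /=.
  apply: eq_big => [l|l _]; first by rewrite !sB (inj_eq perm_inj).
  by rewrite msymB !msymXi.
have DeltaE : Delta = \prod_k \prod_(l | (blk l == blk k) && (k < l)%N) ('X_k - 'X_l).
  rewrite /Defs.Delta [RHS](partition_big blk xpredT) //=; apply: eq_bigr => i _.
  rewrite /block_Delta; apply: eq_big => [k|k ki]; first by rewrite in_block_blockof.
  rewrite in_block_blockof in ki; rewrite (eqP ki).
  by apply: eq_bigl => l; rewrite in_block_blockof.
have [c c1 cE] : exists2 c : OX, c * c = 1 & D = c * Delta ^+ 2 /\ msym s c = c.
  exists (\prod_k \prod_(l | (blk l == blk k) && (k < l)%N) -1).
    rewrite -big_split big1 //= => k _; rewrite -big_split big1 //= => l _.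
    by rewrite mulrNN mulr1.
  split; last first.
    rewrite msym_prod; apply: eq_bigr => k _; rewrite msym_prod.
    by apply: eq_bigr => l _; rewrite msymN msym1.
  rewrite expr2 mulrA {2}DeltaE.
  have -> : \prod_k \prod_(l | (blk l == blk k) && (k < l)%N) (-1) * Delta =
     \prod_k \prod_(l | (blk l == blk k) && (k < l)%N) ('X_l - 'X_k).
    rewrite DeltaE -big_split; apply: eq_bigr => k _; rewrite -big_split.
    by apply: eq_bigr => l _; rewrite /= mulN1r opprB.
  rewrite (exchange_big_dep xpredT) //= -big_split; apply: eq_bigr => k _.
  rewrite (bigID (fun l : 'I_N => (l < k)%N)) /=; congr (_ * _).
    apply: eq_bigl => l; rewrite [blk k == _]eq_sym; case: eqP => //= _.
    by rewrite -val_eqE /= neq_ltn; case: ltnP => // _; rewrite ?andbT ?andbF.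
  apply: eq_bigl => l; case: eqP => //= _; rewrite -leqNgt -val_eqE /= eq_sym.
  by rewrite ltn_neqAle.
case: cE => cE cs.
have : msym s D = c * Delta ^+ 2 by rewrite Ds cE.
rewrite cE msymM cs => /(congr1 (fun x => c * x)).
by rewrite !mulrA c1 !mul1r.
Qed.

Lemma OU_repr_sig (u : OU) : {fk : OX * nat | u = polyU fk.1 * invD2 ^+ fk.2}.
Proof. by apply: cid; have [f [k uE]] := OU_repr u; exists (f, k). Qed.

(** The denominator is a power of the invariant [Delta ^+ 2], as [Delta] is only invariant up to
    sign. For [s] in G, [actUE] shows that the chosen fraction does not matter. *)
Definition actU (s : 'S_N) (u : OU) : OU :=
  let: exist fk _ := OU_repr_sig u in polyU (msym s fk.1) * invD2 ^+ fk.2.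

Lemma OU_cross (f g : OX) k l : (polyU f * invD2 ^+ k = polyU g * invD2 ^+ l) <->
  (f * Delta ^+ 2 ^+ l = g * Delta ^+ 2 ^+ k).
Proof.
have e (h : OX) a b : polyU h * invD2 ^+ a = polyU (h * Delta ^+ 2 ^+ b) * invD2 ^+ (a + b).
  rewrite rmorphM rmorphXn exprD /= -!mulrA; congr (_ * _).
  by rewrite mulrCA polyU_D2 mulr1.
split=> [h|h]; last by rewrite (e f k l) (e g l k) h addnC.
apply: polyU_inj; move: h; rewrite (e f k l) (e g l k) addnC.
move/(congr1 (fun u => u * polyU (Delta ^+ 2) ^+ (l + k))).
by rewrite -!mulrA ![invD2 ^+ _ * _]mulrC polyU_D2 !mulr1.
Qed.

Lemma actUE s f k : s \in G -> actU s (polyU f * invD2 ^+ k) = polyU (msym s f) * invD2 ^+ k.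
Proof.
move=> sG; rewrite /actU; case: OU_repr_sig => [[g l] /= /esym/OU_cross e].
apply/OU_cross; move/(congr1 (msym s)): e.
have D2k j : msym s (Delta ^+ 2 ^+ j) = Delta ^+ 2 ^+ j.
  by rewrite rmorphXn /= Delta_sqr_sym.
by rewrite !msymM !D2k.
Qed.

Lemma actU_poly s f : s \in G -> actU s (polyU f) = polyU (msym s f).
Proof. by move=> sG; have := actUE f 0 sG; rewrite !expr0 !mulr1. Qed.

Lemma OU_repr2 (u v : OU) : exists f g k, u = polyU f * invD2 ^+ k /\ v = polyU g * invD2 ^+ k.
Proof.
have [f [k ->]] := OU_repr u; have [g [l ->]] := OU_repr v.
exists (f * Delta ^+ 2 ^+ l), (g * Delta ^+ 2 ^+ k), (k + l)%N.
split; apply/OU_cross; rewrite exprD -!mulrA //.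
by congr (_ * _); rewrite mulrC.
Qed.

Lemma actUD s : s \in G -> {morph actU s : u v / u + v}.
Proof.
move=> sG u v; have [f [g [k [-> ->]]]] := OU_repr2 u v.
by rewrite -mulrDl -rmorphD !actUE // msymD rmorphD mulrDl.
Qed.

Lemma actUM s : s \in G -> {morph actU s : u v / u * v}.
Proof.
move=> sG u v; have [f [g [k [-> ->]]]] := OU_repr2 u v.
by rewrite mulrACA -rmorphM -exprD !actUE // msymM rmorphM exprD mulrACA.
Qed.

Lemma actU0 s : s \in G -> actU s 0 = 0.
Proof. by move=> sG; rewrite -(rmorph0 (@polyU F r n)) actU_poly // msym0. Qed.

Lemma actU_const s (c : F) : s \in G -> actU s (polyU c%:MP) = polyU c%:MP.
Proof. by move=> sG; rewrite actU_poly // -[c%:MP]mulr1 mul_mpolyC msymZ msym1. Qed.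

Lemma actU_sum s (J : Type) (l : seq J) (P : pred J) (f : J -> OU) : s \in G ->
  actU s (\sum_(i <- l | P i) f i) = \sum_(i <- l | P i) actU s (f i).
Proof. by move=> sG; apply: (big_morph _ (actUD sG) (actU0 sG)). Qed.

Lemma actU1 u : actU 1%g u = u.
Proof. by have [f [k ->]] := OU_repr u; rewrite actUE ?group1 // msym1m. Qed.

Lemma actU_mul s t u : s \in G -> t \in G -> actU (s * t)%g u = actU t (actU s u).
Proof.
move=> sG tG; have [f [k ->]] := OU_repr u.
rewrite (actUE f k (groupM sG tG)) (actUE f k sG) (actUE (msym s f) k tG).
by rewrite (msymMm f s t).
Qed.

Lemma actUK s : s \in G -> cancel (actU s) (actU s^-1%g).
Proof. by move=> sG u; rewrite -actU_mul ?groupV // mulgV actU1. Qed.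

Lemma actUKV s : s \in G -> cancel (actU s^-1%g) (actU s).
Proof. by move=> sG u; rewrite -actU_mul ?groupV // mulVg actU1. Qed.

End OUring.

(** * Invariants and derivations *)

Lemma horner_deriv (R : comNzRingType) (p : {poly R}) x :
  p^`().[x] = \sum_(j < size p) p`_j * (x ^+ j.-1 *+ j).
Proof.
rewrite /deriv horner_poly; case: (size p) => [|k]; first by rewrite !big_ord0.
rewrite [RHS]big_ord_recl /= mulr0n mulr0 add0r; apply: eq_bigr => j _.
by rewrite mulrnAl mulrnAr.
Qed.

Section BlockPoly.
Variables (F : numFieldType) (r : nat) (n : 'I_r -> nat).
Local Notation N := (nvars n).
Local Notation OX := {mpoly F[N]}.
Local Notation OU := (OU F n).
Local Notation blk := (@blockof r n).
Local Notation G := (blkg blk).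

(** A boolean form of [in_block], to which a subring structure can be attached. *)
Definition inblock (i : 'I_r) : {pred OX} :=
  fun f => all (fun m : 'X_{1..N} => [forall j, (j \in block n i) || (m j == 0%N)]) (msupp f).

Lemma inblockP i (f : OX) : reflect (in_block i f) (f \in inblock i).
Proof.
apply: (iffP allP) => [h m /h /forallP hm j ji|h m /h hm].
  by have := hm j; rewrite (negPf ji) => /eqP.
by apply/forallP => j; case: (boolP (j \in _)) => //= /hm ->.
Qed.

Fact inblock_subring i : subring_closed (inblock i).
Proof.
split=> [|f g /inblockP hf /inblockP hg|f g /inblockP hf /inblockP hg]; apply/inblockP.
- move=> m; rewrite msupp1 inE => /eqP -> j _; exact: mnm0E.
- by move=> m /msuppB_le; rewrite mem_cat => /orP[/hf|/hg].
- move=> m /msuppM_le /allpairsP[[m1 m2] /= [/hf h1 /hg h2 ->]] j ji.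
  by rewrite mnmDE h1 // h2.
Qed.
HB.instance Definition _ i := GRing.isSubringClosed.Build OX (inblock i) (inblock_subring i).

Lemma inblockX i j : j \in block n i -> 'X_j \in inblock i.
Proof.
move=> ji; apply/inblockP => m; rewrite msuppX inE => /eqP -> k ki.
rewrite mnm1E; case: eqP => // e; by rewrite -e ji in ki.
Qed.

Lemma msym_inblock i (s t : 'S_N) (f : OX) : f \in inblock i ->
  (forall j, j \in block n i -> s j = t j) -> msym s f = msym t f.
Proof.
move=> /inblockP fi st; rewrite [f]mpolyE !msym_sum big_seq [RHS]big_seq.
apply: eq_bigr => m /fi mi; rewrite !msymZ; congr (_ *: _).
rewrite mpolyXE_id !msym_prod; apply: eq_bigr => j _; rewrite !rmorphXn /= !msymXi.
by have [/st -> //|/mi ->] := boolP (j \in block n i).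
Qed.

Lemma block_sym_blkg i (f : OX) s : f \in inblock i -> block_sym i f -> s \in G ->
  msym s f = f.
Proof.
move=> fi fs sG; rewrite -[RHS](fs (restr s i)) ?restr_on //.
by apply: msym_inblock fi _ => j ji; rewrite restrE.
Qed.

Variable y : N.-tuple OX.
Hypothesis hy : block_generators y.

Lemma y_sym j s : s \in G -> msym s (tnth y j) = tnth y j.
Proof.
have [h _ _] := hy (blk j); have [/inblockP yi ys] := h j (blockof_in j).
exact: block_sym_blkg yi ys.
Qed.

Section Generation.
Variable P : OX -> Prop.
Hypotheses (PC : forall c, P c%:MP) (PD : forall f g, P f -> P g -> P (f + g)).
Hypotheses (PM : forall f g, P f -> P g -> P (f * g)) (PY : forall j, P (tnth y j)).

Lemma gen_sum (J : Type) (l : seq J) (Q : pred J) (f : J -> OX) :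
  (forall i, Q i -> P (f i)) -> P (\sum_(i <- l | Q i) f i).
Proof. by move=> h; apply: (big_ind P) => //; rewrite -mpolyC0; apply: PC. Qed.

Lemma gen_prod (J : Type) (l : seq J) (Q : pred J) (f : J -> OX) :
  (forall i, Q i -> P (f i)) -> P (\prod_(i <- l | Q i) f i).
Proof. by move=> h; apply: (big_ind P) => //; rewrite -mpolyC1; apply: PC. Qed.

Lemma gen_comp p : P (p \mPo y).
Proof.
rewrite comp_mpolyEX; apply: gen_sum => m _; rewrite -mul_mpolyC; apply: PM => //.
rewrite comp_mpolyX; apply: gen_prod => j _.
by elim: (m j) => [|k IH]; [rewrite expr0 -mpolyC1|rewrite exprS; apply: PM].
Qed.

(** An induction principle for block-symmetric polynomials, used in [der_eq0] with [P f] saying that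
    a derivation kills [f]. *)
Lemma gen_block i f : f \in inblock i -> block_sym i f -> P f.
Proof.
move=> /inblockP fi fs; have [_ h _] := hy i; have [p _ ->] := h f fi fs.
exact: gen_comp.
Qed.

(* The sum over the group of a monomial factors into block symmetrizations.   *)
Lemma gen_invariant f : (forall s, s \in G -> msym s f = f) -> P f.
Proof.
move=> fG.
suff: P (\sum_(s in G) msym s f).
  rewrite (eq_bigr (fun=> f)) => [|s /fG //]; rewrite sumr_const -scaler_nat => h.
  rewrite -[f](@scalerK F _ #|G|%:R) ?pnatr_eq0 -?lt0n ?cardG_gt0 //.
  by rewrite -mul_mpolyC; apply: PM.
have -> : \sum_(s in G) msym s f =
    \sum_(m <- msupp f) f@_m *: \sum_(s in G) msym s 'X_[m].
  rewrite (eq_bigr (fun s => \sum_(m <- msupp f) f@_m *: msym s 'X_[m])) => [|s _].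
    by rewrite exchange_big; apply: eq_bigr => m _; rewrite scaler_sumr.
  by rewrite {1}[f]mpolyE msym_sum; apply: eq_bigr => m _; rewrite msymZ.
apply: gen_sum => m _; rewrite -mul_mpolyC; apply: PM => //.
pose b i : OX := \prod_(j in block n i) 'X_j ^+ m j.
have bi i : b i \in inblock i.
  by apply: rpred_prod => j ji; apply: rpredX; apply: inblockX.
have mE : 'X_[m] = \prod_i b i.
  rewrite mpolyXE_id (partition_big blk xpredT) //=; apply: eq_bigr => i _.
  by apply: eq_bigl => j; rewrite in_block_blockof.
suff -> : \sum_(s in G) msym s 'X_[m] =
    \prod_i \sum_(s : 'S_N | perm_on (block n i) s) msym s (b i).
  apply: gen_prod => i _; apply: (@gen_block i).
    apply: rpred_sum => s sB; rewrite msym_prod; apply: rpred_prod => j ji.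
    rewrite rmorphXn /= msymXi; apply: rpredX; apply: inblockX.
    by rewrite perm_closed.
  move=> t tB; rewrite msym_sum [RHS](reindex_inj (mulIg t)) /=.
  apply: eq_big => [s|s _]; last by rewrite -msymMm.
  have h (u : 'S_N) : perm_on (block n i) u = (u \in Sym (block n i)) by rewrite inE.
  by rewrite !h groupMr // -h.
rewrite (bigA_distr_big_dep (fun i s => perm_on (block n i) s)) /=.
rewrite [RHS](reindex_onto (@restr r n) (fun f => \prod_i f i)%g) /=; last first.
  by move=> g /familyP gP; apply: restr_prod.
apply: eq_big => [s|s sG].
  apply/idP/andP => [sG|[_ /eqP <-]]; last by apply: prod_blkg => k; apply: restr_on.
  by split; [apply/familyP => i; apply: restr_on|rewrite prod_restr].
rewrite mE msym_prod; apply: eq_bigr => i _.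
by apply: msym_inblock (bi i) _ => j ji; rewrite restrE.
Qed.

End Generation.

Section Derivation.
Variable d : OX -> OU.
Hypotheses (dD : forall f g, d (f + g) = d f + d g).
Hypotheses (dM : forall f g, d (f * g) = d f * polyU g + polyU f * d g).
Hypotheses (dC : forall c, d c%:MP = 0) (dY : forall j, d (tnth y j) = 0).

Lemma der_sum (J : Type) (l : seq J) (Q : pred J) (f : J -> OX) :
  d (\sum_(i <- l | Q i) f i) = \sum_(i <- l | Q i) d (f i).
Proof. by apply: (big_morph d dD); rewrite -mpolyC0 dC. Qed.

Lemma der_exp f k : d (f ^+ k) = polyU (f ^+ k.-1 *+ k) * d f.
Proof.
elim: k => [|k IH]; first by rewrite expr0 -mpolyC1 dC mulr0n rmorph0 mul0r.
rewrite exprS dM IH; case: k {IH} => [|k] /=.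
  by rewrite expr0 rmorph1 mulr0n rmorph0 mul0r mulr0 addr0 mulr1 mul1r.
by rewrite mulrA -rmorphM mulrnAr -exprS [d f * _]mulrC -mulrDl -rmorphD -mulrS.
Qed.

(* An element is killed by a derivation killing the coefficients of a         *)
(* polynomial of which it is a simple root.                                   *)
Lemma der_eq0 f : d f = 0.
Proof.
have dX k : d 'X_k = 0.
  (* The roots of [P] are the variables of the block of [k], all simple. Its coefficients are
     symmetric, hence killed by [d], and differentiating P(x_k) = 0 leaves P'(x_k) d(x_k) = 0. *)
  set i := blk k; pose P : {poly OX} := \prod_(l in block n i) ('X - ('X_l)%:P).
  pose R : {poly OX} := \prod_(l in block n i | l != k) ('X - ('X_l)%:P).
  have PE : P = ('X - ('X_k)%:P) * R by rewrite /P (bigD1 k) ?blockof_in.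
  have Pk : P.['X_k] = 0 by rewrite PE hornerM hornerXsubC subrr mul0r.
  have P'k : P^`().['X_k] != 0.
    have -> : P^`().['X_k] = R.['X_k].
      by rewrite PE derivM derivXsubC mul1r hornerD hornerM hornerXsubC subrr mul0r addr0.
    rewrite /R horner_prod; apply/prodf_neq0 => l /andP[_ lk].
    rewrite hornerXsubC subr_eq0; apply: contra lk => /eqP e.
    have /eqP := congr1 (mcoeff U_(k)) e; rewrite !mcoeffX eqxx eq_mnm1.
    by case: (eqVneq l k) => // _; rewrite oner_eq0.
  have Pi : P \is a polyOver (inblock i).
    by apply: rpred_prod => l li; rewrite rpredB ?polyOverX // polyOverC inblockX.
  have Psym (s : 'S_N) : perm_on (block n i) s -> map_poly (msym s) P = P.
    move=> sB; rewrite /P rmorph_prod [RHS](reindex_inj (@perm_inj _ s)) /=.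
    apply: eq_big => [l|l _]; first by rewrite perm_closed.
    by rewrite rmorphB /= map_polyX map_polyC /= msymXi.
  have dP j : d P`_j = 0.
    apply: (@gen_block (fun f => d f = 0) _ _ _ _ i) => //.
    - by move=> g h g0 h0; rewrite dD g0 h0 addr0.
    - by move=> g h g0 h0; rewrite dM g0 h0 mulr0 mul0r addr0.
    - by apply: (polyOverP Pi).
    - by move=> s /Psym {2}<-; rewrite coef_map.
  have := congr1 d Pk; rewrite horner_coef der_sum -mpolyC0 dC.
  have -> : \sum_(j < size P) d (P`_j * 'X_k ^+ j) = polyU (P^`().['X_k]) * d 'X_k.
    under eq_bigr => j _ do rewrite dM dP mul0r add0r der_exp mulrA -rmorphM.
    by rewrite -mulr_suml -rmorph_sum -horner_deriv.
  move=> /OU_mul_eq0; apply; apply/eqP => z; case/eqP: P'k.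
  by apply: (@polyU_inj F r n); rewrite z rmorph0.
rewrite [f]mpolyE der_sum big1 // => m _; rewrite -mul_mpolyC dM dC mul0r add0r.
rewrite mpolyXE_id.
have -> : d (\prod_(i < N) 'X_i ^+ m i) = 0; last by rewrite mulr0.
apply: (big_ind (fun f => d f = 0)) => [|g h g0 h0|j _].
- by rewrite -mpolyC1 dC.
- by rewrite dM g0 h0 mulr0 mul0r addr0.
- by rewrite der_exp dX mulr0.
Qed.

End Derivation.

(** Polynomials are killed by [der_eq0], and then the inverse of [Delta ^+ 2] by the Leibniz
    rule. *)
Lemma derU_eq0 (e : OU -> OU) :
  (forall u v, e (u + v) = e u + e v) -> (forall u v, e (u * v) = e u * v + u * e v) ->
  (forall c, e (polyU c%:MP) = 0) -> (forall j, e (polyU (tnth y j)) = 0) ->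
  forall u, e u = 0.
Proof.
move=> eD eM eC eY.
have eP f : e (polyU f) = 0.
  apply: (@der_eq0 (fun f => e (polyU f))) => // [g h|g h]; first by rewrite rmorphD eD.
  by rewrite rmorphM eM.
have eI : e (invD2 F n) = 0.
  have h := polyU_D2 F n 1; rewrite !expr1 in h.
  have := congr1 e h; rewrite eM eP mul0r add0r.
  rewrite -(rmorph1 (@polyU F r n)) eP => /(congr1 (fun u => invD2 F n * u)).
  by rewrite mulr0 mulrA [invD2 F n * _]mulrC h mul1r.
have eIk k : e (invD2 F n ^+ k) = 0.
  elim: k => [|k IH]; first by rewrite expr0 -(rmorph1 (@polyU F r n)) eP.
  by rewrite exprS eM IH eI mulr0 mul0r addr0.
by move=> u; have [f [k ->]] := OU_repr u; rewrite eM eP eIk mulr0 mul0r addr0.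
Qed.

End BlockPoly.

(** * Averaged differential operators *)

Lemma mderivm_homog (F : numFieldType) N (f : {mpoly F[N]}) (m : 'X_{1..N}) :
  (forall m', m' \in msupp f -> mdeg m' = mdeg m) ->
  f^`M[m] = (f@_m *+ (\prod_(i < N) (m i)`!))%:MP.
Proof.
move=> h; apply/mpolyP => m'; rewrite mcoeff_mderivm mcoeffC.
have [->|ne] := eqVneq m' 0%MM.
  rewrite addm0 mulr1; congr (_ *+ _); apply: eq_bigr => i _.
  by rewrite ffactnn.
rewrite (_ : f@_(m + m') = 0) ?mul0rn.
  by rewrite mulr0.
apply/eqP; rewrite mcoeff_eq0; apply/negP => /h; rewrite mdegD => /eqP.
by rewrite -[X in _ == X]addn0 eqn_add2l mdeg_eq0 (negPf ne).
Qed.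

Section Operators.
Variables (F : numFieldType) (r : nat) (n : 'I_r -> nat).
Local Notation N := (nvars n).
Local Notation OX := {mpoly F[N]}.
Local Notation OU := (OU F n).
Local Notation blk := (@blockof r n).
Local Notation G := (blkg blk).

Variable y : N.-tuple OX.
Hypothesis hy : block_generators y.
Variable dy : 'I_N -> {additive OU -> OU}.
Hypothesis dy_der : forall j, is_derivation (dy j).
Hypothesis dy_y : forall j k, dy j (polyU (tnth y k)) = (j == k)%:R.
Local Notation DV_op := (DV_op y dy).

Lemma dyM j u v : dy j (u * v) = dy j u * v + u * dy j v.
Proof. by case: (dy_der j). Qed.

Lemma dyC j c : dy j (polyU c%:MP) = 0.
Proof. by case: (dy_der j). Qed.

(** The conjugate of [dy j] by [s], minus [dy j], is a derivation killing the constants and all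
    generators, hence is zero. *)
Lemma dy_act j s u : s \in G -> dy j (actU s u) = actU s (dy j u).
Proof.
move=> sG; have sVG : (s^-1)%g \in G by rewrite groupV.
rewrite -[LHS](actUKV sG); congr (actU s _); apply/eqP; rewrite -subr_eq0; apply/eqP.
apply: (derU_eq0 hy (e := fun u => actU s^-1%g (dy j (actU s u)) - dy j u)).
- move=> v w; rewrite actUD // !raddfD /= actUD //.
  by rewrite addrACA.
- move=> v w; rewrite actUM // !dyM actUD // !actUM // !actUK //.
  by rewrite opprD addrACA -mulrBl -mulrBr.
- by move=> c; rewrite actU_const // !dyC actU0 // subrr.
- move=> k; rewrite actU_poly // (y_sym hy) // dy_y.
  case: (j == k); last by rewrite actU0 // subrr.
  by rewrite -(rmorph1 (@polyU F r n)) actU_poly // msym1 subrr.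
Qed.

Lemma DV_op_ext P Q : DV_op P -> P =1 Q -> DV_op Q.
Proof. by move=> h e; rewrite -(funext e). Qed.

Lemma DV_op_poly f : (forall s, s \in G -> msym s f = f) -> DV_op (fun u => polyU f * u).
Proof.
move=> fG; apply: (gen_invariant hy (P := fun f => DV_op (fun u => polyU f * u))) => //.
- exact: DV_const.
- move=> g h hg hh; apply: DV_op_ext (DV_add hg hh) _ => u.
  by rewrite rmorphD mulrDl.
- move=> g h hg hh; apply: DV_op_ext (DV_comp hg hh) _ => u.
  by rewrite /= rmorphM mulrA.
- exact: DV_y.
Qed.

(** Written over a power of the invariant [Delta ^+ 2], an invariant [w] has an invariant
    numerator. *)
Lemma DV_op_inv w : (forall s, s \in G -> actU s w = w) -> DV_op (fun u => w * u).
Proof.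
have [f [k ->]] := OU_repr w => wG.
have fG s : s \in G -> msym s f = f.
  move=> sG; have := wG s sG; rewrite actUE // => e.
  apply: (@polyU_inj F r n); have := congr1 (fun u => u * polyU (Delta F n ^+ 2) ^+ k) e.
  by rewrite -!mulrA ![invD2 _ _ ^+ _ * _]mulrC polyU_D2 !mulr1.
elim: k {wG} => [|k IH].
  by apply: DV_op_ext (DV_op_poly fG) _ => u; rewrite expr0 mulr1.
apply: DV_op_ext (DV_comp (DV_invDelta2 y dy) IH) _ => u /=.
by rewrite (exprS (invD2 F n)) [in RHS](mulrCA (polyU f)) -[in RHS]mulrA.
Qed.

Definition gavg (D : OU -> OU) (u : OU) : OU := \sum_(g in G) actU g (D (actU g^-1%g u)).

Lemma actU_trace (w : OU) s : s \in G ->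
  actU s (\sum_(g in G) actU g w) = \sum_(g in G) actU g w.
Proof.
move=> sG; rewrite actU_sum // [RHS](reindex_inj (mulIg s)) /=.
by apply: eq_big => [g|g gG]; rewrite ?groupMr // actU_mul.
Qed.

(* This holds for all differential operators with coefficients in OU: the     *)
(* group commutes with the [dy j], so averaging only affects the coefficients. *)
Definition gavgDV (D : OU -> OU) := forall w, DV_op (gavg (fun u => w * D u)).

Lemma gavgDV_ext D E : gavgDV D -> D =1 E -> gavgDV E.
Proof. by move=> h e; rewrite -(funext e). Qed.

Lemma gavgDV_id : gavgDV id.
Proof.
move=> w; apply: DV_op_ext (DV_op_inv (@actU_trace w)) _ => u.
rewrite /gavg mulr_suml; apply: eq_bigr => g gG.
by rewrite actUM // actUKV.
Qed.

Lemma gavgDV_mul c D : gavgDV D -> gavgDV (fun u => c * D u).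
Proof.
move=> h w; apply: DV_op_ext (h (w * c)) _ => u; rewrite /gavg.
by under eq_bigr do rewrite -mulrA.
Qed.

Lemma gavgDV_add D E : gavgDV D -> gavgDV E -> gavgDV (fun u => D u + E u).
Proof.
move=> hD hE w; apply: DV_op_ext (DV_add (hD w) (hE w)) _ => u.
rewrite /gavg -big_split; apply: eq_bigr => g gG.
by rewrite mulrDr actUD.
Qed.

Lemma gavgDV_zero : gavgDV (fun=> 0).
Proof.
by apply: gavgDV_ext (gavgDV_mul 0 gavgDV_id) _ => u; rewrite mul0r.
Qed.

Lemma gavgDV_sum (J : Type) (l : seq J) (D : J -> OU -> OU) :
  (forall i, gavgDV (D i)) -> gavgDV (fun u => \sum_(i <- l) D i u).
Proof.
move=> h; elim: l => [|i l IH].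
  by apply: gavgDV_ext gavgDV_zero _ => u; rewrite big_nil.
by apply: gavgDV_ext (gavgDV_add (h i) IH) _ => u; rewrite big_cons.
Qed.

(** By Leibniz, w d(D u) = d(w D u) - d(w) D u, and d = [dy j] commutes with averaging. *)
Lemma gavgDV_dy j D : gavgDV D -> gavgDV (fun u => dy j (D u)).
Proof.
move=> h w; have h1 := DV_comp (DV_dy y dy j) (h w).
have h2 := DV_comp (DV_const y dy (-1)) (h (dy j w)).
apply: DV_op_ext (DV_add h1 h2) _ => u.
rewrite /= polyUN1 mulN1r /gavg raddf_sum -sumrB; apply: eq_bigr => g gG.
rewrite dy_act // dyM actUD //.
by rewrite addrC addrA addNr add0r.
Qed.

(** The derivation d/dx_i on [OU], written by the chain rule. *)
Definition dx (i : 'I_N) (u : OU) : OU := \sum_j polyU ((tnth y j)^`M(i)) * dy j u.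

Lemma dx_poly i f : dx i (polyU f) = polyU f^`M(i).
Proof.
apply/eqP; rewrite -subr_eq0; apply/eqP.
apply: (der_eq0 hy (d := fun f => dx i (polyU f) - polyU f^`M(i))).
- move=> g h; rewrite mderivD !rmorphD opprD /= /dx addrACA -big_split /=.
  by congr (_ + _); apply: eq_bigr => j _; rewrite raddfD mulrDr.
- move=> g h; rewrite mderivM rmorphM rmorphD !rmorphM /= /dx.
  rewrite mulrBl mulrBr mulr_suml mulr_sumr addrACA -big_split /= -opprD.
  congr (_ - _); apply: eq_bigr => j _.
  by rewrite dyM mulrDr mulrA mulrCA.
- move=> c; rewrite mderivC rmorph0 subr0 /dx big1 // => j _.
  by rewrite dyC mulr0.
- move=> k; rewrite /dx (bigD1 k) //= dy_y eqxx mulr1 big1 ?addr0 ?subrr // => j /negPf jk.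
  by rewrite dy_y jk mulr0.
Qed.

Lemma gavgDV_dx i D : gavgDV D -> gavgDV (fun u => dx i (D u)).
Proof. by move=> h; apply: gavgDV_sum => j; apply: gavgDV_mul; apply: gavgDV_dy. Qed.

Lemma gavgDV_mderivm (m : 'X_{1..N}) : exists2 D, gavgDV D &
  forall f, D (polyU f) = polyU f^`M[m].
Proof.
pose l := flatten [seq nseq (m i) i | i <- enum 'I_N].
exists (fun u => foldr dx u l).
  elim: l => [|i l IH] /=; first exact: gavgDV_id.
  exact: gavgDV_dx.
move=> f; rewrite mderivm_foldr -/l; elim: l => //= i l ->.
exact: dx_poly.
Qed.

(** The action on [OU] of the group algebra element with coefficients [z]. *)
Definition opU (z : 'S_N -> F) (u : OU) : OU :=
  \sum_(g in G) polyU (z g)%:MP * actU g u.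

Lemma opU_poly z f : opU z (polyU f) = polyU (\sum_(g in G) z g *: msym g f).
Proof.
rewrite /opU rmorph_sum; apply: eq_bigr => g gG.
by rewrite actU_poly // -mul_mpolyC rmorphM.
Qed.

(* P is the average over the group of w * D, where D extracts the coefficient *)
(* of [mono T] from the forms of degree [mdeg (mono T)].                      *)
Lemma ecoef_DV (T : tableau N) (w : OU) :
  exists2 P, DV_op P & P (polyU (spoly F blk T)) = opU (ecoef F blk T) w.
Proof.
have [D DV DE] := gavgDV_mderivm (mono T).
pose c : F := (\prod_(i < N) (mono T i)`!)%:R.
have c0 : c != 0.
  rewrite pnatr_eq0 -lt0n; apply/prodn_gt0 => i; exact: fact_gt0.
exists (gavg (fun u => (polyU (c^-1)%:MP * w) * D u)); first exact: DV.
rewrite /gavg /opU; apply: eq_bigr => g gG; have gVG : (g^-1)%g \in G by rewrite groupV.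
rewrite actU_poly // DE mderivm_homog; last first.
  move=> m; rewrite mcoeff_msupp mcoeff_sym -mcoeff_msupp => /csum_supp[t _].
  by rewrite msuppX inE => /eqP e; rewrite -e !mdeg_perm.
rewrite -/(ecoef F blk T g) -mulr_natr -/c; set e := ecoef F blk T g.
have -> : polyU c^-1%:MP * w * polyU (e * c)%:MP = polyU e%:MP * w.
  by rewrite mulrAC -rmorphM -mpolyCM mulrCA mulVf // mulr1.
by rewrite actUM // actU_const.
Qed.

Lemma DV_act P s u : DV_op P -> s \in G -> P (actU s u) = actU s (P u).
Proof.
move=> hP sG; elim: hP u => [c|j||j|P1 P2 _ IH1 _ IH2|P1 P2 _ IH1 _ IH2] u.
- by rewrite actUM // actU_const.
- by rewrite actUM // actU_poly // (y_sym hy).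
- rewrite actUM //; congr (_ * _); have := actUE (F := F) 1 1 sG.
  by rewrite expr1 !rmorph1 !mul1r.
- exact: dy_act.
- by rewrite IH1 IH2 actUD.
- by rewrite /= IH2 IH1.
Qed.

Lemma DV_opD P u v : DV_op P -> P (u + v) = P u + P v.
Proof. by move=> hP; exact: (DV_valD (MkDV (introT (asboolP _) hP)) u v). Qed.

Lemma DV_op_0 P : DV_op P -> P 0 = 0.
Proof. by move=> hP; apply: (addrI (P 0)); rewrite -DV_opD // !addr0. Qed.

Lemma DV_opZ P (c : F) u : DV_op P -> P (polyU c%:MP * u) = polyU c%:MP * P u.
Proof.
move=> hP; elim: hP u => [b|j||j|P1 P2 _ IH1 _ IH2|P1 P2 _ IH1 _ IH2] u.
- exact: mulrCA.
- exact: mulrCA.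
- exact: mulrCA.
- by rewrite dyM dyC mul0r add0r.
- by rewrite IH1 IH2 mulrDr.
- by rewrite /= IH2 IH1.
Qed.

Lemma DV_opU P z u : DV_op P -> P (opU z u) = opU z (P u).
Proof.
move=> hP; rewrite /opU (big_morph P (fun u v => DV_opD u v hP) (DV_op_0 hP)).
by apply: eq_bigr => g gG; rewrite DV_opZ // DV_act.
Qed.

End Operators.

(** * The decomposition *)

Section Decomposition.
Variables (F : numFieldType) (r : nat) (n : 'I_r -> nat).
Local Notation N := (nvars n).
Local Notation OX := {mpoly F[N]}.
Local Notation OU := (OU F n).
Local Notation blk := (@blockof r n).
Local Notation G := (blkg blk).

Variable y : N.-tuple OX.
Hypothesis hy : block_generators y.
Variable dy : 'I_N -> {additive OU -> OU}.
Hypothesis dy_der : forall j, is_derivation (dy j).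
Hypothesis dy_y : forall j k, dy j (polyU (tnth y k)) = (j == k)%:R.
Local Notation DV_op := (DV_op y dy).
Local Notation Mod := (OU_mod y dy).
Local Notation stdtab := (stdtab n).
Local Notation sp x := (spoly F blk (tableau_of x)).
Local Notation es x := (esum blk (tableau_of x)).

Let tabP : forall x : stdtab, tab_of blk (rowlen (tabshape x)) (tableau_of x) := @tableau_ofP r n.

Lemma cyclicP (v u : OU) : cyclic_submod (v : Mod) u <-> exists2 P, DV_op P & u = P v.
Proof.
split=> [[P ->]|[P hP ->]]; first by exists (DV_val P); [exact: DV_valP|].
by exists (MkDV (introT (asboolP _) hP)).
Qed.

Lemma cyclic_scale (c : F) (f : OX) u : c != 0 ->
  cyclic_submod (polyU (c *: f) : Mod) u <-> exists2 P, DV_op P & u = P (polyU f).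
Proof.
move=> c0; rewrite cyclicP -mul_mpolyC rmorphM; split=> -[P hP ->].
  exists (fun v => P (polyU c%:MP * v)) => //.
  exact: (DV_comp hP (DV_const y dy c)).
exists (fun v => P (polyU (c^-1)%:MP * v)).
  exact: (DV_comp hP (DV_const y dy c^-1)).
by rewrite mulrA -rmorphM -mpolyCM mulVf // rmorph1 mul1r.
Qed.

Lemma num_std_gt0 (lam : diagram n) (T : NST lam) i : (0 < num_std (lam i))%N.
Proof. by apply/card_gt0P; exists (sval T i); rewrite inE; apply: NST_std. Qed.

Lemma specht_stdE (x : stdtab) : specht_std F (tagged x) =
  spconst (sval (tagged x)) F *: sp x.
Proof. by rewrite /specht_std spechtE //; apply: NST_bij. Qed.

Lemma spconst_std_neq0 (x : stdtab) : spconst (sval (tagged x)) F != 0.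
Proof.
apply: spconst_neq0 => i; [exact: NST_bij|exact: num_std_gt0 (tagged x) _].
Qed.

Definition in_component (x : stdtab) (u : OU) := exists2 P, DV_op P & u = P (polyU (sp x)).

Lemma cyclic_specht (x : stdtab) u :
  cyclic_submod (polyU (specht_std F (tagged x)) : Mod) u <-> in_component x u.
Proof. by rewrite specht_stdE cyclic_scale // spconst_std_neq0. Qed.

Lemma in_component0 x : in_component x 0.
Proof.
by exists (fun u => polyU 0%:MP * u); [exact: DV_const|rewrite polyU0 mul0r].
Qed.

Lemma in_componentD x u v : in_component x u -> in_component x v -> in_component x (u + v).
Proof.
by move=> [P hP ->] [Q hQ ->]; exists (fun u => P u + Q u) => //; apply: DV_add.
Qed.

Lemma in_component_DV x P u : DV_op P -> in_component x u -> in_component x (P u).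
Proof.
by move=> hP [Q hQ ->]; exists (P \o Q) => //; apply: DV_comp.
Qed.

Lemma in_componentZ x c u : in_component x u -> in_component x (polyU c%:MP * u).
Proof. by apply: in_component_DV; apply: DV_const. Qed.

Lemma in_componentB x u v : in_component x u -> in_component x v -> in_component x (u - v).
Proof.
move=> hu /(in_componentZ (-1)) hv; rewrite -mulN1r -(polyUN1 F n).
exact: in_componentD.
Qed.

(** Take the first [x] with [v x] non-zero. Its symmetrizer commutes with D_V, so it kills the other
    terms together with their Specht polynomials, and it multiplies [v x] by a non-zero scalar. *)
Lemma component_sum_eq0 (v : stdtab -> OU) : (forall x, in_component x (v x)) ->
  \sum_x v x = 0 -> forall x, v x = 0.
Proof.
move=> hv z x0; apply/eqP/negPn/negP => vx0.
have [x vx h] := pick_first F (@rowlen_inj r n) tabP (@tableau_of_std r n)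
  (@tableau_of_inj r n) (A := fun x => v x != 0) vx0.
have opD : {morph opU (ecoef F blk (tableau_of x)) : u w / u + w}.
  move=> u w; rewrite /opU -big_split; apply: eq_bigr => g gG.
  by rewrite actUD // mulrDr.
have op0 : opU (ecoef F blk (tableau_of x)) 0 = 0.
  by rewrite /opU big1 // => g gG; rewrite actU0 // mulr0.
have opv x' : exists2 P, DV_op P & v x' = P (polyU (sp x')) /\
   opU (ecoef F blk (tableau_of x)) (v x') = P (polyU (es x (sp x'))).
  have [P hP vE] := hv x'; exists P => //; split=> //.
  by rewrite vE -(DV_opU hy dy_der dy_y) // opU_poly sum_ecoef.
move/(congr1 (opU (ecoef F blk (tableau_of x)))): z.
rewrite (big_morph _ opD op0) op0 (bigD1 x) //= big1 ?addr0 => [|x' x'x]; last first.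
  have [-> //|vx'] := eqVneq (v x') 0.
  by have [P hP [_ ->]] := opv x'; rewrite h // rmorph0 (DV_op_0 hP).
have [P hP [vE ->]] := opv x.
have [c c0 ->] := esum_spolyE F tabP x.
rewrite -mul_mpolyC rmorphM (DV_opZ dy_der _ _ hP) -vE.
move=> /(congr1 (fun u => polyU (c^-1)%:MP * u)); rewrite mulr0 mulrA -rmorphM.
by rewrite -mpolyCM mulVf // rmorph1 mul1r => /eqP; rewrite (negPf vx).
Qed.

(** Apply the expression of 1 from [one_theta] to [u]: each term is a multiple of e_x applied to a
    translate of [u], and lies in the component of [x] by [ecoef_DV]. *)
Lemma component_sum u : exists v : stdtab -> OU, (forall x, in_component x (v x)) /\ u = \sum_x v x.
Proof.
have [smap smapP] : exists smap : stdtab -> stdtab -> 'S_N, forall x x', tabshape x = tabshape x' ->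
    tmap blk (tableau_of x) (tableau_of x') (smap x x').
  have h (p : stdtab * stdtab) : exists s, tabshape p.1 = tabshape p.2 ->
      tmap blk (tableau_of p.1) (tableau_of p.2) s.
    case: (eqVneq (tabshape p.1) (tabshape p.2)) => [e|/eqP ne]; last by exists 1%g.
    by have [s sP] := tmapP_subproof tabP e; exists s.
  have [f fP] := @choice _ _ _ h.
  by exists (fun x x' => f (x, x')) => x x'; apply: (fP (x, x')).
have [a aP] := one_theta F (@rowlen_inj r n) tabP (@tableau_of_std r n)
  (@tableau_of_inj r n) smapP (card_blkg_stdtab n).
pose w p := polyU (a p)%:MP * opU (ecoef F blk (tableau_of p.1)) (actU (smap p.2 p.1) u).
exists (fun x => \sum_(x' | tabshape x == tabshape x') w (x, x')); split=> [x|].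
  apply: (big_ind (in_component x)); [exact: in_component0|exact: in_componentD|] => x' _.
  apply: in_componentZ;
  have [P hP <-] := ecoef_DV hy dy_der dy_y (tableau_of x) (actU (smap x' x) u).
  by exists P.
rewrite pair_big_dep /=.
transitivity (\sum_(h in G) polyU ((h == 1%g)%:R : F)%:MP * actU h u).
  rewrite (bigD1 1%g) ?group1 //= eqxx actU1 rmorph1 mul1r big1 ?addr0 // => h /andP[_ /negPf ->].
  by rewrite mpolyC0 rmorph0 mul0r.
transitivity (\sum_(p | tabshape p.1 == tabshape p.2) \sum_(h in G)
    polyU (a p * theta F blk (@tableau_of r n) smap p.1 p.2 h)%:MP * actU h u).
  rewrite exchange_big /=; apply: eq_bigr => h hG.
  by rewrite aP // -mulr_suml raddf_sum rmorph_sum.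
apply: eq_big => -[x x'] //= /eqP e; have sG := tmap_blk (smapP _ _ (esym e)).
rewrite /w /opU mulr_sumr (reindex_inj (mulgI (smap x' x))) /=.
apply: eq_big => [h|h]; first by rewrite groupMl.
rewrite groupMl // => hG.
by rewrite mpolyCM rmorphM -mulrA /theta mulKg (actU_mul _ sG hG).
Qed.

Lemma direct_sum_specht : is_direct_sum Mod
  (fun x : stdtab => cyclic_submod (polyU (specht_std F (tagged x)) : Mod)).
Proof.
move=> u; have [v [hv uE]] := component_sum u.
exists [ffun x => v x]; split.
  by split=> [x|]; [rewrite ffunE cyclic_specht|rewrite uE; apply: eq_bigr => x _; rewrite ffunE].
move=> g [hg gE]; apply/ffunP => x; rewrite ffunE.
apply/eqP; rewrite -subr_eq0; apply/eqP.
apply: (@component_sum_eq0 (fun x => v x - g x)) => [x'|].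
  by apply: in_componentB => //; apply/cyclic_specht.
by rewrite sumrB -uE; apply/eqP; rewrite subr_eq0; apply/eqP.
Qed.

(** * Moving each summand to that of the canonical tableau *)

Let canon (lam : diagram n) := tabof (canon_tab lam).

Lemma canon_tab_bij (lam : diagram n) i : fill_bij (canon_tab lam i).
Proof. by rewrite ffunE; apply: canon_bij. Qed.

Lemma specht_canonE (lam : diagram n) :
  specht_canon F lam = spconst (canon_tab lam) F *: spoly F blk (canon lam).
Proof. by rewrite /specht_canon spechtE //; apply: canon_tab_bij. Qed.

Lemma canonP (lam : diagram n) : tab_of blk (rowlen lam) (canon lam).
Proof. by apply: tabof_tab; apply: canon_tab_bij. Qed.

Lemma tocanon_exists (x : stdtab) :
  exists s, tmap blk (tableau_of x) (canon (tabshape x)) s.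
Proof. exact: tmap_exists (tabP x) (canonP _). Qed.

Definition tocanon x := projT1 (cid (tocanon_exists x)).

Lemma tocanonP x : tmap blk (tableau_of x) (canon (tabshape x)) (tocanon x).
Proof. exact: projT2 (cid (tocanon_exists x)). Qed.

Lemma tocanonG x : tocanon x \in G.
Proof. exact: tmap_blk (tocanonP x). Qed.

(** The permutation [tocanon x] commutes with D_V and sends the Specht polynomial of [x] to that of
    the canonical tableau of its shape. *)
Lemma cyclic_canon (x : stdtab) u :
  cyclic_submod (polyU (specht_canon F (tabshape x)) : Mod) (actU (tocanon x) u) <->
  in_component x u.
Proof.
rewrite specht_canonE cyclic_scale; last first.
  apply: spconst_neq0 => i; [exact: canon_tab_bij|exact: num_std_gt0 (tagged x) i].
have e := msym_spoly F (tocanonP x).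
split=> -[P hP uE]; exists P => //.
  apply: (can_inj (actUK (tocanonG x))); rewrite uE -(DV_act hy dy_der dy_y _ hP (tocanonG x)).
  by rewrite (actU_poly _ (tocanonG x)) e.
by rewrite uE -(DV_act hy dy_der dy_y _ hP (tocanonG x)) (actU_poly _ (tocanonG x)) e.
Qed.

Definition component (u : OU) : {ffun stdtab -> OU} := projT1 (cid (direct_sum_specht u)).

Lemma componentP u : (forall x, in_component x (component u x)) /\ u = \sum_x component u x.
Proof.
rewrite /component; case: cid => g [[hg gE] _] /=; split=> // x.
exact/cyclic_specht.
Qed.

Lemma component_uniq u (g : stdtab -> OU) : (forall x, in_component x (g x)) -> u = \sum_x g x ->
  component u =1 g.
Proof.
move=> hg uE x; have [hc cE] := componentP u; apply/eqP; rewrite -subr_eq0; apply/eqP.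
apply: (@component_sum_eq0 (fun x => component u x - g x)) => [x'|]; first exact: in_componentB.
by rewrite sumrB -uE -cE subrr.
Qed.

Lemma component_linear P u v x : DV_op P ->
  component (P u + v) x = P (component u x) + component v x.
Proof.
move=> hP; have [hu uE] := componentP u; have [hv vE] := componentP v.
apply: (@component_uniq _ (fun x => P (component u x) + component v x)) => [x'|].
  by apply: in_componentD => //; apply: in_component_DV.
rewrite big_split /= -vE; congr (_ + _).
by rewrite {1}uE (big_morph P (fun u v => DV_opD u v hP) (DV_op_0 hP)).
Qed.

(** The isomorphism splits [u] into its components and moves each one by [tocanon]. The index type
    is left free so that the copies can be numbered by a dimension. *)
Lemma iso_direct_sum_of_bij (J : finType) (th : J -> stdtab) (sh : J -> diagram n) :
  bijective th -> (forall k, tabshape (th k) = sh k) ->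
  iso_direct_sum Mod (fun k : J => cyclic_submod (polyU (specht_canon F (sh k)) : Mod)).
Proof.
case=> ti thK tiK sE.
pose phi0 (u : Mod) : {ffun J -> Mod} := [ffun k => actU (tocanon (th k)) (component u (th k))].
have phi_lin : linear phi0.
  move=> P u v; apply/ffunP => k; rewrite !ffunE.
  have hP := DV_valP P.
  rewrite (component_linear _ _ _ hP) (actUD (tocanonG _)); congr (_ + _).
  by rewrite -(DV_act hy dy_der dy_y _ hP (tocanonG _)).
pose phi : {linear Mod -> {ffun J -> Mod}} :=
  HB.pack phi0 (GRing.isLinear.Build _ _ _ _ phi0 phi_lin).
exists phi; split=> [u v /ffunP uv|g].
  rewrite (proj2 (componentP u)) (proj2 (componentP v)); apply: eq_bigr => x _.
  have := uv (ti x); rewrite /= !ffunE tiK.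
  exact: (can_inj (actUK (tocanonG x))).
split=> [[u <-] k|hg].
  by rewrite /= ffunE -sE cyclic_canon; apply: (proj1 (componentP u)).
pose v x := actU (tocanon x)^-1%g (g (ti x)).
have hv x : in_component x (v x).
  by rewrite -cyclic_canon /v actUKV ?tocanonG // -{1}(tiK x) sE.
exists (\sum_x v x); apply/ffunP => k; rewrite /= ffunE.
by rewrite (component_uniq hv) // /v actUKV ?tocanonG // thK.
Qed.

(** The F_T of one shape are non-zero multiples of members of the independent family of all Specht
    polynomials. *)
Lemma specht_dimE (lam : diagram n) : specht_dim F lam = #|NST lam|.
Proof.
apply: (@dimensionE _ _ _ _ (fun k => specht_std F (enum_val k))); split=> [w|c c0 k].
  split=> -[c ->].
    exists (fun k => c (enum_val k)).
    by rewrite (reindex (@enum_val _ (NST lam))) //=; apply/onW_bij/enum_val_bij.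
  exists (fun T => c (enum_rank T)).
  rewrite [RHS](reindex (@enum_val _ (NST lam))); last exact/onW_bij/enum_val_bij.
  by apply: eq_bigr => k _; rewrite enum_valK.
pose std (T : NST lam) : stdtab := existT _ lam T.
have std_inj : injective std.
  by move=> T T' e; apply: (@eq_from_Tagged _ (fun l : diagram n => NST l : Type) lam).
(* A relation among tableaux of shape [lam] is extended by zero to all shapes, so that [spoly_free]
   applies. *)
pose d (x : stdtab) : F := if [pick T | std T == x] is Some T
  then c (enum_rank T) * spconst (sval T) F else 0.
have dE T : d (std T) = c (enum_rank T) * spconst (sval T) F.
  by rewrite /d; case: pickP => [T' /eqP/std_inj -> //|/(_ T)]; rewrite eqxx.
have dz : \sum_x d x *: sp x = 0.
  rewrite (bigID (mem [set std T | T : NST lam])) /= [X in _ + X]big1 ?addr0.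
    rewrite big_imset /=; last by move=> T T' _ _ /std_inj.
    rewrite -[RHS]c0 (reindex (@enum_val _ (NST lam))) /=; last exact/onW_bij/enum_val_bij.
    apply: eq_big => // j _; rewrite dE enum_valK -scalerA.
    by rewrite (specht_stdE (std (enum_val j))).
  move=> x xT; rewrite /d; case: pickP => [T /eqP Tx|]; last by rewrite scale0r.
  by case/imsetP: xT; exists T.
have := spoly_free (@rowlen_inj r n) tabP (@tableau_of_std r n) (@tableau_of_inj r n) dz.
move=> /(_ (std (enum_val k))) /eqP; rewrite dE enum_valK mulf_eq0.
by rewrite (negPf (spconst_std_neq0 (std (enum_val k)))) orbF => /eqP.
Qed.

Lemma iso_direct_sum_specht : iso_direct_sum Mod
  (fun lk : {lam : diagram n & 'I_(specht_dim F lam)} =>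
     cyclic_submod (polyU (specht_canon F (tag lk)) : Mod)).
Proof.
pose J := {lam : diagram n & 'I_(specht_dim F lam)}.
pose th (k : J) : stdtab :=
  existT _ (tag k) (enum_val (cast_ord (specht_dimE (tag k)) (tagged k))).
pose ti (x : stdtab) : J :=
  existT _ (tag x) (cast_ord (esym (specht_dimE (tag x))) (enum_rank (tagged x))).
apply: (@iso_direct_sum_of_bij _ th) => //.
exists ti => [[lam k]|[lam T]]; rewrite /th /ti /=.
  by rewrite enum_valK cast_ordK.
by rewrite cast_ordKV enum_rankK.
Qed.

End Decomposition.

Theorem proposition3p7 (R : realType) (r : nat) (n : 'I_r -> nat)
    (r_gt0 : (0 < r)%N) (n_gt0 : forall i, (0 < n i)%N)
    (y : (nvars n).-tuple {mpoly R[i][nvars n]})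
    (hy : block_generators y)
    (dy : 'I_(nvars n) -> {additive OU R[i] n -> OU R[i] n})
    (dy_der : forall j, is_derivation (dy j))
    (dy_y : forall j k, dy j (polyU (tnth y k)) = (j == k)%:R) :
  is_direct_sum (OU_mod y dy)
    (fun lT : {lam : diagram n & NST lam} =>
       cyclic_submod (polyU (specht_std R[i] (tagged lT)) : OU_mod y dy))
  /\
  iso_direct_sum (OU_mod y dy)
    (fun lk : {lam : diagram n & 'I_(specht_dim R[i] lam)} =>
       cyclic_submod (polyU (specht_canon R[i] (tag lk)) : OU_mod y dy)).
Proof.
split; first exact: (direct_sum_specht hy dy_der dy_y).
exact: (iso_direct_sum_specht hy dy_der dy_y).
Qed.
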